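(* Let $n,m\ge2$, $g=\gcd(n,m)$ and $X=S^2(n,m)$. Fix a symplectic form $\omega$ on $X$ for which the integrality condition $$\frac{1}{2\pi\hbar}\int_X\omega=d_0+\frac{a}{n}+\frac{b}{m}$$ holds for some $d_0\in\mathbb{Z}$, $a\in\{0,\dots,n-1\}$, $b\in\{0,\dots,m-1\}$, and fix one prequantum bundle $(L,\nabla)$ with curvature $-\frac{i}{\hbar}\omega$. Then every other prequantum bundle with the same curvature is (isomorphic to one) of the form $(L,\nabla)\otimes F_\chi$, where $F_\chi$ is a flat orbifold line bundle determined by a character $\chi\in\mathrm{Hom}(\pi_1^{\mathrm{orb}}(X),U(1))$. In particular, when $\gcd(n,m)=1$ there is no torsion ambiguity, whereas when $\gcd(n,m)>1$ there are precisely $g$ discrete flat sectors.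
   Context: $S^2(n,m)$ is the oriented effective 2-orbifold with underlying space $S^2$ and exactly two cone points, with local models $D/\mathbb{Z}_n$ and $D/\mathbb{Z}_m$ ($D\subset\mathbb{C}$ a disk, the generator acting by $u\mapsto e^{2\pi i/n}u$, resp. $u\mapsto e^{2\pi i/m}u$). Orbifold forms, line bundles and connections are given on uniformizing charts by invariant forms, equivariant line bundles and equivariant connections, compatibly glued; orbifold integration weights each chart with group $G$ by $1/|G|$. A prequantum bundle is a Hermitian orbifold line bundle with unitary orbifold connection of curvature $-\frac{i}{\hbar}\omega$; isomorphisms are unitary and connection-preserving. $\pi_1^{\mathrm{orb}}(X)=\langle x_1,x_2\mid x_1^n=x_2^m=x_1x_2=1\rangle\cong\mathbb{Z}_g$ is the orbifold fundamental group. Flat (unitary) orbifold line bundles are those with zero curvature; $F_\chi$ is the one with holonomy character $\chi$. ''Flat sectors'' are the isomorphism classes of prequantum bundles with the given curvature. $\hbar>0$ is fixed. *)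

(* Defs.v *)
From Stdlib Require Import Reals Lra Lia List ZArith.
From Coquelicot Require Import Coquelicot.
Open Scope C_scope.

Definition Dx (f : C -> R) (z : C) : R := Derive (fun x => f (x, Im z)) (Re z).
Definition Dy (f : C -> R) (z : C) : R := Derive (fun y => f (Re z, y)) (Im z).

Fixpoint Ck (k : nat) (U : C -> Prop) (f : C -> R) : Prop :=
  (forall z, U z -> continuous f z) /\
  match k with
  | O => True
  | S k' =>
      (forall z, U z -> ex_derive (fun x => f (x, Im z)) (Re z) /\
                        ex_derive (fun y => f (Re z, y)) (Im z)) /\
      Ck k' U (Dx f) /\ Ck k' U (Dy f)
  end.

Definition smooth (U : C -> Prop) (f : C -> R) : Prop := forall k, Ck k U f.

Definition csmooth (U : C -> Prop) (f : C -> C) : Prop :=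
  smooth U (fun z => Re (f z)) /\ smooth U (fun z => Im (f z)).

Definition CDx (f : C -> C) (z : C) : C :=
  (Dx (fun w => Re (f w)) z, Dx (fun w => Im (f w)) z).
Definition CDy (f : C -> C) (z : C) : C :=
  (Dy (fun w => Re (f w)) z, Dy (fun w => Im (f w)) z).

(** The orbifold S^2(n,m) has two uniformizing charts, both the plane C (an open disk up to equivariant
    diffeomorphism), with Z_n, resp. Z_m, acting by rotations.  The chart
    quotients C/Z_n and C/Z_m are the complements of one cone point each; they
    are glued along u^n v^m = 1, i.e. the sphere has the coordinate u^n on the
    first and its inverse v^m on the second.  The gluing is holomorphic, so X
    is oriented by the standard orientation of both charts.

    A point of the disjoint union of the two charts is a pair (chart, z).
    [arrow n m p q d] says that the effective orbifold groupoid has an arrow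
    from p to q, i.e. the germ at p of a change of uniformizing chart taking p
    to q; all such changes are holomorphic, and d is the complex derivative of
    the germ at p.  Together with p and q it determines the germ: within a
    chart it is the rotation u |-> d u, and across charts it is the local
    solution v(u) of u^n v^m = 1 through the given points.  Composition of
    arrows multiplies the derivatives. *)

Inductive chart : Set := north | south.

Definition point : Type := (chart * C)%type.

Definition cone_order (n m : nat) (k : chart) : nat :=
  match k with north => n | south => m end.

Definition arrow (n m : nat) (p q : point) (d : C) : Prop :=
  let (k, z) := p in
  let (l, w) := q in
  let a := cone_order n m k in
  let b := cone_order n m l in
  match k, l with
  | north, north | south, south => d ^ a = 1 /\ w = d * z
  | north, south | south, north =>
      z ^ a * w ^ b = 1 /\ d = - (INR a * w) / (INR b * z)
  end.

(* A smooth family of arrows over the open subset W of the chart k, with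
   targets (l, phi z) and derivatives delta z. *)
Definition local_change (n m : nat) (k l : chart) (W : C -> Prop)
    (phi delta : C -> C) : Prop :=
  open W /\ csmooth W phi /\ csmooth W delta /\
  forall z, W z -> arrow n m (k, z) (l, phi z) (delta z).

(** A 2-form is given by its coefficient with respect to dx /\ dy in each
    chart; the pullback by a holomorphic germ of derivative d multiplies the
    coefficient by |d|^2.  Every 2-form on a surface is closed. *)

Definition orb_2form (n m : nat) (w : point -> R) : Prop :=
  (forall k, smooth (fun _ => True) (fun z => w (k, z))) /\
  (forall p q d, arrow n m p q d -> w p = (w q * (Cmod d) ^ 2)%R).

Definition symplectic (n m : nat) (w : point -> R) : Prop :=
  orb_2form n m w /\ forall p, w p <> 0%R.

Definition unit_disk_integral (f : C -> R) : R :=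
  RInt (fun x => RInt (fun y => f (x, y)) (- sqrt (1 - x ^ 2)) (sqrt (1 - x ^ 2)))
    (-1) 1.

(* X is the union of the images of the two closed unit disks, which overlap
   only in the circle |u| = |v| = 1. *)
Definition orb_integral (n m : nat) (w : point -> R) : R :=
  (/ INR n * unit_disk_integral (fun z => w (north, z))
   + / INR m * unit_disk_integral (fun z => w (south, z)))%R.

Definition covector : Type := (R * R)%type.

Definition pairing (A : covector) (v : C) : R :=
  (fst A * Re v + snd A * Im v)%R.

(* The bundle is given by unitary frames s_i over the members lb_dom i of an
   arbitrary open cover of the disjoint union of the charts.  An arrow a from p
   to q acts by s_i(p) |-> lb_tr i j p q d * s_j(q); the arrows with p = q and
   d = 1 give the transition functions of the underlying bundles over the
   charts.  The connection is nabla s_i = - i A_i s_i, with A_i = lb_conn i a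
   real 1-form; the last field says that arrows preserve it, that is,
   dg = i g (phi^* A_j - A_i) for the function g representing the action of a
   smooth family of arrows. *)
Record line_bundle (n m : nat) : Type := LineBundle {
  lb_idx : Type;
  lb_dom : lb_idx -> point -> Prop;
  lb_tr : lb_idx -> lb_idx -> point -> point -> C -> C;
  lb_conn : lb_idx -> point -> covector;
  lb_open : forall i k, open (fun z : C => lb_dom i (k, z));
  lb_cover : forall p, exists i, lb_dom i p;
  lb_unitary : forall i j p q d, lb_dom i p -> lb_dom j q -> arrow n m p q d ->
    Cmod (lb_tr i j p q d) = 1%R;
  lb_cocycle : forall i j l p q r d e,
    lb_dom i p -> lb_dom j q -> lb_dom l r ->
    arrow n m p q d -> arrow n m q r e ->
    lb_tr i l p r (e * d) = lb_tr j l q r e * lb_tr i j p q d;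
  lb_tr_smooth : forall i j k l W phi delta, local_change n m k l W phi delta ->
    (forall z, W z -> lb_dom i (k, z) /\ lb_dom j (l, phi z)) ->
    csmooth W (fun z => lb_tr i j (k, z) (l, phi z) (delta z));
  lb_conn_smooth : forall i k,
    smooth (fun z => lb_dom i (k, z)) (fun z => fst (lb_conn i (k, z))) /\
    smooth (fun z => lb_dom i (k, z)) (fun z => snd (lb_conn i (k, z)));
  lb_conn_tr : forall i j k l W phi delta, local_change n m k l W phi delta ->
    (forall z, W z -> lb_dom i (k, z) /\ lb_dom j (l, phi z)) ->
    let g := fun z => lb_tr i j (k, z) (l, phi z) (delta z) in
    forall z, W z ->
      CDx g z = Ci * g z * RtoC (pairing (lb_conn j (l, phi z)) (delta z * 1)
                                 - pairing (lb_conn i (k, z)) 1) /\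
      CDy g z = Ci * g z * RtoC (pairing (lb_conn j (l, phi z)) (delta z * Ci)
                                 - pairing (lb_conn i (k, z)) Ci)
}.

Arguments LineBundle {n m}.
Arguments lb_idx {n m}.
Arguments lb_dom {n m}.
Arguments lb_tr {n m}.
Arguments lb_conn {n m}.

(* The coefficient of d(- i A_i) with respect to dx /\ dy. *)
Definition curvature {n m : nat} (L : line_bundle n m) (i : lb_idx L) (p : point) : C :=
  - Ci * RtoC (Dx (fun z => snd (lb_conn L i (fst p, z))) (snd p)
               - Dy (fun z => fst (lb_conn L i (fst p, z))) (snd p)).

Definition prequantum {n m : nat} (hbar : R) (w : point -> R)
    (L : line_bundle n m) : Prop :=
  forall i p, lb_dom L i p -> curvature L i p = - (Ci / hbar) * w p.

Definition flat {n m : nat} (L : line_bundle n m) : Prop :=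
  forall i p, lb_dom L i p -> curvature L i p = 0.

(* s_i(p) |-> f i j p * s'_j(p), over the identity of X. *)
Definition isomorphic {n m : nat} (L M : line_bundle n m) : Prop :=
  exists f : lb_idx L -> lb_idx M -> point -> C,
    (forall i j p, lb_dom L i p -> lb_dom M j p -> Cmod (f i j p) = 1%R) /\
    (forall i i' j j' p q d,
       lb_dom L i p -> lb_dom L i' q -> lb_dom M j p -> lb_dom M j' q ->
       arrow n m p q d ->
       f i' j' q * lb_tr L i i' p q d = lb_tr M j j' p q d * f i j p) /\
    (forall i j k,
       let U := fun z => lb_dom L i (k, z) /\ lb_dom M j (k, z) in
       let h := fun z => f i j (k, z) in
       csmooth U h /\
       forall z, U z ->
         CDx h z = Ci * h z * RtoC (pairing (lb_conn M j (k, z)) 1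
                                    - pairing (lb_conn L i (k, z)) 1) /\
         CDy h z = Ci * h z * RtoC (pairing (lb_conn M j (k, z)) Ci
                                    - pairing (lb_conn L i (k, z)) Ci)).

Lemma Ck_cont k U f : Ck k U f -> forall z, U z -> continuous f z.
Proof. destruct k; intros [H _]; exact H. Qed.

Lemma Ck_pred k U f : Ck (S k) U f -> Ck k U f.
Proof.
  revert f; induction k as [|k IH]; intros f [Hc [He [Hx Hy]]].
  - split; [exact Hc | exact I].
  - split; [exact Hc|]. split; [exact He|]. split; apply IH; assumption.
Qed.

Lemma Ck_subset k (U V : C -> Prop) f :
  (forall z, V z -> U z) -> Ck k U f -> Ck k V f.
Proof.
  intros HVU; revert f; induction k as [|k IH]; intros f [Hc H].
  - split; [intros z Hz; apply Hc, HVU, Hz | exact I].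
  - destruct H as [He [Hx Hy]].
    split; [intros z Hz; apply Hc, HVU, Hz|].
    split; [intros z Hz; apply He, HVU, Hz|].
    split; apply IH; assumption.
Qed.

Lemma open_x (U : C -> Prop) z : open U -> U z -> locally (Re z) (fun x => U (x, Im z)).
Proof.
  intros HU Hz. destruct (HU z Hz) as [e He]. exists e. intros x Hx.
  apply He. split; [exact Hx | apply ball_center].
Qed.

Lemma open_y (U : C -> Prop) z : open U -> U z -> locally (Im z) (fun y => U (Re z, y)).
Proof.
  intros HU Hz. destruct (HU z Hz) as [e He]. exists e. intros y Hy.
  apply He. split; [apply ball_center | exact Hy].
Qed.

Lemma Ck_ext k (U : C -> Prop) f g : open U ->
  (forall z, U z -> f z = g z) -> Ck k U f -> Ck k U g.
Proof.
  intros HU; revert f g; induction k as [|k IH]; intros f g Hfg [Hc H].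
  - split; [|exact I]. intros z Hz. apply continuous_ext_loc with f.
    + apply filter_imp with U; [exact Hfg | apply HU, Hz].
    + apply Hc, Hz.
  - destruct H as [He [Hx Hy]]. repeat split.
    + intros z Hz. apply continuous_ext_loc with f.
      * apply filter_imp with U; [exact Hfg | apply HU, Hz].
      * apply Hc, Hz.
    + apply ex_derive_ext_loc with (fun x => f (x, Im z)).
      * apply filter_imp with (fun x => U (x, Im z)); [intros x; apply Hfg|].
        apply open_x; assumption.
      * apply He; assumption.
    + apply ex_derive_ext_loc with (fun y => f (Re z, y)).
      * apply filter_imp with (fun y => U (Re z, y)); [intros y; apply Hfg|].
        apply open_y; assumption.
      * apply He; assumption.
    + apply IH with (Dx f); [|exact Hx]. intros z Hz. apply Derive_ext_loc.
      apply filter_imp with (fun x => U (x, Im z)); [intros x; apply Hfg|].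
      apply open_x; assumption.
    + apply IH with (Dy f); [|exact Hy]. intros z Hz. apply Derive_ext_loc.
      apply filter_imp with (fun y => U (Re z, y)); [intros y; apply Hfg|].
      apply open_y; assumption.
Qed.

Lemma Ck_plus k (U : C -> Prop) f g : open U -> Ck k U f -> Ck k U g ->
  Ck k U (fun z => f z + g z)%R.
Proof.
  intros HU; revert f g; induction k as [|k IH]; intros f g [Hc H] [Hc' H'].
  - split; [|exact I]. intros z Hz. apply (continuous_plus f g); auto.
  - destruct H as [He [Hx Hy]], H' as [He' [Hx' Hy']]. repeat split.
    + intros z Hz. apply (continuous_plus f g); auto.
    + apply (@ex_derive_plus R_AbsRing R_NormedModule); [apply He | apply He']; assumption.
    + apply (@ex_derive_plus R_AbsRing R_NormedModule); [apply He | apply He']; assumption.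
    + apply Ck_ext with (fun z => Dx f z + Dx g z)%R; [exact HU| |apply IH; assumption].
      intros z Hz. symmetry. apply Derive_plus; [apply He | apply He']; assumption.
    + apply Ck_ext with (fun z => Dy f z + Dy g z)%R; [exact HU| |apply IH; assumption].
      intros z Hz. symmetry. apply Derive_plus; [apply He | apply He']; assumption.
Qed.

Lemma Ck_mult k (U : C -> Prop) f g : open U -> Ck k U f -> Ck k U g ->
  Ck k U (fun z => f z * g z)%R.
Proof.
  intros HU; revert f g; induction k as [|k IH]; intros f g Hf Hg.
  - destruct Hf as [Hc H], Hg as [Hc' H'].
    split; [|exact I]. intros z Hz. apply (continuous_mult f g); auto.
  - pose proof (Ck_pred _ _ _ Hf) as Hf0. pose proof (Ck_pred _ _ _ Hg) as Hg0.
    destruct Hf as [Hc [He [Hx Hy]]], Hg as [Hc' [He' [Hx' Hy']]]. repeat split.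
    + intros z Hz. apply (continuous_mult f g); auto.
    + apply ex_derive_mult; [apply He | apply He']; assumption.
    + apply ex_derive_mult; [apply He | apply He']; assumption.
    + apply Ck_ext with (fun z => Dx f z * g z + f z * Dx g z)%R; [exact HU| |].
      * intros [x y] Hz. symmetry.
        apply (Derive_mult (fun x => f (x, y)) (fun x => g (x, y)));
          [apply (He (x, y)) | apply (He' (x, y))]; assumption.
      * apply Ck_plus; [exact HU| |]; apply IH; assumption.
    + apply Ck_ext with (fun z => Dy f z * g z + f z * Dy g z)%R; [exact HU| |].
      * intros [x y] Hz. symmetry.
        apply (Derive_mult (fun y => f (x, y)) (fun y => g (x, y)));
          [apply (He (x, y)) | apply (He' (x, y))]; assumption.
      * apply Ck_plus; [exact HU| |]; apply IH; assumption.
Qed.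

Lemma Ck_opp k (U : C -> Prop) f : open U -> Ck k U f -> Ck k U (fun z => - f z)%R.
Proof.
  intros HU; revert f; induction k as [|k IH]; intros f [Hc H].
  - split; [|exact I]. intros z Hz. apply (continuous_opp f); auto.
  - destruct H as [He [Hx Hy]]. repeat split.
    + intros z Hz. apply (continuous_opp f); auto.
    + apply (@ex_derive_opp R_AbsRing R_NormedModule); apply He; assumption.
    + apply (@ex_derive_opp R_AbsRing R_NormedModule); apply He; assumption.
    + apply Ck_ext with (fun z => - Dx f z)%R; [exact HU| |apply IH; assumption].
      intros z Hz. symmetry. apply Derive_opp.
    + apply Ck_ext with (fun z => - Dy f z)%R; [exact HU| |apply IH; assumption].
      intros z Hz. symmetry. apply Derive_opp.
Qed.

Lemma csmooth_mult (U : C -> Prop) f g : open U -> csmooth U f -> csmooth U g ->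
  csmooth U (fun z => f z * g z).
Proof.
  intros HU [Hf Hf'] [Hg Hg']; split; intros k.
  - apply (Ck_plus k U (fun z => Re (f z) * Re (g z))%R
             (fun z => - (Im (f z) * Im (g z)))%R HU);
      [apply Ck_mult; auto | apply Ck_opp; [exact HU | apply Ck_mult; auto]].
  - apply (Ck_plus k U (fun z => Re (f z) * Im (g z))%R
             (fun z => Im (f z) * Re (g z))%R HU); apply Ck_mult; auto.
Qed.

Lemma CDx_mult (U : C -> Prop) f g z : csmooth U f -> csmooth U g -> U z ->
  CDx (fun z => f z * g z) z = CDx f z * g z + f z * CDx g z.
Proof.
  intros [Hf Hf'] [Hg Hg'] Hz. destruct z as [x y].
  destruct (Hf 1%nat) as [_ [H1 _]], (Hf' 1%nat) as [_ [H2 _]],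
    (Hg 1%nat) as [_ [H3 _]], (Hg' 1%nat) as [_ [H4 _]].
  destruct (H1 _ Hz) as [D1 _], (H2 _ Hz) as [D2 _],
    (H3 _ Hz) as [D3 _], (H4 _ Hz) as [D4 _]; simpl in *.
  unfold CDx, Dx; simpl.
  set (f1 := fun x => Re (f (x, y))) in *. set (f2 := fun x => Im (f (x, y))) in *.
  set (g1 := fun x => Re (g (x, y))) in *. set (g2 := fun x => Im (g (x, y))) in *.
  apply injective_projections; cbn -[Derive].
  - transitivity (Derive (fun x => f1 x * g1 x - f2 x * g2 x)%R x); [reflexivity|].
    rewrite Derive_minus by (apply ex_derive_mult; assumption).
    rewrite 2!Derive_mult by assumption.
    unfold f1, f2, g1, g2, Re, Im. ring.
  - transitivity (Derive (fun x => f1 x * g2 x + f2 x * g1 x)%R x); [reflexivity|].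
    rewrite Derive_plus by (apply ex_derive_mult; assumption).
    rewrite 2!Derive_mult by assumption.
    unfold f1, f2, g1, g2, Re, Im. ring.
Qed.

Lemma CDy_mult (U : C -> Prop) f g z : csmooth U f -> csmooth U g -> U z ->
  CDy (fun z => f z * g z) z = CDy f z * g z + f z * CDy g z.
Proof.
  intros [Hf Hf'] [Hg Hg'] Hz. destruct z as [x y].
  destruct (Hf 1%nat) as [_ [H1 _]], (Hf' 1%nat) as [_ [H2 _]],
    (Hg 1%nat) as [_ [H3 _]], (Hg' 1%nat) as [_ [H4 _]].
  destruct (H1 _ Hz) as [_ D1], (H2 _ Hz) as [_ D2],
    (H3 _ Hz) as [_ D3], (H4 _ Hz) as [_ D4]; simpl in *.
  unfold CDy, Dy; simpl.
  set (f1 := fun y => Re (f (x, y))) in *. set (f2 := fun y => Im (f (x, y))) in *.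
  set (g1 := fun y => Re (g (x, y))) in *. set (g2 := fun y => Im (g (x, y))) in *.
  apply injective_projections; cbn -[Derive].
  - transitivity (Derive (fun y => f1 y * g1 y - f2 y * g2 y)%R y); [reflexivity|].
    rewrite Derive_minus by (apply ex_derive_mult; assumption).
    rewrite 2!Derive_mult by assumption.
    unfold f1, f2, g1, g2, Re, Im. ring.
  - transitivity (Derive (fun y => f1 y * g2 y + f2 y * g1 y)%R y); [reflexivity|].
    rewrite Derive_plus by (apply ex_derive_mult; assumption).
    rewrite 2!Derive_mult by assumption.
    unfold f1, f2, g1, g2, Re, Im. ring.
Qed.

Lemma pairing_plus A B v :
  pairing ((fst A + fst B)%R, (snd A + snd B)%R) v = (pairing A v + pairing B v)%R.
Proof. unfold pairing; simpl; ring. Qed.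

Lemma tensor_open n m (L M : line_bundle n m) (ij : lb_idx L * lb_idx M) k :
  open (fun z : C => lb_dom L (fst ij) (k, z) /\ lb_dom M (snd ij) (k, z)).
Proof. apply open_and; apply lb_open. Qed.

Definition tensor {n m : nat} (L M : line_bundle n m) : line_bundle n m.
Proof.
  refine (LineBundle (lb_idx L * lb_idx M)%type
    (fun i p => lb_dom L (fst i) p /\ lb_dom M (snd i) p)
    (fun i j p q d => lb_tr L (fst i) (fst j) p q d * lb_tr M (snd i) (snd j) p q d)
    (fun i p => ((fst (lb_conn L (fst i) p) + fst (lb_conn M (snd i) p))%R,
                 (snd (lb_conn L (fst i) p) + snd (lb_conn M (snd i) p))%R))
    (tensor_open n m L M) _ _ _ _ _ _).
  - intros p. destruct (lb_cover _ _ L p) as [i Hi], (lb_cover _ _ M p) as [j Hj].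
    exists (i, j). split; assumption.
  - intros i j p q d [Hi Hi'] [Hj Hj'] Ha.
    rewrite Cmod_mult, 2!lb_unitary by assumption. ring.
  - intros i j l p q r d e [Hi Hi'] [Hj Hj'] [Hl Hl'] Ha Hb.
    rewrite (lb_cocycle _ _ L (fst i) (fst j) (fst l) p q r d e),
      (lb_cocycle _ _ M (snd i) (snd j) (snd l) p q r d e) by assumption.
    ring.
  - intros i j k l W phi delta Hc Hd.
    apply (csmooth_mult W (fun z => lb_tr L (fst i) (fst j) (k, z) (l, phi z) (delta z))
             (fun z => lb_tr M (snd i) (snd j) (k, z) (l, phi z) (delta z))).
    + apply Hc.
    + apply lb_tr_smooth; [exact Hc|]. intros z Hz; destruct (Hd z Hz); tauto.
    + apply lb_tr_smooth; [exact Hc|]. intros z Hz; destruct (Hd z Hz); tauto.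
  - intros i k. destruct (lb_conn_smooth _ _ L (fst i) k) as [H1 H2],
      (lb_conn_smooth _ _ M (snd i) k) as [H3 H4].
    split; intros r; simpl;
    (apply Ck_plus; [apply tensor_open with (ij := i)
      | eapply Ck_subset; [|auto]; simpl; tauto
      | eapply Ck_subset; [|auto]; simpl; tauto]).
  - intros i j k l W phi delta Hc Hd g z Hz.
    assert (HL : forall z, W z -> lb_dom L (fst i) (k, z) /\ lb_dom L (fst j) (l, phi z))
      by (intros t Ht; destruct (Hd t Ht); tauto).
    assert (HM : forall z, W z -> lb_dom M (snd i) (k, z) /\ lb_dom M (snd j) (l, phi z))
      by (intros t Ht; destruct (Hd t Ht); tauto).
    pose proof (lb_tr_smooth _ _ L _ _ _ _ _ _ _ Hc HL) as SL.
    pose proof (lb_tr_smooth _ _ M _ _ _ _ _ _ _ Hc HM) as SM.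
    destruct (lb_conn_tr _ _ L _ _ _ _ _ _ _ Hc HL z Hz) as [XL YL].
    destruct (lb_conn_tr _ _ M _ _ _ _ _ _ _ Hc HM z Hz) as [XM YM].
    unfold g. rewrite !pairing_plus.
    rewrite (CDx_mult W _ _ z SL SM Hz), (CDy_mult W _ _ z SL SM Hz), XL, YL, XM, YM.
    rewrite ?RtoC_minus, ?RtoC_plus. split; ring.
Defined.

(** Words in the generators x_1 = north, x_2 = south; the boolean is [true] for
    the inverse of a generator. *)

Definition word : Type := list (chart * bool).

Inductive pi1_eq (n m : nat) : word -> word -> Prop :=
| pi1_refl : forall u, pi1_eq n m u u
| pi1_sym : forall u v, pi1_eq n m u v -> pi1_eq n m v u
| pi1_trans : forall u v w, pi1_eq n m u v -> pi1_eq n m v w -> pi1_eq n m u w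
| pi1_app : forall u u' v v', pi1_eq n m u u' -> pi1_eq n m v v' ->
    pi1_eq n m (u ++ v) (u' ++ v')
| pi1_inv : forall x b, pi1_eq n m ((x, b) :: (x, negb b) :: nil) nil
| pi1_cone : forall x, pi1_eq n m (repeat (x, false) (cone_order n m x)) nil
| pi1_prod : pi1_eq n m ((north, false) :: (south, false) :: nil) nil.

Record character (n m : nat) : Type := Character {
  char_fun :> word -> C;
  char_unitary : forall u, Cmod (char_fun u) = 1%R;
  char_mult : forall u v, char_fun (u ++ v) = char_fun u * char_fun v;
  char_compat : forall u v, pi1_eq n m u v -> char_fun u = char_fun v
}.

Definition cis (t : R) : C := (cos t, sin t).

Definition velocity (c : R -> C) (t : R) : C :=
  (Derive (fun s => Re (c s)) t, Derive (fun s => Im (c s)) t).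

(* The section sum y_i s_i along the path c in the chart k is well defined and
   parallel; y i t only matters when c t is in the domain of s_i. *)
Definition parallel {n m : nat} (L : line_bundle n m) (k : chart) (c : R -> C)
    (y : lb_idx L -> R -> C) : Prop :=
  forall t,
    (forall i j, lb_dom L i (k, c t) -> lb_dom L j (k, c t) ->
       y j t = lb_tr L i j (k, c t) (k, c t) 1 * y i t) /\
    (forall i, lb_dom L i (k, c t) ->
       @is_derive R_AbsRing C_R_NormedModule (y i) t
         (Ci * RtoC (pairing (lb_conn L i (k, c t)) (velocity c t)) * y i t)).

(* The generator x_k, based at the point of X represented by 1 in both charts
   (1^n 1^m = 1), is the orbifold loop t |-> exp(2 pi i t / n_k), 0 <= t <= 1,
   in the chart k, closed up by the arrow rotating its endpoint back to 1.
   Parallel transport along it is multiplication by h on the fibre at 1. *)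
Definition generator_holonomy {n m : nat} (L : line_bundle n m) (k : chart)
    (h : C) : Prop :=
  let a := (2 * PI / INR (cone_order n m k))%R in
  exists y : lb_idx L -> R -> C,
    parallel L k (fun t => cis (a * t)) y /\
    forall i j, lb_dom L i (k, cis a) -> lb_dom L j (k, RtoC 1) ->
      y j 0%R <> 0 /\
      lb_tr L i j (k, cis a) (k, RtoC 1) (cis (- a)) * y i 1%R = h * y j 0%R.

Definition has_holonomy {n m : nat} (L : line_bundle n m) (chi : character n m) : Prop :=
  forall k, generator_holonomy L k (chi ((k, false) :: nil)).

Definition exactly_classes {n m : nat} (g : nat) (P : line_bundle n m -> Prop) : Prop :=
  exists S : nat -> line_bundle n m,
    (forall a, (a < g)%nat -> P (S a)) /\
    (forall a b, (a < g)%nat -> (b < g)%nat -> isomorphic (S a) (S b) -> a = b) /\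
    (forall L, P L -> exists a, (a < g)%nat /\ isomorphic L (S a)).

(* Main.v *)
(** A flat orbifold line bundle has a global parallel unit section over each of the two uniformizing
    charts, because a plane is simply connected.  Relative to these sections the arrows of the
    groupoid act by a locally constant U(1)-valued cocycle.  Restricted to the rotations of the
    charts this cocycle is a pair of characters of Z_n and Z_m; the arrows between the charts form
    the curve u^n v^m = 1, and transport along the spiral (e^t, e^(-nt/m)) shows that, on
    generators, the two characters are inverse to each other, so both are given by a g-th root of
    unity, g = gcd(n,m), and that it determines the cocycle up to rescaling the two sections.
    Hence every flat bundle is the c-th power, 0 <= c < g, of one explicit bundle with values in the
    g-th roots of unity.  Two prequantum bundles with the same curvature differ by the flat bundle
    L' (x) L^*, and the isotropy at a cone point tells the g twists apart. *)

From Stdlib Require Import Reals Lra Lia List ZArith ClassicalEpsilon FunctionalExtensionality.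
From Coquelicot Require Import Coquelicot.
Require Import Defs.
Open Scope C_scope.

(** * Calculus in the plane *)

(** The frames of a bundle are arbitrary, so data in different frames can be compared only through
    something frame-independent. That is [arrow_ratio], the coefficient of an arrow with respect to
    parallel sections at its two ends. It is multiplicative under composition, and its derivative
    along a curve of arrows vanishes because the connection terms at the two ends cancel. Uniqueness
    and gluing of sections, constancy of the rotation characters and transport along the spiral are
    all instances of this.

    The curve u^n v^m = 1 has no global branch v(u), and it has g components. Curves on it are
    therefore parametrised by the exponential, and every arrow from north to south is a spiral from
    (1,1) followed by a rotation of the south chart. The spiral that ends at u = zeta_n has v =
    1/zeta_m; rotations at both ends bring it back to the arrow at (1,1), which is why the two
    characters are inverse.

    Isomorphisms are not assembled by tensor algebra: a parallel section of [tensor M (dual L)] that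
    is equivariant up to the c-th power of the torsion cocycle is already the coefficient family of
    an isomorphism from L to M twisted by the c-th torsion bundle. *)

Definition is_derive_C (f : R -> C) (t : R) (l : C) : Prop :=
  @is_derive R_AbsRing C_R_NormedModule f t l.

Lemma is_derive_C_iff (f : R -> C) (t : R) (l : C) :
  is_derive_C f t l <->
  is_derive (fun s => Re (f s)) t (Re l) /\ is_derive (fun s => Im (f s)) t (Im l).
Proof.
  split.
  - intros H; split.
    + apply (filterdiff_comp' f (fst : C_R_NormedModule -> R_NormedModule) t _ fst H).
      apply filterdiff_linear, is_linear_fst.
    + apply (filterdiff_comp' f (snd : C_R_NormedModule -> R_NormedModule) t _ snd H).
      apply filterdiff_linear, is_linear_snd.
  - intros [H1 H2].
    apply filterdiff_ext with (fun s => (Re (f s), Im (f s))).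
    { intros s; symmetry; apply surjective_pairing. }
    apply (filterdiff_ext_lin _ (fun y : R => (scal y (Re l), scal y (Im l)) : C_R_NormedModule)).
    2: { intros y. reflexivity. }
    apply (@filterdiff_comp'_2 R_AbsRing R_NormedModule R_NormedModule R_NormedModule
             C_R_NormedModule (fun s => Re (f s)) (fun s => Im (f s)) (fun x y => (x, y)) t
             _ _ (fun x y => (x, y)) H1 H2).
    apply filterdiff_ext with (fun t => t); [intros; apply surjective_pairing|].
    apply (filterdiff_ext_lin _ (fun t => t)); [|intros; apply surjective_pairing].
    apply filterdiff_id.
Qed.

Lemma is_derive_R_mult (f g : R -> R) (t a b : R) :
  is_derive f t a -> is_derive g t b ->
  is_derive (fun s => (f s * g s)%R) t (a * g t + f t * b)%R.
Proof. intros Hf Hg. exact (is_derive_mult f g t a b Hf Hg Rmult_comm). Qed.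

Lemma is_derive_C_mult (f g : R -> C) t a b :
  is_derive_C f t a -> is_derive_C g t b ->
  is_derive_C (fun s => f s * g s) t (a * g t + f t * b).
Proof.
  rewrite !is_derive_C_iff. intros [H1 H2] [H3 H4]. split.
  - replace (Re (a * g t + f t * b)) with
      (minus (Re a * Re (g t) + Re (f t) * Re b) (Im a * Im (g t) + Im (f t) * Im b))%R
      by (unfold minus, plus, opp, Re, Im; simpl; ring).
    apply (is_derive_minus (fun s => Re (f s) * Re (g s))%R (fun s => Im (f s) * Im (g s))%R);
      apply is_derive_R_mult; assumption.
  - replace (Im (a * g t + f t * b)) with
      (plus (Re a * Im (g t) + Re (f t) * Im b) (Im a * Re (g t) + Im (f t) * Re b))%R
      by (unfold plus, Re, Im; simpl; ring).
    apply (is_derive_plus (fun s => Re (f s) * Im (g s))%R (fun s => Im (f s) * Re (g s))%R);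
      apply is_derive_R_mult; assumption.
Qed.

Lemma is_derive_C_conj (f : R -> C) t a :
  is_derive_C f t a -> is_derive_C (fun s => Cconj (f s)) t (Cconj a).
Proof.
  rewrite !is_derive_C_iff. intros [H1 H2]. split; [exact H1|].
  apply (is_derive_opp _ _ _ H2).
Qed.

Lemma is_derive_C_eq (f : R -> C) t a b : is_derive_C f t a -> a = b -> is_derive_C f t b.
Proof. intros H <-; exact H. Qed.

Lemma is_derive_C_const (c : C) t : is_derive_C (fun _ => c) t 0.
Proof. apply (is_derive_const (c : C_R_NormedModule) t). Qed.

Lemma is_derive_C_zero (f : R -> C) a b : (a <= b)%R ->
  (forall t, (a <= t <= b)%R -> is_derive_C f t 0) -> f a = f b.
Proof.
  intros [Hab| ->] H; [|reflexivity].
  apply (@eq_is_derive C_R_NormedModule f a b); [exact H | exact Hab].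
Qed.

(** Partial derivatives alone give no chain rule. Both of them exist near the point and [Dx f] is
    continuous there, which makes [f] differentiable. *)
Lemma Ck_chain (U : C -> Prop) (f : C -> R) (c : R -> C) t v :
  open U -> Ck 1 U f -> U (c t) -> is_derive_C c t v ->
  is_derive (fun s => f (c s)) t (Dx f (c t) * Re v + Dy f (c t) * Im v)%R.
Proof.
  intros HU [Hc [He [Hx Hy]]] Ht Hv. apply is_derive_C_iff in Hv. destruct Hv as [H1 H2].
  eapply is_derive_ext.
  2: { apply is_derive_Reals.
    apply (derivable_pt_lim_comp_2d (fun x y => f (x, y)) (fun s => Re (c s)) (fun s => Im (c s)) t
      (Dx f (c t)) (Dy f (c t))); [|apply is_derive_Reals; exact H1 | apply is_derive_Reals; exact H2].
    apply filterdiff_differentiable_pt_lim.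
    eapply filterdiff_ext_lin.
    - apply (is_derive_filterdiff (fun x y => f (x, y)) (Re (c t)) (Im (c t))
              (fun x y => Dx f (x, y)) (Dy f (c t))).
      + change (Re (c t), Im (c t)) with (fst (c t), snd (c t)). rewrite <- surjective_pairing.
        apply filter_imp with U; [|apply HU, Ht].
        intros u Hu. apply Derive_correct. apply (He u Hu).
      + apply Derive_correct. apply (He (c t) Ht).
      + change (Re (c t), Im (c t)) with (fst (c t), snd (c t)). rewrite <- surjective_pairing.
        apply (continuous_ext (Dx f)).
        * intros u. rewrite <- surjective_pairing. reflexivity.
        * apply Hx, Ht.
    - intros [y1 y2]. reflexivity. }
  intros s. simpl. unfold Re, Im. rewrite <- surjective_pairing. reflexivity.
Qed.

Lemma csmooth_chain (U : C -> Prop) (f : C -> C) (c : R -> C) t v :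
  open U -> csmooth U f -> U (c t) -> is_derive_C c t v ->
  is_derive_C (fun s => f (c s)) t (CDx f (c t) * Re v + CDy f (c t) * Im v).
Proof.
  intros HU [H1 H2] Ht Hv. apply is_derive_C_iff. split.
  - replace (Re (CDx f (c t) * Re v + CDy f (c t) * Im v)) with
      (Dx (fun w => Re (f w)) (c t) * Re v + Dy (fun w => Re (f w)) (c t) * Im v)%R
      by (unfold CDx, CDy; simpl; ring).
    apply (Ck_chain U (fun w => Re (f w))); auto.
  - replace (Im (CDx f (c t) * Re v + CDy f (c t) * Im v)) with
      (Dx (fun w => Im (f w)) (c t) * Re v + Dy (fun w => Im (f w)) (c t) * Im v)%R
      by (unfold CDx, CDy; simpl; ring).
    apply (Ck_chain U (fun w => Im (f w))); auto.
Qed.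

(** The finite-order form of [csmooth], needed for inductions on the order of differentiability. *)
Definition CCk (k : nat) (U : C -> Prop) (f : C -> C) : Prop :=
  Ck k U (fun z => Re (f z)) /\ Ck k U (fun z => Im (f z)).

Lemma csmooth_CCk U f : csmooth U f <-> forall k, CCk k U f.
Proof.
  split; [intros [H1 H2] k; split; auto|].
  intros H; split; intros k; apply H.
Qed.

Lemma CCk_mult k (U : C -> Prop) f g : open U -> CCk k U f -> CCk k U g ->
  CCk k U (fun z => f z * g z).
Proof.
  intros HU [Hf Hf'] [Hg Hg']; split.
  - apply (Ck_plus k U (fun z => Re (f z) * Re (g z))%R
             (fun z => - (Im (f z) * Im (g z)))%R HU);
      [apply Ck_mult; auto | apply Ck_opp; [exact HU | apply Ck_mult; auto]].
  - apply (Ck_plus k U (fun z => Re (f z) * Im (g z))%R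
             (fun z => Im (f z) * Re (g z))%R HU); apply Ck_mult; auto.
Qed.

Lemma Ck_const k U (c : R) : Ck k U (fun _ => c).
Proof.
  revert c; induction k as [|k IH]; intros c.
  - split; [|exact I]. intros z _. apply continuous_const.
  - split; [intros z _; apply continuous_const|].
    split; [intros z _; split; apply ex_derive_const|].
    assert (E : forall f, f = (fun _ : C => 0%R) -> Ck k U f) by (intros f ->; apply IH).
    split; apply E, functional_extensionality; intros z;
      [apply (Derive_const c (Re z)) | apply (Derive_const c (Im z))].
Qed.

Lemma CCk_const k U (c : C) : CCk k U (fun _ => c).
Proof. split; apply Ck_const. Qed.

Lemma csmooth_const U (c : C) : csmooth U (fun _ => c).
Proof. split; intros k; apply Ck_const. Qed.

(** [Derive] is total, so values of [CDx] and [CDy] do not show that a derivative exists; this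
    predicate records existence together with the values. *)
Definition has_partials (f : C -> C) (z fx fy : C) : Prop :=
  is_derive_C (fun x => f (x, Im z)) (Re z) fx /\
  is_derive_C (fun y => f (Re z, y)) (Im z) fy.

Lemma has_partials_CD f z fx fy : has_partials f z fx fy -> CDx f z = fx /\ CDy f z = fy.
Proof.
  intros [H1 H2]. apply is_derive_C_iff in H1, H2. destruct H1 as [H1 H1'], H2 as [H2 H2'].
  split; apply injective_projections; apply is_derive_unique; assumption.
Qed.

Lemma csmooth_has_partials U f z : csmooth U f -> U z -> has_partials f z (CDx f z) (CDy f z).
Proof.
  intros [H1 H2] Hz. destruct (H1 1%nat) as [_ [E1 _]], (H2 1%nat) as [_ [E2 _]].
  destruct (E1 z Hz), (E2 z Hz).
  split; apply is_derive_C_iff; split; apply Derive_correct; assumption.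
Qed.

(* Bootstrapping: a solution of a first-order system is as smooth as its right-hand side. *)
Lemma csmooth_bootstrap (U : C -> Prop) (f fx fy : C -> C) : open U ->
  (forall z, U z -> continuous (fun z => Re (f z)) z /\ continuous (fun z => Im (f z)) z) ->
  (forall z, U z -> has_partials f z (fx z) (fy z)) ->
  (forall k, CCk k U f -> CCk k U fx /\ CCk k U fy) ->
  csmooth U f.
Proof.
  intros HU Hc Hp Hb. apply csmooth_CCk. intros k.
  assert (Hp' : forall z, U z ->
     (is_derive (fun x => Re (f (x, Im z))) (Re z) (Re (fx z)) /\
      is_derive (fun x => Im (f (x, Im z))) (Re z) (Im (fx z))) /\
     (is_derive (fun y => Re (f (Re z, y))) (Im z) (Re (fy z)) /\
      is_derive (fun y => Im (f (Re z, y))) (Im z) (Im (fy z)))).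
  { intros z Hz. destruct (Hp z Hz) as [H1 H2]. apply is_derive_C_iff in H1, H2. tauto. }
  induction k as [|k IH].
  - split; (split; [intros z Hz; apply (Hc z Hz) | exact I]).
  - destruct (Hb k IH) as [[A1 A2] [B1 B2]]. split.
    + split; [intros z Hz; apply (Hc z Hz)|]. split; [|split].
      * intros z Hz; destruct (Hp' z Hz) as [[h1 h2] [h3 h4]]; split; eexists; [exact h1 | exact h3].
      * apply Ck_ext with (fun z => Re (fx z)); [exact HU| |exact A1].
        intros z Hz. destruct (Hp' z Hz) as [[h1 h2] [h3 h4]].
        symmetry. exact (is_derive_unique _ _ _ h1).
      * apply Ck_ext with (fun z => Re (fy z)); [exact HU| |exact B1].
        intros z Hz. destruct (Hp' z Hz) as [[h1 h2] [h3 h4]].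
        symmetry. exact (is_derive_unique _ _ _ h3).
    + split; [intros z Hz; apply (Hc z Hz)|]. split; [|split].
      * intros z Hz; destruct (Hp' z Hz) as [[h1 h2] [h3 h4]]; split; eexists; [exact h2 | exact h4].
      * apply Ck_ext with (fun z => Im (fx z)); [exact HU| |exact A2].
        intros z Hz. destruct (Hp' z Hz) as [[h1 h2] [h3 h4]].
        symmetry. exact (is_derive_unique _ _ _ h2).
      * apply Ck_ext with (fun z => Im (fy z)); [exact HU| |exact B2].
        intros z Hz. destruct (Hp' z Hz) as [[h1 h2] [h3 h4]].
        symmetry. exact (is_derive_unique _ _ _ h4).
Qed.

Lemma csmooth_id U : open U -> csmooth U (fun z => z).
Proof.
  intros HU. apply csmooth_bootstrap with (fun _ => RtoC 1) (fun _ => Ci); [exact HU| | |].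
  - intros [x y] _; split; [apply continuous_fst | apply continuous_snd].
  - intros z _. split; apply is_derive_C_iff; split.
    + exact (is_derive_id (K := R_AbsRing) (Re z)).
    + exact (is_derive_const (K := R_AbsRing) (V := R_NormedModule) (Im z) (Re z)).
    + exact (is_derive_const (K := R_AbsRing) (V := R_NormedModule) (Re z) (Im z)).
    + exact (is_derive_id (K := R_AbsRing) (Im z)).
  - intros; split; apply CCk_const.
Qed.

Lemma csmooth_pow U f k : open U -> csmooth U f -> csmooth U (fun z => f z ^ k).
Proof.
  intros HU Hf. induction k as [|k IH]; [apply (csmooth_const U 1)|].
  apply csmooth_mult; assumption.
Qed.

Lemma csmooth_ext (U : C -> Prop) f g : open U -> (forall z, U z -> f z = g z) ->
  csmooth U f -> csmooth U g.
Proof.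
  intros HU E [H1 H2]; split; intros k.
  - apply Ck_ext with (fun z => Re (f z)); [exact HU| |apply H1]. intros z Hz; rewrite E; auto.
  - apply Ck_ext with (fun z => Im (f z)); [exact HU| |apply H2]. intros z Hz; rewrite E; auto.
Qed.

Lemma csmooth_subset (U V : C -> Prop) f : (forall z, V z -> U z) -> csmooth U f -> csmooth V f.
Proof. intros H [H1 H2]; split; intros k; eapply Ck_subset; eauto. Qed.

Lemma csmooth_conj (U : C -> Prop) f : open U -> csmooth U f -> csmooth U (fun z => Cconj (f z)).
Proof. intros HU [H1 H2]; split; [exact H1|]. intros k. apply (Ck_opp k U _ HU (H2 k)). Qed.

(** The conditions in [Ck] are pointwise, with continuity and derivatives taken in the ambient
    plane, so the covering sets may be arbitrary. *)
Lemma Ck_union k (P : (C -> Prop) -> Prop) U f :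
  (forall z, U z -> exists V, P V /\ V z) -> (forall V, P V -> Ck k V f) -> Ck k U f.
Proof.
  intros HU. revert f; induction k as [|k IH]; intros f H.
  - split; [|exact I]. intros z Hz. destruct (HU z Hz) as [V [HV Hz']]. apply (Ck_cont O V f (H V HV) z Hz').
  - split; [|split; [|split]].
    + intros z Hz. destruct (HU z Hz) as [V [HV Hz']]. apply (Ck_cont (S k) V f (H V HV) z Hz').
    + intros z Hz. destruct (HU z Hz) as [V [HV Hz']].
      destruct (H V HV) as [_ [He _]]. exact (He z Hz').
    + apply IH. intros V HV. apply (H V HV).
    + apply IH. intros V HV. apply (H V HV).
Qed.

Lemma csmooth_union (P : (C -> Prop) -> Prop) U f :
  (forall z, U z -> exists V, P V /\ V z) -> (forall V, P V -> csmooth V f) -> csmooth U f.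
Proof.
  intros HU H; split; intros k; apply Ck_union with P; auto; intros V HV; apply H; exact HV.
Qed.

Lemma CD_ext (U : C -> Prop) f g z : open U -> U z -> (forall z, U z -> f z = g z) ->
  CDx f z = CDx g z /\ CDy f z = CDy g z.
Proof.
  intros HU Hz E. split; unfold CDx, CDy, Dx, Dy; f_equal; apply Derive_ext_loc;
  first [apply filter_imp with (fun x => U (x, Im z)); [intros x Hx; rewrite E by exact Hx; reflexivity | apply open_x; assumption]
        |apply filter_imp with (fun y => U (Re z, y)); [intros x Hx; rewrite E by exact Hx; reflexivity | apply open_y; assumption]].
Qed.

(** * The Poincaré lemma on rectangles *)

Definition box (a b c d : R) (z : C) : Prop := ((a < Re z < b) /\ (c < Im z < d))%R.

Lemma continuous_Re (z : C) : continuous Re z.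
Proof. destruct z; apply continuous_fst. Qed.

Lemma continuous_Im (z : C) : continuous Im z.
Proof. destruct z; apply continuous_snd. Qed.

Lemma open_box a b c d : open (box a b c d).
Proof.
  repeat apply open_and.
  - apply (open_comp Re (fun x => a < x)%R); [intros; apply continuous_Re | apply open_gt].
  - apply (open_comp Re (fun x => x < b)%R); [intros; apply continuous_Re | apply open_lt].
  - apply (open_comp Im (fun x => c < x)%R); [intros; apply continuous_Im | apply open_gt].
  - apply (open_comp Im (fun x => x < d)%R); [intros; apply continuous_Im | apply open_lt].
Qed.

Lemma open_contains_box (U : C -> Prop) z : open U -> U z ->
  exists e, (0 < e)%R /\ forall w, box (Re z - e) (Re z + e) (Im z - e) (Im z + e) w -> U w.
Proof.
  intros HU Hz. destruct (HU z Hz) as [[e He] H]. exists e. split; [exact He|].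
  intros w [[H1 H2] [H3 H4]]. apply H. split; simpl; apply Rabs_def1; unfold minus, plus, opp; simpl;
  unfold Re, Im in *; lra.
Qed.

Lemma continuous_slice_x (f : C -> R) x y : continuous f (x, y) -> continuous (fun t => f (t, y)) x.
Proof.
  intros H. apply (continuous_comp (fun t => (t, y)) f); [|exact H].
  apply (@continuous_comp_2 R_UniformSpace R_UniformSpace R_UniformSpace C_UniformSpace
           (fun t => t) (fun _ => y) (fun a b => (a, b)));
    [apply continuous_id | apply continuous_const|].
  apply continuous_ext with (fun u => u); [intros; apply surjective_pairing | apply continuous_id].
Qed.

Lemma continuous_slice_y (f : C -> R) x y : continuous f (x, y) -> continuous (fun t => f (x, t)) y.
Proof.
  intros H. apply (continuous_comp (fun t => (x, t)) f); [|exact H].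
  apply (@continuous_comp_2 R_UniformSpace R_UniformSpace R_UniformSpace C_UniformSpace
           (fun _ => x) (fun t => t) (fun a b => (a, b)));
    [apply continuous_const | apply continuous_id|].
  apply continuous_ext with (fun u => u); [intros; apply surjective_pairing | apply continuous_id].
Qed.

Lemma Rmin_max_between a b x y t : (a < x < b)%R -> (a < y < b)%R ->
  (Rmin x y <= t <= Rmax x y)%R -> (a < t < b)%R.
Proof. unfold Rmin, Rmax; destruct (Rle_dec x y); lra. Qed.

(** The potential integrates the form from the centre, first horizontally at height [y0], then
    vertically. Its y-derivative is the fundamental theorem of calculus. For the x-derivative,
    differentiation under the integral turns the vertical part into the integral of [Dx A2], that is
    of [Dy A1], which is A1(x,y) - A1(x,y0). *)
Lemma poincare_box (a b c d : R) (A1 A2 : C -> R) :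
  let U := box a b c d in
  Ck 1 U A1 -> Ck 1 U A2 -> (forall z, U z -> Dx A2 z = Dy A1 z) ->
  exists phi : C -> R, forall z, U z ->
    is_derive (fun x => phi (x, Im z)) (Re z) (A1 z) /\
    is_derive (fun y => phi (Re z, y)) (Im z) (A2 z).
Proof.
  intros U [C1 [E1 [_ Y1]]] [C2 [E2 [X2 _]]] Hcurl.
  set (x0 := ((a + b) / 2)%R). set (y0 := ((c + d) / 2)%R).
  exists (fun z => RInt (fun t => A1 (t, y0)) x0 (Re z) + RInt (fun s => A2 (Re z, s)) y0 (Im z))%R.
  intros [x y] [Hx Hy]; unfold Re, Im in Hx, Hy; simpl in *.
  assert (Hx0 : (a < x0 < b)%R) by (unfold x0; lra).
  assert (Hy0 : (c < y0 < d)%R) by (unfold y0; lra).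
  assert (I1 : forall x', (a < x' < b)%R -> ex_RInt (fun t => A1 (t, y0)) x0 x').
  { intros x' Hx'. apply (@ex_RInt_continuous R_CompleteNormedModule). intros t Ht.
    apply continuous_slice_x, C1. split; [exact (Rmin_max_between _ _ _ _ _ Hx0 Hx' Ht) | exact Hy0]. }
  assert (I2 : forall x' y', (a < x' < b)%R -> (c < y' < d)%R -> ex_RInt (fun s => A2 (x', s)) y0 y').
  { intros x' y' Hx' Hy'. apply (@ex_RInt_continuous R_CompleteNormedModule). intros t Ht.
    apply continuous_slice_y, C2. split; [exact Hx' | exact (Rmin_max_between _ _ _ _ _ Hy0 Hy' Ht)]. }
  assert (Lx : locally x (fun x' => a < x' < b)%R).
  { apply filter_and; [apply (open_gt a) | apply (open_lt b)]; tauto. }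
  assert (Ly : locally y (fun y' => c < y' < d)%R).
  { apply filter_and; [apply (open_gt c) | apply (open_lt d)]; tauto. }
  split.
  - assert (D : RInt (fun s => Derive (fun u => A2 (u, s)) x) y0 y = (A1 (x, y) - A1 (x, y0))%R).
    { rewrite (RInt_ext _ (Derive (fun s => A1 (x, s)))).
      - apply RInt_Derive.
        + intros t Ht. apply (E1 (x, t)).
          split; [exact Hx | exact (Rmin_max_between _ _ _ _ _ Hy0 Hy Ht)].
        + intros t Ht. apply (continuous_slice_y (Dy A1)), Y1.
          split; [exact Hx | exact (Rmin_max_between _ _ _ _ _ Hy0 Hy Ht)].
      - intros t Ht. apply (Hcurl (x, t)).
        split; [exact Hx|]. apply (Rmin_max_between _ _ _ _ _ Hy0 Hy); split; apply Rlt_le; apply Ht. }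
    replace (A1 (x, y)) with (A1 (x, y0) + (A1 (x, y) - A1 (x, y0)))%R by ring.
    rewrite <- D.
    apply (is_derive_plus (fun x => RInt (fun t => A1 (t, y0)) x0 x)
             (fun x => RInt (fun s => A2 (x, s)) y0 y)).
    + apply (is_derive_RInt (fun t => A1 (t, y0)) _ x0).
      * apply filter_imp with (2 := Lx). intros x' Hx'. apply (@RInt_correct R_CompleteNormedModule), I1, Hx'.
      * apply continuous_slice_x, C1. split; assumption.
    + apply (is_derive_RInt_param (fun x s => A2 (x, s))).
      * apply filter_imp with (2 := Lx). intros x' Hx' t Ht. apply (E2 (x', t)).
        split; [exact Hx' | exact (Rmin_max_between _ _ _ _ _ Hy0 Hy Ht)].
      * intros t Ht. apply continuity_2d_pt_filterlim.
        apply (continuous_ext (Dx A2)); [intros [u v]; reflexivity|]. apply X2.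
        split; [exact Hx | exact (Rmin_max_between _ _ _ _ _ Hy0 Hy Ht)].
      * apply filter_imp with (2 := Lx). intros x' Hx'. apply I2; assumption.
  - replace (A2 (x, y)) with (0 + A2 (x, y))%R by ring.
    apply (is_derive_plus (fun _ => RInt (fun t => A1 (t, y0)) x0 x)
             (fun y => RInt (fun s => A2 (x, s)) y0 y)).
    + apply (is_derive_const (RInt (fun t => A1 (t, y0)) x0 x)).
    + apply (is_derive_RInt (fun s => A2 (x, s)) _ y0).
      * apply filter_imp with (2 := Ly). intros y' Hy'. apply (@RInt_correct R_CompleteNormedModule), I2; assumption.
      * apply continuous_slice_y, C2. split; assumption.
Qed.

(** Continuity of one partial derivative already gives differentiability, hence continuity; this
    starts the bootstrap in [parallel_box]. *)
Lemma continuous_of_partials (U : C -> Prop) (f fx fy : C -> R) z : open U -> U z ->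
  (forall z, U z -> is_derive (fun x => f (x, Im z)) (Re z) (fx z) /\
                    is_derive (fun y => f (Re z, y)) (Im z) (fy z)) ->
  continuous fx z -> continuous f z.
Proof.
  intros HU Hz Hp Hc. destruct z as [x y].
  apply continuous_ext with (fun u => f (fst u, snd u)); [intros [u v]; reflexivity|].
  apply (@filterdiff_continuous R_AbsRing (prod_NormedModule R_AbsRing R_NormedModule R_NormedModule) R_NormedModule).
  eexists. apply (is_derive_filterdiff (fun x y => f (x, y)) x y (fun x y => fx (x, y)) (fy (x, y))).
  - apply filter_imp with U; [|apply HU, Hz]. intros [u v] Hu. apply (Hp (u, v) Hu).
  - apply (Hp (x, y) Hz).
  - apply continuous_ext with fx; [intros [u v]; reflexivity | exact Hc].
Qed.

Lemma cis_norm t : Cmod (cis t) = 1%R.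
Proof.
  unfold cis, Cmod; simpl. rewrite !Rmult_1_r, Rplus_comm.
  change (sqrt (Rsqr (sin t) + Rsqr (cos t)) = 1%R). rewrite sin2_cos2. apply sqrt_1.
Qed.

Lemma is_derive_cis (f : R -> R) t l : is_derive f t l ->
  is_derive_C (fun s => cis (f s)) t (Ci * cis (f t) * RtoC l).
Proof.
  intros H. apply is_derive_C_iff. split; simpl.
  - eapply filterdiff_ext_lin.
    + apply (is_derive_comp cos f); [apply is_derive_Reals, derivable_pt_lim_cos | exact H].
    + intros y. cbn. unfold mult; simpl. ring.
  - eapply filterdiff_ext_lin.
    + apply (is_derive_comp sin f); [apply is_derive_Reals, derivable_pt_lim_sin | exact H].
    + intros y. cbn. unfold mult; simpl. ring.
Qed.

Lemma continuous_cos' t : continuous cos t.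
Proof. apply continuity_pt_filterlim, continuity_cos. Qed.

Lemma continuous_sin' t : continuous sin t.
Proof. apply continuity_pt_filterlim, continuity_sin. Qed.

(** The solution is exp(i phi) for a potential phi. Only first derivatives of phi are controlled,
    but the equation dg = i g A has a right-hand side as smooth as g, so [csmooth_bootstrap]
    applies. *)
Lemma parallel_box (a b c d : R) (A1 A2 : C -> R) :
  let U := box a b c d in
  smooth U A1 -> smooth U A2 -> (forall z, U z -> Dx A2 z = Dy A1 z) ->
  exists g : C -> C, csmooth U g /\ forall z, U z ->
    Cmod (g z) = 1%R /\ CDx g z = Ci * g z * RtoC (A1 z) /\ CDy g z = Ci * g z * RtoC (A2 z).
Proof.
  intros U H1 H2 Hcurl.
  destruct (poincare_box a b c d A1 A2 (H1 1%nat) (H2 1%nat) Hcurl) as [phi Hphi].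
  assert (Hp : forall z, U z ->
    has_partials (fun z => cis (phi z)) z (Ci * cis (phi z) * RtoC (A1 z)) (Ci * cis (phi z) * RtoC (A2 z))).
  { intros [x y] Hz. destruct (Hphi _ Hz) as [D1 D2]. split.
    - apply (is_derive_cis (fun x => phi (x, y)) x _ D1).
    - apply (is_derive_cis (fun y => phi (x, y)) y _ D2). }
  exists (fun z => cis (phi z)). split.
  - apply csmooth_bootstrap with (3 := Hp); [apply open_box| |].
    + intros z Hz.
      assert (Cphi : continuous phi z).
      { apply (continuous_of_partials U phi A1 A2); [apply open_box | exact Hz | exact Hphi|].
        exact (Ck_cont O U A1 (H1 O) z Hz). }
      split; [apply (continuous_comp phi cos) | apply (continuous_comp phi sin)];
        [exact Cphi | apply continuous_cos' | exact Cphi | apply continuous_sin'].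
    + intros k Hk.
      assert (Hi : CCk k U (fun z => Ci * cis (phi z)))
        by (apply (CCk_mult k U (fun _ => Ci)); [apply open_box | apply CCk_const | exact Hk]).
      split; apply (CCk_mult k U (fun z => Ci * cis (phi z))); try exact Hi; try apply open_box;
        (split; simpl; [|apply Ck_const]); [apply H1 | apply H2].
  - intros z Hz. split; [apply cis_norm|]. exact (has_partials_CD _ _ _ _ (Hp z Hz)).
Qed.

(** * Parallel sections of a flat bundle *)

Lemma Cmod_1_neq_0 z : Cmod z = 1%R -> z <> 0.
Proof. intros H ->. rewrite Cmod_0 in H. lra. Qed.

Lemma Cmod_1_conj_l z : Cmod z = 1%R -> Cconj z * z = 1.
Proof. intros H. rewrite Cmult_comm, <- Cmod2_conj, H. apply f_equal. ring. Qed.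

Lemma Cconj_RtoC (r : R) : Cconj (RtoC r) = RtoC r.
Proof. apply injective_projections; simpl; ring. Qed.

Lemma Cconj_Ci : Cconj Ci = - Ci.
Proof. apply injective_projections; simpl; ring. Qed.

Lemma arrow_id n m p : arrow n m p p 1.
Proof. destruct p as [[|] z]; simpl; split; try apply Cpow_1_l; ring. Qed.

Lemma local_change_id n m k U : open U -> local_change n m k k U (fun z => z) (fun _ => 1).
Proof.
  intros HU. split; [exact HU|]. split; [apply csmooth_id, HU|].
  split; [apply csmooth_const|]. intros z _. apply arrow_id.
Qed.

Lemma pairing_1 A : pairing A 1 = fst A.
Proof. unfold pairing; simpl; ring. Qed.

Lemma pairing_Ci A : pairing A Ci = snd A.
Proof. unfold pairing; simpl; ring. Qed.

Lemma pairing_mult A d v :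
  pairing A (d * v) = (pairing A (d * 1) * Re v + pairing A (d * Ci) * Im v)%R.
Proof. unfold pairing, Re, Im; simpl; ring. Qed.

Lemma csmooth_continuous (U : C -> Prop) (f : C -> C) z : csmooth U f -> U z -> continuous f z.
Proof.
  intros [H1 H2] Hz.
  apply continuous_ext with (fun z => (Re (f z), Im (f z))).
  { intros w; symmetry; apply surjective_pairing. }
  apply (@continuous_comp_2 C_UniformSpace R_UniformSpace R_UniformSpace C_UniformSpace
           (fun z => Re (f z)) (fun z => Im (f z)) (fun a b => (a, b))).
  - exact (Ck_cont O U _ (H1 O) z Hz).
  - exact (Ck_cont O U _ (H2 O) z Hz).
  - apply continuous_ext with (fun u => u); [intros; apply surjective_pairing | apply continuous_id].
Qed.

Lemma is_derive_C_continuous (c : R -> C) t v : is_derive_C c t v -> continuous c t.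
Proof. intros H. apply (@ex_derive_continuous R_AbsRing C_R_NormedModule). exists v; exact H. Qed.

(** Smoothness and connection compatibility of transition functions are available only when a whole
    family of arrows starts and ends in given frames. This shrinks a family to meet that condition;
    openness comes from continuity of [phi]. *)
Lemma local_change_preim n m k l W phi delta (U V : C -> Prop) :
  open U -> open V -> local_change n m k l W phi delta ->
  local_change n m k l (fun z => W z /\ U z /\ V (phi z)) phi delta.
Proof.
  intros HU HV [HW [Hp [Hd Ha]]].
  split; [|split; [|split]].
  - intros z [H1 [H2 H3]]. apply filter_and; [apply HW, H1|]. apply filter_and; [apply HU, H2|].
    apply (csmooth_continuous W phi z Hp H1). apply HV, H3.
  - apply csmooth_subset with W; [tauto | exact Hp].
  - apply csmooth_subset with W; [tauto | exact Hd].
  - intros z Hz. apply Ha, Hz.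
Qed.

Section Bundle.
Context {n m : nat} (B : line_bundle n m).

(** The identity arrow composed with itself makes the value idempotent, and modulus 1 makes it
    invertible. *)
Lemma lb_tr_id i p : lb_dom B i p -> lb_tr B i i p p 1 = 1.
Proof.
  intros H. pose proof (arrow_id n m p) as Ha.
  pose proof (lb_cocycle _ _ B i i i p p p 1 1 H H H Ha Ha) as E.
  rewrite Cmult_1_l in E.
  assert (N := Cmod_1_neq_0 _ (lb_unitary _ _ B i i p p 1 H H Ha)).
  set (x := lb_tr B i i p p 1) in *.
  transitivity (x * x / x); [field; exact N | rewrite <- E; field; exact N].
Qed.

Lemma lb_tr_left i j l p q d : lb_dom B i p -> lb_dom B j q -> lb_dom B l q -> arrow n m p q d ->
  lb_tr B i l p q d = lb_tr B j l q q 1 * lb_tr B i j p q d.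
Proof.
  intros Hi Hj Hl Ha.
  rewrite <- (lb_cocycle _ _ B i j l p q q d 1 Hi Hj Hl Ha (arrow_id n m q)).
  rewrite Cmult_1_l. reflexivity.
Qed.

Lemma lb_tr_right i j l p q d : lb_dom B i p -> lb_dom B j p -> lb_dom B l q -> arrow n m p q d ->
  lb_tr B i l p q d = lb_tr B j l p q d * lb_tr B i j p p 1.
Proof.
  intros Hi Hj Hl Ha.
  rewrite <- (lb_cocycle _ _ B i j l p p q 1 d Hi Hj Hl (arrow_id n m p) Ha).
  rewrite Cmult_1_r. reflexivity.
Qed.

(* [s i z] is the coefficient with respect to the frame [s_i] of a parallel unit section over [U]. *)
Definition parallel_on (k : chart) (U : C -> Prop) (s : lb_idx B -> C -> C) : Prop :=
  (forall i z, U z -> lb_dom B i (k, z) -> Cmod (s i z) = 1%R) /\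
  (forall i j z, U z -> lb_dom B i (k, z) -> lb_dom B j (k, z) ->
     s j z = lb_tr B i j (k, z) (k, z) 1 * s i z) /\
  (forall i, csmooth (fun z => U z /\ lb_dom B i (k, z)) (s i)) /\
  (forall i z, U z -> lb_dom B i (k, z) ->
     CDx (s i) z = Ci * s i z * RtoC (fst (lb_conn B i (k, z))) /\
     CDy (s i) z = Ci * s i z * RtoC (snd (lb_conn B i (k, z)))).

Lemma open_and_dom U i k : open U -> open (fun z => U z /\ lb_dom B i (k, z)).
Proof. intros HU. apply open_and; [exact HU | apply lb_open]. Qed.

Lemma parallel_on_subset k (U V : C -> Prop) s : (forall z, V z -> U z) ->
  parallel_on k U s -> parallel_on k V s.
Proof.
  intros HVU [H1 [H2 [H3 H4]]].
  split; [|split; [|split]]; intros; auto.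
  apply csmooth_subset with (2 := H3 i). intros z [Hz Hz']; auto.
Qed.

Lemma parallel_on_ext_dom k U s s' : open U ->
  (forall i z, U z -> lb_dom B i (k, z) -> s i z = s' i z) ->
  parallel_on k U s -> parallel_on k U s'.
Proof.
  intros HU E [H1 [H2 [H3 H4]]]. split; [|split; [|split]].
  - intros i z Hz Hi. rewrite <- E; auto.
  - intros i j z Hz Hi Hj. rewrite <- !E; auto.
  - intros i. apply csmooth_ext with (s i); [apply open_and_dom, HU | | apply H3].
    intros z [Hz Hi]; apply E; assumption.
  - intros i z Hz Hi. rewrite <- E by assumption.
    destruct (CD_ext _ (s i) (s' i) z (open_and_dom U i k HU) (conj Hz Hi)) as [<- <-].
    + intros w [Hw Hw']; apply E; assumption.
    + apply H4; assumption.
Qed.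

Lemma parallel_on_union k (P : (C -> Prop) -> Prop) U s :
  (forall z, U z -> exists V, P V /\ V z) -> (forall V, P V -> parallel_on k V s) ->
  parallel_on k U s.
Proof.
  intros HU H. split; [|split; [|split]].
  - intros i z Hz. destruct (HU z Hz) as [V [HV Hz']]. apply (H V HV); exact Hz'.
  - intros i j z Hz. destruct (HU z Hz) as [V [HV Hz']]. destruct (H V HV) as [_ [H2 _]]. apply H2; exact Hz'.
  - intros i. apply csmooth_union with (fun V' => exists V, P V /\ V' = (fun z => V z /\ lb_dom B i (k, z))).
    + intros z [Hz Hi]. destruct (HU z Hz) as [V [HV Hz']].
      exists (fun z => V z /\ lb_dom B i (k, z)). split; [exists V; auto | auto].
    + intros V' [V [HV ->]]. apply (H V HV).
  - intros i z Hz. destruct (HU z Hz) as [V [HV Hz']]. destruct (H V HV) as [_ [_ [_ H4]]]. apply H4; exact Hz'.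
Qed.

Lemma parallel_on_scal k U s c : open U -> Cmod c = 1%R -> parallel_on k U s ->
  parallel_on k U (fun i z => c * s i z).
Proof.
  intros HU Hc [H1 [H2 [H3 H4]]]. split; [|split; [|split]].
  - intros i z Hz Hi. rewrite Cmod_mult, Hc, H1 by assumption. ring.
  - intros i j z Hz Hi Hj. rewrite (H2 i j z) by assumption. ring.
  - intros i. apply (csmooth_mult _ (fun _ => c) (s i)); [apply open_and_dom, HU | apply csmooth_const | apply H3].
  - intros i z Hz Hi. destruct (H4 i z Hz Hi) as [E1 E2].
    rewrite (CDx_mult _ (fun _ => c) (s i) z (csmooth_const _ c) (H3 i) (conj Hz Hi)).
    rewrite (CDy_mult _ (fun _ => c) (s i) z (csmooth_const _ c) (H3 i) (conj Hz Hi)).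
    rewrite E1, E2.
    assert (E0 : CDx (fun _ : C => c) z = 0 /\ CDy (fun _ : C => c) z = 0)
      by (apply has_partials_CD; split; apply is_derive_C_const).
    destruct E0 as [-> ->]. split; ring.
Qed.

Lemma parallel_on_curve k U s c t v i : open U -> parallel_on k U s ->
  is_derive_C c t v -> U (c t) -> lb_dom B i (k, c t) ->
  is_derive_C (fun t => s i (c t)) t (Ci * s i (c t) * RtoC (pairing (lb_conn B i (k, c t)) v)).
Proof.
  intros HU [H1 [H2 [H3 H4]]] Hc Ht Hi.
  apply (is_derive_C_eq _ _ _ _
    (csmooth_chain _ (s i) c t v (open_and_dom U i k HU) (H3 i) (conj Ht Hi) Hc)).
  destruct (H4 i (c t) Ht Hi) as [-> ->].
  unfold pairing. rewrite RtoC_plus, !RtoC_mult. ring.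
Qed.

(** The record states compatibility in the directions 1 and i only; an arbitrary velocity is handled
    by real linearity ([pairing_mult]). *)
Lemma lb_tr_curve i j k l W phi delta c t v : local_change n m k l W phi delta ->
  is_derive_C c t v -> W (c t) -> lb_dom B i (k, c t) -> lb_dom B j (l, phi (c t)) ->
  is_derive_C (fun t => lb_tr B i j (k, c t) (l, phi (c t)) (delta (c t))) t
    (Ci * lb_tr B i j (k, c t) (l, phi (c t)) (delta (c t)) *
     RtoC (pairing (lb_conn B j (l, phi (c t))) (delta (c t) * v) - pairing (lb_conn B i (k, c t)) v)).
Proof.
  intros HW Hc Ht Hi Hj.
  pose proof (local_change_preim n m k l W phi delta _ _ (lb_open _ _ B i k) (lb_open _ _ B j l) HW) as HW'.
  assert (Hd : forall z, W z /\ lb_dom B i (k, z) /\ lb_dom B j (l, phi z) ->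
     lb_dom B i (k, z) /\ lb_dom B j (l, phi z)) by tauto.
  pose proof (lb_tr_smooth _ _ B i j k l _ phi delta HW' Hd) as S.
  destruct (lb_conn_tr _ _ B i j k l _ phi delta HW' Hd (c t) (conj Ht (conj Hi Hj))) as [E1 E2].
  apply (is_derive_C_eq _ _ _ _
    (csmooth_chain _ (fun z => lb_tr B i j (k, z) (l, phi z) (delta z)) c t v
       (proj1 HW') S (conj Ht (conj Hi Hj)) Hc)).
  rewrite E1, E2, (pairing_mult _ (delta (c t)) v), !pairing_1, !pairing_Ci.
  change (pairing (lb_conn B i (k, c t)) v) with
    (fst (lb_conn B i (k, c t)) * Re v + snd (lb_conn B i (k, c t)) * Im v)%R.
  rewrite !RtoC_minus, !RtoC_plus, !RtoC_mult. ring.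
Qed.

(** An arbitrary choice of frame at each point, so that [arrow_ratio] is a total function of the
    arrow; [arrow_ratio_frames] shows the choice to be immaterial. *)
Definition frame_at (p : point) : lb_idx B :=
  proj1_sig (constructive_indefinite_description _ (lb_cover n m B p)).

Lemma frame_at_dom p : lb_dom B (frame_at p) p.
Proof. apply (proj2_sig (constructive_indefinite_description _ (lb_cover n m B p))). Qed.

(* The action of an arrow relative to parallel sections [s] at its source and [s'] at its target;
   [Cconj] inverts a coefficient of modulus 1. *)
Definition arrow_ratio (k l : chart) (s s' : lb_idx B -> C -> C) (z w d : C) : C :=
  Cconj (s' (frame_at (l, w)) w) *
  lb_tr B (frame_at (k, z)) (frame_at (l, w)) (k, z) (l, w) d * s (frame_at (k, z)) z.

(** A change of frame at the source cancels between section and transition function; one at the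
    target appears multiplied by its own conjugate. *)
Lemma arrow_ratio_frames k l U V s s' z w d i j :
  parallel_on k U s -> parallel_on l V s' -> U z -> V w ->
  lb_dom B i (k, z) -> lb_dom B j (l, w) -> arrow n m (k, z) (l, w) d ->
  arrow_ratio k l s s' z w d = Cconj (s' j w) * lb_tr B i j (k, z) (l, w) d * s i z.
Proof.
  intros [H1 [H2 _]] [H1' [H2' _]] Hz Hw Hi Hj Ha. unfold arrow_ratio.
  pose proof (frame_at_dom (k, z)) as Di. pose proof (frame_at_dom (l, w)) as Dj.
  set (i' := frame_at (k, z)) in *. set (j' := frame_at (l, w)) in *.
  rewrite (lb_tr_left i' j j' _ _ d), (lb_tr_right i' i j _ _ d) by assumption.
  rewrite (H2' j j' w), (H2 i' i z) by assumption.
  pose proof (Cmod_1_conj_l _ (lb_unitary _ _ B j j' _ _ _ Hj Dj (arrow_id n m (l, w)))) as E.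
  rewrite Cmult_conj.
  transitivity (Cconj (lb_tr B j j' (l, w) (l, w) 1) * lb_tr B j j' (l, w) (l, w) 1 *
    (Cconj (s' j w) * lb_tr B i j (k, z) (l, w) d * (lb_tr B i' i (k, z) (k, z) 1 * s i' z))); [ring|].
  rewrite E. ring.
Qed.

Lemma arrow_ratio_unitary k l U V s s' z w d :
  parallel_on k U s -> parallel_on l V s' -> U z -> V w -> arrow n m (k, z) (l, w) d ->
  Cmod (arrow_ratio k l s s' z w d) = 1%R.
Proof.
  intros [H1 _] [H1' _] Hz Hw Ha. unfold arrow_ratio.
  rewrite !Cmod_mult, Cmod_conj, H1, H1', lb_unitary; auto using frame_at_dom. ring.
Qed.

Lemma arrow_ratio_comp j k l U V W s s' s'' x y z d e :
  parallel_on j U s -> parallel_on k V s' -> parallel_on l W s'' -> U x -> V y -> W z ->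
  arrow n m (j, x) (k, y) d -> arrow n m (k, y) (l, z) e ->
  arrow_ratio j l s s'' x z (e * d) = arrow_ratio k l s' s'' y z e * arrow_ratio j k s s' x y d.
Proof.
  intros [H1 _] [H1' _] [H1'' _] Hx Hy Hz Ha Hb. unfold arrow_ratio.
  rewrite (lb_cocycle _ _ B _ (frame_at (k, y)) _ _ (k, y) _ d e) by auto using frame_at_dom.
  pose proof (Cmod_1_conj_l _ (H1' _ y Hy (frame_at_dom (k, y)))) as E.
  set (a := s' (frame_at (k, y)) y) in *.
  match goal with |- ?x = _ => transitivity (x * (Cconj a * a)) end; [rewrite E; ring | ring].
Qed.

(** Logarithmic derivatives cancel: the source section contributes +iA(v), the arrow i(A'(dl v) -
    A(v)), the conjugated target section -iA'(dl v). The family [phi], [delta] has to follow the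
    curve of arrows only near [t], so different branches may serve at different times. *)
Lemma arrow_ratio_curve k l U V s s' W phi delta c c' dl t v :
  open U -> open V -> parallel_on k U s -> parallel_on l V s' ->
  local_change n m k l W phi delta -> W (c t) -> U (c t) -> V (c' t) ->
  is_derive_C c t v -> is_derive_C c' t (dl t * v) ->
  locally t (fun t' => phi (c t') = c' t' /\ delta (c t') = dl t') ->
  is_derive_C (fun t => arrow_ratio k l s s' (c t) (c' t) (dl t)) t 0.
Proof.
  intros HU HV Hs Hs' HW Wt Ut Vt Hc Hc' Hloc.
  set (i := frame_at (k, c t)). set (j := frame_at (l, c' t)).
  assert (Di : lb_dom B i (k, c t)) by apply frame_at_dom.
  assert (Dj : lb_dom B j (l, c' t)) by apply frame_at_dom.
  destruct (locally_singleton _ _ Hloc) as [E1 E2].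
  (* The chosen frame can jump along the curve, so the frames at time [t] are frozen; near [t] they
     still cover both ends and give the same ratio. *)
  apply (is_derive_ext_loc (V := C_R_NormedModule)
     (fun t => Cconj (s' j (c' t)) * lb_tr B i j (k, c t) (l, phi (c t)) (delta (c t)) * s i (c t))).
  - pose proof (is_derive_C_continuous _ _ _ Hc) as Cc. pose proof (is_derive_C_continuous _ _ _ Hc') as Cc'.
    pose proof (Cc _ (HU _ Ut)) as L1. pose proof (Cc' _ (HV _ Vt)) as L2.
    pose proof (Cc _ (lb_open _ _ B i k _ Di)) as L3. pose proof (Cc' _ (lb_open _ _ B j l _ Dj)) as L4.
    pose proof (Cc _ (proj1 HW _ Wt)) as L5.
    unfold filtermap in *.
    pose proof (filter_and _ _ Hloc (filter_and _ _ L1 (filter_and _ _ L2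
      (filter_and _ _ L3 (filter_and _ _ L4 L5))))) as L.
    apply filter_imp with (2 := L). intros t' [[e1 e2] [u1 [u2 [u3 [u4 u5]]]]].
    assert (Ha := proj2 (proj2 (proj2 HW)) _ u5). rewrite e1, e2 in Ha |- *.
    symmetry. apply (arrow_ratio_frames k l U V); assumption.
  - pose proof (parallel_on_curve k U s c t v i HU Hs Hc Ut Di) as D1.
    pose proof (parallel_on_curve l V s' c' t _ j HV Hs' Hc' Vt Dj) as D2.
    assert (Dj' : lb_dom B j (l, phi (c t))) by (rewrite E1; exact Dj).
    pose proof (lb_tr_curve i j k l W phi delta c t v HW Hc Wt Di Dj') as D3.
    rewrite E1, E2 in D3.
    apply (is_derive_C_eq _ _ _ _ (is_derive_C_mult _ _ _ _ _
       (is_derive_C_mult _ _ _ _ _ (is_derive_C_conj _ _ _ D2) D3) D1)).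
    rewrite E1, E2, !Cmult_conj, Cconj_RtoC, Cconj_Ci, RtoC_minus.
    ring.
Qed.

(** The equation is solved in a single frame [i0], where flatness is the vanishing of the curl, and
    then carried to every other frame by the transition functions over identity arrows. *)
Lemma parallel_on_local k z0 : flat B ->
  exists e s, (0 < e)%R /\ parallel_on k (box (Re z0 - e) (Re z0 + e) (Im z0 - e) (Im z0 + e)) s.
Proof.
  intros HF. set (i0 := frame_at (k, z0)).
  destruct (open_contains_box _ z0 (lb_open _ _ B i0 k) (frame_at_dom (k, z0))) as [e [He Hb]].
  set (U := box (Re z0 - e) (Re z0 + e) (Im z0 - e) (Im z0 + e)) in *.
  destruct (lb_conn_smooth _ _ B i0 k) as [S1 S2].
  assert (Hcurl : forall z, U z -> Dx (fun z => snd (lb_conn B i0 (k, z))) z =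
                                  Dy (fun z => fst (lb_conn B i0 (k, z))) z).
  { intros z Hz. pose proof (HF i0 (k, z) (Hb z Hz)) as E. unfold curvature in E; simpl in E.
    apply (f_equal snd) in E. simpl in E. apply Rminus_diag_uniq. lra. }
  destruct (parallel_box _ _ _ _ (fun z => fst (lb_conn B i0 (k, z))) (fun z => snd (lb_conn B i0 (k, z)))
    (fun r => Ck_subset r _ U _ Hb (S1 r)) (fun r => Ck_subset r _ U _ Hb (S2 r)) Hcurl)
    as [g [Sg Hg]].
  fold U in Sg, Hg.
  assert (HU : open U) by apply open_box.
  exists e, (fun j z => lb_tr B i0 j (k, z) (k, z) 1 * g z). split; [exact He|].
  assert (HC : forall j, local_change n m k k (fun z => U z /\ lb_dom B j (k, z)) (fun z => z) (fun _ => 1))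
    by (intros j; apply local_change_id, open_and_dom, HU).
  assert (HD : forall j z, U z /\ lb_dom B j (k, z) -> lb_dom B i0 (k, z) /\ lb_dom B j (k, z))
    by (intros j z [Hz Hj]; auto).
  assert (ST : forall j, csmooth (fun z => U z /\ lb_dom B j (k, z)) (fun z => lb_tr B i0 j (k, z) (k, z) 1))
    by (intros j; apply (lb_tr_smooth _ _ B i0 j k k _ _ _ (HC j) (HD j))).
  assert (Sg' : forall j, csmooth (fun z => U z /\ lb_dom B j (k, z)) g)
    by (intros j; apply csmooth_subset with (2 := Sg); tauto).
  split; [|split; [|split]].
  - intros i z Hz Hi. rewrite Cmod_mult, lb_unitary by auto using arrow_id.
    destruct (Hg z Hz) as [-> _]. ring.
  - intros i j z Hz Hi Hj.
    rewrite (lb_tr_left i0 i j (k, z) (k, z) 1) by auto using arrow_id. ring.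
  - intros j. apply csmooth_mult; [apply open_and_dom, HU | apply ST | apply Sg'].
  - intros j z Hz Hj.
    pose proof (conj Hz Hj : (fun z => U z /\ lb_dom B j (k, z)) z) as Hz'.
    rewrite (CDx_mult _ _ _ z (ST j) (Sg' j) Hz'), (CDy_mult _ _ _ z (ST j) (Sg' j) Hz').
    destruct (lb_conn_tr _ _ B i0 j k k _ _ _ (HC j) (HD j) z Hz') as [E1 E2].
    destruct (Hg z Hz) as [_ [G1 G2]].
    rewrite E1, E2, G1, G2, !Cmult_1_l, !pairing_1, !pairing_Ci, !RtoC_minus. split; ring.
Qed.

End Bundle.

(** * Extending parallel sections to the whole plane *)

Lemma is_derive_C_segment (z0 v : C) t : is_derive_C (fun t => z0 + RtoC t * v) t v.
Proof.
  apply is_derive_C_iff. destruct z0 as [x0 y0], v as [x y]. simpl. split; auto_derive; trivial; ring.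
Qed.

(** Continuous induction: a property of intervals that holds locally and passes to unions of
    overlapping intervals holds on every interval. The proof takes the supremum of the right ends
    reachable from [a]. *)
Lemma interval_induction (P : R -> R -> Prop) :
  (forall a b a' b', (a <= a')%R -> (b' <= b)%R -> P a b -> P a' b') ->
  (forall x, exists e, (0 < e)%R /\ P (x - e)%R (x + e)%R) ->
  (forall a b a' b', (a < a')%R -> (a' < b)%R -> (b < b')%R -> P a b -> P a' b' -> P a b') ->
  forall a b, (a < b)%R -> P a b.
Proof.
  intros Hmono Hloc Hglue a b Hab.
  set (E := fun t => (a < t <= b)%R /\ P a t).
  destruct (Hloc a) as [e0 [He0 P0]].
  assert (HE0 : E (Rmin b (a + e0))).
  { split.
    - split; [apply Rmin_glb_lt; lra | apply Rmin_l].
    - apply (Hmono (a - e0)%R (a + e0)%R); [lra | apply Rmin_r | exact P0]. }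
  destruct (completeness E) as [l [Hub Hlub]].
  { exists b. intros t [[_ H] _]; exact H. }
  { eexists; exact HE0. }
  assert (Hl : (a < l <= b)%R).
  { split; [apply Rlt_le_trans with (2 := Hub _ HE0); apply HE0|].
    apply Hlub. intros t [[_ H] _]; exact H. }
  destruct (Hloc l) as [e [He Pl]].
  assert (Ht : exists t, E t /\ (l - e < t)%R).
  { apply NNPP; intros N. assert (l <= l - e)%R; [|lra].
    apply Hlub. intros t Ht. apply Rnot_lt_le. intros Hlt. apply N; exists t; auto. }
  destruct Ht as [t [[[Hat Htb] Pt] Hlt]].
  assert (Htl : (t <= l)%R) by (apply Hub; split; auto).
  assert (PP : P a (l + e)%R).
  (* The second interval has to start strictly between [a] and [t]; the midpoint keeps [lo] above
     [a] in case l - e lies to the left of [a]. *)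
  { set (lo := Rmax (l - e) ((a + t) / 2)).
    assert (H1 : ((a + t) / 2 <= lo)%R) by apply Rmax_r.
    assert (H2 : (lo < t)%R) by (apply Rmax_lub_lt; lra).
    apply (Hglue a t lo (l + e)%R); try lra; [exact Pt|].
    apply (Hmono (l - e)%R (l + e)%R); [apply Rmax_l | lra | exact Pl]. }
  destruct (Rlt_le_dec l b) as [Hlb|Hlb].
  - exfalso. assert (HE : E (Rmin b (l + e))).
    { split; [split; [apply Rmin_glb_lt; lra | apply Rmin_l]|].
      apply (Hmono a (l + e)%R); [lra | apply Rmin_r | exact PP]. }
    pose proof (Hub _ HE). assert (l < Rmin b (l + e))%R by (apply Rmin_glb_lt; lra). lra.
  - apply (Hmono a (l + e)%R); [lra | lra | exact PP].
Qed.

Lemma between_segment a b x y t : (0 <= t <= 1)%R -> (a < x < b)%R -> (a < y < b)%R ->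
  (a < x + t * (y - x) < b)%R.
Proof. intros Ht Hx Hy. destruct (Rle_dec x y); split; nra. Qed.

Lemma box_segment a b c d z w t : (0 <= t <= 1)%R -> box a b c d z -> box a b c d w ->
  box a b c d (z + RtoC t * (w - z)).
Proof.
  intros Ht [[H1 H2] [H3 H4]] [[H5 H6] [H7 H8]]. split.
  - replace (Re (z + RtoC t * (w - z))) with (Re z + t * (Re w - Re z))%R by (unfold Re, Im; simpl; ring).
    apply between_segment; auto.
  - replace (Im (z + RtoC t * (w - z))) with (Im z + t * (Im w - Im z))%R by (unfold Re, Im; simpl; ring).
    apply between_segment; auto.
Qed.

Section Bundle.
Context {n m : nat} (B : line_bundle n m).

(** For identity arrows [arrow_ratio] is the quotient of two sections, and it is constant along the
    segment from [z0] to [z]. *)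
Lemma parallel_on_unique k U V s s' z0 z i0 i : open U -> open V ->
  parallel_on B k U s -> parallel_on B k V s' ->
  (forall t, (0 <= t <= 1)%R -> U (z0 + RtoC t * (z - z0)) /\ V (z0 + RtoC t * (z - z0))) ->
  lb_dom B i0 (k, z0) -> lb_dom B i (k, z) ->
  s i z = s i0 z0 * Cconj (s' i0 z0) * s' i z.
Proof.
  intros HU HV Hs Hs' Hseg Hi0 Hi.
  assert (E0 : z0 + RtoC 0 * (z - z0) = z0) by ring.
  assert (E1 : z0 + RtoC 1 * (z - z0) = z) by ring.
  destruct (Hseg 0%R) as [U0 V0]; [lra|]. destruct (Hseg 1%R) as [U1 V1]; [lra|].
  rewrite E0 in U0, V0. rewrite E1 in U1, V1.
  assert (K : arrow_ratio B k k s s' z0 z0 1 = arrow_ratio B k k s s' z z 1).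
  { set (c := fun t : R => z0 + RtoC t * (z - z0)).
    transitivity (arrow_ratio B k k s s' (c 0%R) (c 0%R) 1); [unfold c; rewrite E0; reflexivity|].
    transitivity (arrow_ratio B k k s s' (c 1%R) (c 1%R) 1); [|unfold c; rewrite E1; reflexivity].
    apply (is_derive_C_zero (fun t => arrow_ratio B k k s s' (c t) (c t) 1)); [lra|].
    intros t Ht. destruct (Hseg t Ht) as [Ut Vt].
    apply (arrow_ratio_curve B k k U V s s' (fun z => U z /\ V z) (fun z => z) (fun _ => 1) c c
             (fun _ => 1) t (z - z0)); auto.
    - apply local_change_id, open_and; assumption.
    - apply is_derive_C_segment.
    - rewrite Cmult_1_l. apply is_derive_C_segment.
    - apply filter_forall. auto. }
  rewrite (arrow_ratio_frames B k k U V s s' z0 z0 1 i0 i0) in K by auto using arrow_id.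
  rewrite (arrow_ratio_frames B k k U V s s' z z 1 i i) in K by auto using arrow_id.
  rewrite !lb_tr_id in K by assumption.
  destruct Hs' as [N _]. pose proof (Cmod_1_conj_l _ (N i z V1 Hi)) as E.
  transitivity (Cconj (s' i z) * 1 * s i z * s' i z).
  - transitivity (Cconj (s' i z) * s' i z * s i z); [rewrite E; ring | ring].
  - rewrite <- K. ring.
Qed.

(** The second section is multiplied by the quotient of the two at [z0]. They then agree on the
    whole intersection, because it is star-shaped about [z0]. *)
Lemma parallel_on_glue k U V s s' z0 : open U -> open V ->
  parallel_on B k U s -> parallel_on B k V s' -> U z0 -> V z0 ->
  (forall z t, (0 <= t <= 1)%R -> U z -> V z ->
     U (z0 + RtoC t * (z - z0)) /\ V (z0 + RtoC t * (z - z0))) ->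
  exists s'', parallel_on B k (fun z => U z \/ V z) s''.
Proof.
  intros HU HV Hs Hs' U0 V0 Hconv.
  set (i0 := frame_at B (k, z0)). pose proof (frame_at_dom B (k, z0)) as D0. fold i0 in D0.
  set (c := s i0 z0 * Cconj (s' i0 z0)).
  exists (fun i z => if excluded_middle_informative (U z /\ lb_dom B i (k, z)) then s i z else c * s' i z).
  assert (Hc : Cmod c = 1%R).
  { unfold c. destruct Hs as [N _], Hs' as [N' _]. rewrite Cmod_mult, Cmod_conj, N, N' by assumption. ring. }
  apply (parallel_on_union B k (fun W => W = U \/ W = V)).
  - intros z [Hz|Hz]; [exists U | exists V]; auto.
  - intros W [-> | ->].
    + apply (parallel_on_ext_dom B k U s); [exact HU| |exact Hs].
      intros i z Hz Hi. destruct (excluded_middle_informative _); tauto.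
    + apply (parallel_on_ext_dom B k V (fun i z => c * s' i z)); [exact HV| |].
      * intros i z Hz Hi. destruct (excluded_middle_informative _) as [[Hz' _]|]; [|reflexivity].
        symmetry. apply (parallel_on_unique k U V s s' z0 z i0 i); auto.
      * apply parallel_on_scal; assumption.
Qed.

(* A section is first extended in x along a thin horizontal strip, whose height may shrink at each
   step, and the strips are then glued in y. *)
Lemma parallel_on_box k : flat B -> forall a b c d, (a < b)%R -> (c < d)%R ->
  exists s, parallel_on B k (box a b c d) s.
Proof.
  intros HF a b c d Hab.
  assert (Hsub : forall a b c d a' b' c' d', (a <= a')%R -> (b' <= b)%R -> (c <= c')%R -> (d' <= d)%R ->
    (exists s, parallel_on B k (box a b c d) s) -> exists s, parallel_on B k (box a' b' c' d') s).
  { intros a1 b1 c1 d1 a2 b2 c2 d2 H1 H2 H3 H4 [s Hs]. exists s.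
    apply parallel_on_subset with (2 := Hs). intros z [Hz Hz']. split; lra. }
  revert c d. apply interval_induction.
  - intros c d c' d' Hc Hd. apply Hsub; lra.
  - intros y.
    enough (K : exists e, (0 < e)%R /\ exists s, parallel_on B k (box a b (y - e) (y + e)) s) by exact K.
    revert a b Hab. apply (interval_induction (fun a b => exists e, (0 < e)%R /\
      exists s, parallel_on B k (box a b (y - e) (y + e)) s)).
    + intros a b a' b' Ha Hb [e [He K]]. exists e. split; [exact He|]. revert K. apply Hsub; lra.
    + intros x. destruct (parallel_on_local B k (x, y) HF) as [e [s [He Hs]]].
      exists e. split; [exact He|]. exists e. split; [exact He|]. exists s. exact Hs.
    + intros a b a' b' H1 H2 H3 [e [He K]] [e' [He' K']].
      exists (Rmin e e'). pose proof (Rmin_l e e'). pose proof (Rmin_r e e').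
      assert (0 < Rmin e e')%R by (apply Rmin_glb_lt; assumption).
      split; [assumption|]. set (f := Rmin e e') in *.
      assert (K1 : exists s, parallel_on B k (box a b (y - f) (y + f)) s) by (revert K; apply Hsub; lra).
      assert (K2 : exists s, parallel_on B k (box a' b' (y - f) (y + f)) s) by (revert K'; apply Hsub; lra).
      destruct K1 as [s Hs], K2 as [s' Hs'].
      destruct (parallel_on_glue k _ _ s s' (((a' + b) / 2)%R, y) (open_box _ _ _ _) (open_box _ _ _ _) Hs Hs')
        as [s'' Hs''].
      * unfold box; simpl; lra.
      * unfold box; simpl; lra.
      * intros z t Ht Hz Hz'. split; apply box_segment; auto; unfold box; simpl; lra.
      * exists s''. apply parallel_on_subset with (2 := Hs''). intros z [Hz Hz'].
        destruct (Rlt_le_dec (Re z) b); [left | right]; split; lra.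
  - intros c d c' d' H1 H2 H3 [s Hs] [s' Hs'].
    destruct (parallel_on_glue k _ _ s s' (((a + b) / 2)%R, ((c' + d) / 2)%R) (open_box _ _ _ _) (open_box _ _ _ _) Hs Hs')
        as [s'' Hs''].
    + unfold box; simpl; lra.
    + unfold box; simpl; lra.
    + intros z t Ht Hz Hz'. split; apply box_segment; auto; unfold box; simpl; lra.
    + exists s''. apply parallel_on_subset with (2 := Hs''). intros z [Hz Hz'].
      destruct (Rlt_le_dec (Im z) d); [left | right]; split; lra.
Qed.

(** The plane is exhausted by squares. Normalising each section to 1 at the origin in the frame [i0]
    makes them agree wherever two squares meet, so any square containing a point can define the
    global section there. *)
Lemma parallel_on_plane k : flat B -> exists s, parallel_on B k (fun _ => True) s.
Proof.
  intros HF.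
  set (Q := fun N : nat => let r := (INR N + 1)%R in box (- r) r (- r) r).
  assert (Q0 : forall N, Q N 0).
  { intros N. unfold Q, box; simpl. pose proof (pos_INR N). lra. }
  assert (QU : forall N, open (Q N)) by (intros; apply open_box).
  set (i0 := frame_at B (k, RtoC 0)). pose proof (frame_at_dom B (k, RtoC 0)) as D0. fold i0 in D0.
  assert (HS : forall N, exists s, parallel_on B k (Q N) s /\ s i0 0 = 1).
  { intros N. pose proof (pos_INR N).
    destruct (parallel_on_box k HF (- (INR N + 1))%R (INR N + 1)%R (- (INR N + 1))%R (INR N + 1)%R)
      as [s Hs]; [lra | lra |].
    assert (N1 : Cmod (s i0 0) = 1%R) by (apply Hs; [apply (Q0 N) | exact D0]).
    exists (fun i z => Cconj (s i0 0) * s i z). split.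
    - apply parallel_on_scal; [apply QU | rewrite Cmod_conj; exact N1 | exact Hs].
    - apply Cmod_1_conj_l, N1. }
  set (S := fun N => proj1_sig (constructive_indefinite_description _ (HS N))).
  assert (HS1 : forall N, parallel_on B k (Q N) (S N))
    by (intros N; apply (proj2_sig (constructive_indefinite_description _ (HS N)))).
  assert (HS2 : forall N, S N i0 0 = 1)
    by (intros N; apply (proj2_sig (constructive_indefinite_description _ (HS N)))).
  assert (HSS : forall N M i z, Q N z -> Q M z -> lb_dom B i (k, z) -> S N i z = S M i z).
  { intros N M i z HN HM Hi.
    rewrite (parallel_on_unique k (Q N) (Q M) (S N) (S M) 0 z i0 i); auto.
    - rewrite !HS2. transitivity (1 * (Cconj 1 * 1) * S M i z); [ring|].
      rewrite Cmod_1_conj_l by apply Cmod_1. ring.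
    - intros t Ht. split; apply box_segment; auto; apply Q0. }
  assert (Hex : forall z, exists N, Q N z).
  { intros z. destruct (nfloor_ex (Rabs (Re z) + Rabs (Im z))) as [N [_ HN]].
    { pose proof (Rabs_pos (Re z)). pose proof (Rabs_pos (Im z)). lra. }
    exists N. unfold Q, box. pose proof (Rabs_pos (Re z)). pose proof (Rabs_pos (Im z)).
    destruct (Rabs_def2 (Re z) (INR N + 1)); [lra|].
    destruct (Rabs_def2 (Im z) (INR N + 1)); lra. }
  set (num := fun z => proj1_sig (constructive_indefinite_description _ (Hex z))).
  assert (Hnum : forall z, Q (num z) z)
    by (intros z; apply (proj2_sig (constructive_indefinite_description _ (Hex z)))).
  exists (fun i z => S (num z) i z).
  apply (parallel_on_union B k (fun V => exists N, V = Q N)).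
  - intros z _. exists (Q (num z)). split; [exists (num z); reflexivity | apply Hnum].
  - intros V [N ->]. apply (parallel_on_ext_dom B k (Q N) (S N)); [apply QU| |apply HS1].
    intros i z Hz Hi. apply HSS; auto.
Qed.

End Bundle.

(** * Roots of unity and the torsion bundles *)

Lemma cis_0 : cis 0 = 1.
Proof. unfold cis. rewrite cos_0, sin_0. reflexivity. Qed.

Lemma cis_plus a b : cis (a + b) = cis a * cis b.
Proof. unfold cis. rewrite cos_plus, sin_plus. apply injective_projections; simpl; ring. Qed.

Lemma cis_opp a : cis (- a) = Cconj (cis a).
Proof. unfold cis. rewrite cos_neg, sin_neg. reflexivity. Qed.

Lemma cis_pow a k : cis a ^ k = cis (INR k * a).
Proof.
  induction k as [|k IH]; [simpl; rewrite Rmult_0_l, cis_0; reflexivity|].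
  rewrite Cpow_S, IH, <- cis_plus, S_INR. f_equal; ring.
Qed.

(** The half-angle formula cos t = 1 - 2 sin(t/2)^2 reduces the claim to the zeros of the sine. *)
Lemma cis_eq_1 t : cis t = 1 -> exists k : Z, t = (2 * PI * IZR k)%R.
Proof.
  intros H. apply (f_equal fst) in H. simpl in H.
  assert (Hs : sin (t / 2) = 0%R).
  { replace t with (2 * (t / 2))%R in H by field. rewrite cos_2a_sin in H. nra. }
  destruct (sin_eq_0_0 _ Hs) as [k Hk]. exists k. lra.
Qed.

Lemma cis_2PI_INR k : cis (2 * PI * INR k) = 1.
Proof.
  rewrite <- cis_0. unfold cis. f_equal.
  - replace (2 * PI * INR k)%R with (0 + 2 * INR k * PI)%R by ring. apply cos_period.
  - replace (2 * PI * INR k)%R with (0 + 2 * INR k * PI)%R by ring. apply sin_period.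
Qed.

Lemma unit_cis z : Cmod z = 1%R -> exists t, z = cis t.
Proof.
  intros H. assert (E : (Re z ^ 2 + Im z ^ 2 = 1)%R) by (rewrite <- Cmod2_alt, H; ring).
  destruct z as [x y]; unfold Re, Im in E; cbn [fst snd] in E.
  assert (Hx : (-1 <= x <= 1)%R) by nra.
  assert (Hsq : sqrt (1 - Rsqr x) = Rabs y).
  { rewrite <- sqrt_Rsqr_abs. f_equal. unfold Rsqr. lra. }
  destruct (Rle_dec 0 y).
  - exists (acos x). unfold cis. rewrite cos_acos, sin_acos, Hsq, Rabs_right by lra. reflexivity.
  - exists (- acos x)%R. unfold cis. rewrite cos_neg, sin_neg, cos_acos, sin_acos, Hsq, Rabs_left by lra.
    f_equal. ring.
Qed.

Definition zeta (n : nat) : C := cis (2 * PI / INR n).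

Lemma zeta_pow n k : zeta n ^ k = cis (2 * PI * INR k / INR n).
Proof. unfold zeta. rewrite cis_pow. f_equal. unfold Rdiv; ring. Qed.

Lemma zeta_norm n : Cmod (zeta n) = 1%R.
Proof. apply cis_norm. Qed.

Lemma zeta_order n : (0 < n)%nat -> zeta n ^ n = 1.
Proof.
  intros Hn. apply lt_INR in Hn; simpl in Hn. rewrite zeta_pow.
  replace (2 * PI * INR n / INR n)%R with (2 * PI * INR 1)%R by (simpl; field; lra). apply cis_2PI_INR.
Qed.

Lemma Cmod_root n z : (0 < n)%nat -> z ^ n = 1 -> Cmod z = 1%R.
Proof.
  intros Hn H. apply (f_equal Cmod) in H. rewrite Cmod_pow, Cmod_1 in H.
  pose proof (Cmod_ge_0 z) as Hz. destruct (Rtotal_order (Cmod z) 1) as [Hl|[He|Hg]]; [exfalso| exact He |exfalso].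
  - pose proof (pow_lt_1_compat (Cmod z) n (conj Hz Hl) Hn). lra.
  - pose proof (Rlt_pow_R1 (Cmod z) n Hg Hn). lra.
Qed.

(** With z = [cis t], the hypothesis says that n t is 2 pi times an integer; the exponent is that
    integer reduced modulo n. *)
Lemma root_zeta n z : (0 < n)%nat -> z ^ n = 1 -> exists k, (k < n)%nat /\ z = zeta n ^ k.
Proof.
  intros Hn H. assert (Hn' := lt_INR _ _ Hn); simpl in Hn'.
  destruct (unit_cis z (Cmod_root n z Hn H)) as [t ->]. rewrite cis_pow in H.
  destruct (cis_eq_1 _ H) as [k Hk].
  assert (HnZ : (0 < Z.of_nat n)%Z) by lia.
  pose proof (Z.mod_pos_bound k (Z.of_nat n) HnZ) as Hr.
  pose proof (Z.div_mod k (Z.of_nat n)) as Hd.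
  set (q := (k / Z.of_nat n)%Z) in *. set (r := (k mod Z.of_nat n)%Z) in *.
  exists (Z.to_nat r). split; [lia|].
  rewrite zeta_pow.
  assert (Et : t = (2 * PI * INR (Z.to_nat r) / INR n + 2 * PI * IZR q)%R).
  { rewrite (INR_IZR_INZ (Z.to_nat r)), Z2Nat.id by lia.
    rewrite Hd, plus_IZR, mult_IZR, <- INR_IZR_INZ in Hk by lia.
    apply (Rmult_eq_reg_l (INR n)); [|lra]. rewrite Hk. field. lra. }
  rewrite Et, cis_plus.
  assert (Eq : cis (2 * PI * IZR q) = 1).
  { destruct (Z_le_gt_dec 0 q).
    - rewrite <- (Z2Nat.id q) by lia. rewrite <- INR_IZR_INZ. apply cis_2PI_INR.
    - replace (2 * PI * IZR q)%R with (- (2 * PI * INR (Z.to_nat (- q))))%R.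
      + rewrite cis_opp, cis_2PI_INR. apply injective_projections; simpl; ring.
      + rewrite INR_IZR_INZ, Z2Nat.id, opp_IZR by lia. ring. }
  rewrite Eq. ring.
Qed.

Lemma zeta_pow_inj n a b : (a < n)%nat -> (b < n)%nat -> zeta n ^ a = zeta n ^ b -> a = b.
Proof.
  assert (K : forall a b, (a <= b)%nat -> (b < n)%nat -> zeta n ^ a = zeta n ^ b -> a = b).
  { intros a' b' Hab Hb H.
    assert (Hn : (0 < INR n)%R) by (apply (lt_INR 0); lia).
    assert (E : zeta n ^ (b' - a') = 1).
    { replace b' with (a' + (b' - a'))%nat in H by lia. rewrite Cpow_add_r in H.
      assert (N : zeta n ^ a' <> 0) by (apply Cpow_nz, Cmod_1_neq_0, zeta_norm).
      transitivity (zeta n ^ a' * zeta n ^ (b' - a') / zeta n ^ a'); [field; exact N|].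
      rewrite <- H. field. exact N. }
    rewrite zeta_pow in E. destruct (cis_eq_1 _ E) as [k Hk].
    assert (Hk' : INR (b' - a') = (IZR k * INR n)%R).
    { pose proof PI_RGT_0. apply (Rmult_eq_reg_l (2 * PI / INR n)).
      - transitivity (2 * PI * INR (b' - a') / INR n)%R; [field; lra|]. rewrite Hk. field; lra.
      - apply Rgt_not_eq, Rdiv_lt_0_compat; lra. }
    rewrite !INR_IZR_INZ, <- mult_IZR in Hk'. apply eq_IZR in Hk'.
    destruct (Z_le_gt_dec k 0); nia. }
  intros Ha Hb H. destruct (Nat.le_ge_cases a b); [apply K; auto | symmetry; apply K; auto].
Qed.

Lemma zeta_mult g k : (0 < g)%nat -> (0 < k)%nat -> zeta (k * g) ^ k = zeta g.
Proof.
  intros Hg Hk. apply lt_INR in Hg, Hk; simpl in Hg, Hk.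
  rewrite zeta_pow, mult_INR. unfold zeta. f_equal. field. lra.
Qed.

(** Differentiating h^g = 1 gives g h^(g-1) dh = 0 with an invertible factor. Transition functions
    valued in roots of unity thus preserve the zero connection. *)
Lemma root_derivative_0 (W : C -> Prop) h g z : open W -> (0 < g)%nat -> csmooth W h ->
  (forall z, W z -> h z ^ g = 1) -> W z -> CDx h z = 0 /\ CDy h z = 0.
Proof.
  intros HW Hg Hh H1 Hz.
  assert (K : forall k, CDx (fun z => h z ^ S k) z = RtoC (INR (S k)) * h z ^ k * CDx h z /\
                        CDy (fun z => h z ^ S k) z = RtoC (INR (S k)) * h z ^ k * CDy h z).
  { induction k as [|k [IHx IHy]].
    - destruct (CD_ext W (fun z => h z ^ 1) h z HW Hz) as [-> ->]; [intros; apply Cpow_1_r|].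
      split; simpl; ring.
    - pose proof (csmooth_pow W h (S k) HW Hh) as S2.
      pose proof (CDx_mult W h (fun z => h z ^ S k) z Hh S2 Hz) as Ex.
      pose proof (CDy_mult W h (fun z => h z ^ S k) z Hh S2 Hz) as Ey.
      split.
      + transitivity (CDx (fun z => h z * h z ^ S k) z); [reflexivity|]. rewrite Ex, IHx.
        rewrite (S_INR (S k)), RtoC_plus, Cpow_S. ring.
      + transitivity (CDy (fun z => h z * h z ^ S k) z); [reflexivity|]. rewrite Ey, IHy.
        rewrite (S_INR (S k)), RtoC_plus, Cpow_S. ring. }
  destruct g as [|g]; [lia|]. destruct (K g) as [Kx Ky].
  assert (E0 : CDx (fun _ : C => RtoC 1) z = 0 /\ CDy (fun _ : C => RtoC 1) z = 0)
      by (apply has_partials_CD; split; apply is_derive_C_const).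
  destruct (CD_ext W (fun z => h z ^ S g) (fun _ => RtoC 1) z HW Hz H1) as [Ax Ay].
  rewrite Ax, (proj1 E0) in Kx. rewrite Ay, (proj2 E0) in Ky.
  assert (N : RtoC (INR (S g)) * h z ^ g <> 0).
  { apply Cmult_neq_0; [intros E; apply RtoC_inj in E; revert E; apply not_0_INR; lia|].
    apply Cpow_nz, Cmod_1_neq_0, (Cmod_root (S g)); [lia | auto]. }
  split.
  - transitivity (RtoC (INR (S g)) * h z ^ g * CDx h z / (RtoC (INR (S g)) * h z ^ g)); [field|];
    [split; intros E; apply N; rewrite E; ring|]. rewrite <- Kx. unfold Cdiv; ring.
  - transitivity (RtoC (INR (S g)) * h z ^ g * CDy h z / (RtoC (INR (S g)) * h z ^ g)); [field|];
    [split; intros E; apply N; rewrite E; ring|]. rewrite <- Ky. unfold Cdiv; ring.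
Qed.

Lemma Cpow_0_l k : (0 < k)%nat -> (0 : C) ^ k = 0.
Proof. destruct k; [lia|]. intros _. rewrite Cpow_S. ring. Qed.

Lemma Cpow_eq_1_neq_0 k (z : C) : (0 < k)%nat -> z ^ k = 1 -> z <> 0.
Proof. intros Hk H ->. rewrite Cpow_0_l in H by exact Hk. apply (f_equal fst) in H. simpl in H. lra. Qed.

Lemma Cpow_mult_eq_1_neq_0 a b (z w : C) : (0 < a)%nat -> (0 < b)%nat -> z ^ a * w ^ b = 1 -> z <> 0 /\ w <> 0.
Proof.
  intros Ha Hb H. split; intros ->; rewrite Cpow_0_l in H by assumption;
  apply (f_equal fst) in H; simpl in H; lra.
Qed.

Lemma INR_neq_0 n : (0 < n)%nat -> RtoC (INR n) <> 0.
Proof. intros Hn E. apply RtoC_inj in E. revert E. apply not_0_INR. lia. Qed.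

Lemma Cpow_div_l (z w : C) k : w <> 0 -> (z / w) ^ k = z ^ k / w ^ k.
Proof. intros Hw. unfold Cdiv. rewrite Cpow_mult_l, Cpow_inv by exact Hw. reflexivity. Qed.

Lemma arrow_comp n m p q r d e : (0 < n)%nat -> (0 < m)%nat ->
  arrow n m p q d -> arrow n m q r e -> arrow n m p r (e * d).
Proof.
  intros Hn Hm.
  (* [S] and [D] mean that an arrow stays in the same chart or goes to a different one. With the
     cone orders as variables [a], [b], each assertion covers two of the eight chart patterns; the
     remaining two are compositions of rotations. *)
  assert (SD : forall a b (x y z f g : C), (0 < a)%nat -> (0 < b)%nat -> f ^ a = 1 -> y = f * x -> y ^ a * z ^ b = 1 ->
    g = - (INR a * z) / (INR b * y) -> x ^ a * z ^ b = 1 /\ g * f = - (INR a * z) / (INR b * x)).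
  { intros a b x y z f g Ha Hb H1 -> H2 ->. pose proof (INR_neq_0 b Hb) as Nb.
    pose proof (Cpow_eq_1_neq_0 a f Ha H1) as Nf.
    rewrite Cpow_mult_l, H1, Cmult_1_l in H2. split; [exact H2|].
    destruct (Cpow_mult_eq_1_neq_0 a b x z Ha Hb H2) as [Nx _]. field. auto. }
  assert (DS : forall a b (x y z f g : C), (0 < a)%nat -> (0 < b)%nat -> x ^ a * y ^ b = 1 ->
    f = - (INR a * y) / (INR b * x) -> g ^ b = 1 -> z = g * y ->
    x ^ a * z ^ b = 1 /\ g * f = - (INR a * z) / (INR b * x)).
  { intros a b x y z f g Ha Hb H1 -> H2 ->. pose proof (INR_neq_0 b Hb) as Nb.
    destruct (Cpow_mult_eq_1_neq_0 a b x y Ha Hb H1) as [Nx _].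
    rewrite Cpow_mult_l, H2, Cmult_1_l. split; [exact H1|]. field. auto. }
  assert (DD : forall a b (x y z f g : C), (0 < a)%nat -> (0 < b)%nat -> x ^ a * y ^ b = 1 ->
    f = - (INR a * y) / (INR b * x) -> y ^ b * z ^ a = 1 -> g = - (INR b * z) / (INR a * y) ->
    (g * f) ^ a = 1 /\ z = g * f * x).
  { intros a b x y z f g Ha Hb H1 -> H2 ->. pose proof (INR_neq_0 b Hb) as Nb. pose proof (INR_neq_0 a Ha) as Na.
    destruct (Cpow_mult_eq_1_neq_0 a b x y Ha Hb H1) as [Nx Ny].
    assert (E : - (INR b * z) / (INR a * y) * (- (INR a * y) / (INR b * x)) = z / x) by (field; auto).
    rewrite E. split; [|field; exact Nx].
    rewrite Cpow_div_l by exact Nx.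
    pose proof (Cpow_nz x a Nx) as Px. pose proof (Cpow_nz y b Ny) as Py.
    transitivity (y ^ b * z ^ a / (x ^ a * y ^ b)); [field; auto|]. rewrite H1, H2. field. }
  destruct p as [[|] x], q as [[|] y], r as [[|] z]; simpl; intros [H1 H2] [H3 H4]; eauto.
  1,2: subst; rewrite Cpow_mult_l, H1, H3; split; ring.
Qed.

Lemma arrow_inv n m p q d : (0 < n)%nat -> (0 < m)%nat -> arrow n m p q d -> arrow n m q p (/ d).
Proof.
  intros Hn Hm.
  assert (S : forall a (x y f : C), (0 < a)%nat -> f ^ a = 1 -> y = f * x -> (/ f) ^ a = 1 /\ x = / f * y).
  { intros a x y f Ha H1 ->. pose proof (Cpow_eq_1_neq_0 a f Ha H1) as Nf.
    rewrite Cpow_inv, H1 by exact Nf. split; [|field; exact Nf]. field. }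
  assert (D : forall a b (x y f : C), (0 < a)%nat -> (0 < b)%nat -> x ^ a * y ^ b = 1 ->
     f = - (INR a * y) / (INR b * x) -> y ^ b * x ^ a = 1 /\ / f = - (INR b * x) / (INR a * y)).
  { intros a b x y f Ha Hb H1 ->. pose proof (INR_neq_0 b Hb) as Nb. pose proof (INR_neq_0 a Ha) as Na.
    destruct (Cpow_mult_eq_1_neq_0 a b x y Ha Hb H1) as [Nx Ny].
    split; [rewrite Cmult_comm; exact H1|]. field. auto. }
  destruct p as [[|] x], q as [[|] y]; simpl; intros [H1 H2]; eauto.
Qed.

(** Arrows at a cone point are isotropy only: u^n v^m = 1 excludes zero, and rotations fix it. *)
Lemma arrow_from_0 n m k q d : (0 < n)%nat -> (0 < m)%nat -> arrow n m (k, RtoC 0) q d -> q = (k, RtoC 0).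
Proof.
  intros Hn Hm. destruct k, q as [[|] w]; simpl; intros [H1 H2].
  1,4: rewrite H2; f_equal; ring.
  1: destruct (Cpow_mult_eq_1_neq_0 n m _ _ Hn Hm H1); congruence.
  destruct (Cpow_mult_eq_1_neq_0 m n _ _ Hm Hn H1); congruence.
Qed.

(** * Dual bundles and additivity of the curvature *)

Lemma pairing_opp A v : pairing ((- fst A)%R, (- snd A)%R) v = (- pairing A v)%R.
Proof. unfold pairing; simpl; ring. Qed.

(** Conjugates stand for inverses of the transition functions: they agree on the unit circle, and
    conjugation preserves smoothness without any division. *)
Definition dual {n m : nat} (L : line_bundle n m) : line_bundle n m.
Proof.
  refine (LineBundle (lb_idx L) (lb_dom L) (fun i j p q d => Cconj (lb_tr L i j p q d))
    (fun i p => ((- fst (lb_conn L i p))%R, (- snd (lb_conn L i p))%R))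
    (lb_open n m L) (lb_cover n m L) _ _ _ _ _).
  - intros. rewrite Cmod_conj. apply lb_unitary; assumption.
  - intros i j l p q r d e Hi Hj Hl Ha Hb.
    rewrite (lb_cocycle _ _ L i j l p q r d e) by assumption. apply Cmult_conj.
  - intros i j k l W phi delta HW HD.
    apply (csmooth_conj W (fun z => lb_tr L i j (k, z) (l, phi z) (delta z)) (proj1 HW)).
    apply lb_tr_smooth; assumption.
  - intros i k. destruct (lb_conn_smooth _ _ L i k) as [H1 H2].
    split; intros r; apply Ck_opp; auto; apply lb_open.
  - intros i j k l W phi delta HW HD g z Hz.
    pose proof (lb_tr_smooth _ _ L i j k l W phi delta HW HD) as S.
    destruct (lb_conn_tr _ _ L i j k l W phi delta HW HD z Hz) as [E1 E2].
    destruct (csmooth_has_partials _ _ z S Hz) as [P1 P2].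
    apply is_derive_C_conj in P1, P2.
    destruct (has_partials_CD g z _ _ (conj P1 P2)) as [-> ->].
    rewrite E1, E2. unfold g. rewrite !Cmult_conj, !Cconj_RtoC, !Cconj_Ci.
    rewrite !pairing_opp, !RtoC_minus, !RtoC_opp. split; ring.
Defined.

Lemma curvature_dual n m (L : line_bundle n m) (i : lb_idx L) p :
  curvature (dual L) i p = - curvature L i p.
Proof.
  unfold curvature, Dx, Dy; simpl. rewrite !Derive_opp. rewrite !RtoC_minus, !RtoC_opp. ring.
Qed.

(** Additivity of [Derive] requires differentiability, which the connection forms have only inside
    the domains of their frames. *)
Lemma curvature_tensor n m (L M : line_bundle n m) (i : lb_idx L) (j : lb_idx M) p :
  lb_dom L i p -> lb_dom M j p ->
  curvature (tensor L M) (i, j) p = curvature L i p + curvature M j p.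
Proof.
  intros Hi Hj. destruct p as [k z].
  destruct (lb_conn_smooth _ _ L i k) as [A1 A2]. destruct (lb_conn_smooth _ _ M j k) as [B1 B2].
  destruct (A1 1%nat) as [_ [C1 _]], (A2 1%nat) as [_ [C2 _]],
    (B1 1%nat) as [_ [D1 _]], (B2 1%nat) as [_ [D2 _]].
  unfold curvature, Dx, Dy; cbn -[Derive RtoC Cmult Copp Cplus Ci Re Im].
  pose proof (Derive_plus (fun x : R => snd (lb_conn L i (k, (x, Im z))))
    (fun x : R => snd (lb_conn M j (k, (x, Im z)))) (Re z) (proj1 (C2 z Hi)) (proj1 (D2 z Hj))) as EX.
  pose proof (Derive_plus (fun y : R => fst (lb_conn L i (k, (Re z, y))))
    (fun y : R => fst (lb_conn M j (k, (Re z, y)))) (Im z) (proj2 (C1 z Hi)) (proj2 (D1 z Hj))) as EY.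
  etransitivity; [apply f_equal, f_equal, f_equal2; [exact EX | exact EY]|].
  match type of EX with _ = (?a + ?b)%R => match type of EY with _ = (?c + ?d)%R =>
    change (- Ci * RtoC (a + b - (c + d)) = - Ci * RtoC (a - c) + - Ci * RtoC (b - d)) end end.
  rewrite !RtoC_minus, !RtoC_plus. ring.
Qed.

(** * The bundles of gcd(n,m)-torsion *)

Section Torsion.
Context (n m : nat) (Hn : (0 < n)%nat) (Hm : (0 < m)%nat).

Notation g := (Nat.gcd n m).
Notation n' := (n / Nat.gcd n m)%nat.
Notation m' := (m / Nat.gcd n m)%nat.

Lemma gcd_pos : (0 < g)%nat.
Proof. destruct (Nat.eq_dec g 0) as [E|]; [|lia]. apply Nat.gcd_eq_0 in E. lia. Qed.

Lemma div_gcd_l : n = (n' * g)%nat.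
Proof. pose proof gcd_pos. destruct (Nat.gcd_divide_l n m) as [k E]. rewrite E at 2. rewrite Nat.div_mul; lia. Qed.

Lemma div_gcd_r : m = (m' * g)%nat.
Proof. pose proof gcd_pos. destruct (Nat.gcd_divide_r n m) as [k E]. rewrite E at 2. rewrite Nat.div_mul; lia. Qed.

Lemma pow_gcd_l (z : C) : (z ^ n') ^ g = z ^ n.
Proof. rewrite <- Cpow_mult_r. f_equal. symmetry; apply div_gcd_l. Qed.

Lemma pow_gcd_r (z : C) : (z ^ m') ^ g = z ^ m.
Proof. rewrite <- Cpow_mult_r. f_equal. symmetry; apply div_gcd_r. Qed.

(* A cocycle of gcd(n,m)-th roots of unity on the groupoid, where u^(g-1) stands for the inverse of
   u; away from the cone points it is the coboundary of [torsion_potential]. *)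
Definition torsion_cocycle (p q : point) (d : C) : C :=
  match fst p, fst q with
  | north, north => d ^ n'
  | south, south => (d ^ m') ^ (g - 1)
  | south, north => snd q ^ n' * snd p ^ m'
  | north, south => (snd p ^ n' * snd q ^ m') ^ (g - 1)
  end.

(** A multivalued function on the sphere minus the cone points, with branches u^(n/g) and v^(-m/g).
    Since (u^(n/g) v^(m/g))^g = 1 on the gluing curve, branches differ by g-th roots of unity. *)
Definition torsion_potential (p : point) : C :=
  match fst p with north => snd p ^ n' | south => / snd p ^ m' end.

Lemma root_pred_inv (z : C) : z ^ g = 1 -> z ^ (g - 1) = / z.
Proof.
  intros H. pose proof (Cpow_eq_1_neq_0 g z gcd_pos H) as N.
  assert (E : z * z ^ (g - 1) = 1).
  { rewrite <- Cpow_S. replace (S (g - 1)) with g by (pose proof gcd_pos; lia). exact H. }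
  transitivity (z * z ^ (g - 1) / z); [field; exact N|]. rewrite E. field. exact N.
Qed.

Lemma torsion_cocycle_root p q d : arrow n m p q d -> torsion_cocycle p q d ^ g = 1.
Proof.
  destruct p as [[|] z], q as [[|] w]; unfold torsion_cocycle; simpl; intros [H _].
  - rewrite pow_gcd_l. exact H.
  - rewrite <- Cpow_mult_r, Nat.mul_comm, Cpow_mult_r, Cpow_mult_l, pow_gcd_l, pow_gcd_r, H. apply Cpow_1_l.
  - rewrite Cpow_mult_l, pow_gcd_l, pow_gcd_r, Cmult_comm. exact H.
  - rewrite <- Cpow_mult_r, Nat.mul_comm, Cpow_mult_r, pow_gcd_r, H. apply Cpow_1_l.
Qed.

Lemma torsion_cocycle_potential p q d : arrow n m p q d -> snd p <> 0 ->
  snd q <> 0 /\ torsion_potential q = torsion_cocycle p q d * torsion_potential p.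
Proof.
  intros Ha Nz. pose proof (torsion_cocycle_root p q d Ha) as R. revert Ha Nz R.
  destruct p as [[|] z], q as [[|] w]; unfold torsion_cocycle, torsion_potential; simpl; intros [H H'] Nz R.
  - pose proof (Cpow_eq_1_neq_0 n d Hn H). subst w. split; [apply Cmult_neq_0; assumption|].
    apply Cpow_mult_l.
  - destruct (Cpow_mult_eq_1_neq_0 n m z w Hn Hm H) as [_ Nw]. split; [exact Nw|].
    rewrite root_pred_inv.
    + field. split; apply Cpow_nz; assumption.
    + rewrite Cpow_mult_l, pow_gcd_l, pow_gcd_r. exact H.
  - destruct (Cpow_mult_eq_1_neq_0 m n z w Hm Hn H) as [_ Nw]. split; [exact Nw|].
    field. apply Cpow_nz; assumption.
  - pose proof (Cpow_eq_1_neq_0 m d Hm H) as Nd. subst w. split; [apply Cmult_neq_0; assumption|].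
    rewrite root_pred_inv.
    + rewrite Cpow_mult_l. field. split; apply Cpow_nz; assumption.
    + rewrite pow_gcd_r. exact H.
Qed.

Lemma torsion_potential_neq_0 (p : point) : snd p <> 0 -> torsion_potential p <> 0.
Proof.
  destruct p as [[|] z]; unfold torsion_potential; simpl; intros Nz.
  - apply Cpow_nz, Nz.
  - intros E. assert (K : z ^ m' * / z ^ m' = 1) by (apply Cinv_r, Cpow_nz, Nz).
    rewrite E in K. apply (f_equal fst) in K. revert K. simpl. lra.
Qed.

(** Away from the cone points the cocycle is a quotient of potentials, so composition telescopes. At
    a cone point, where the potential vanishes or has a pole, all arrows are isotropy and the
    formula is a power of the derivative. *)
Lemma torsion_cocycle_comp p q r d e : arrow n m p q d -> arrow n m q r e ->
  torsion_cocycle p r (e * d) = torsion_cocycle q r e * torsion_cocycle p q d.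
Proof.
  intros Ha Hb. destruct (excluded_middle_informative (snd p = 0)) as [E|Nz].
  - destruct p as [k z]; simpl in E; subst z.
    rewrite (arrow_from_0 n m k q d Hn Hm Ha) in *.
    rewrite (arrow_from_0 n m k r e Hn Hm Hb) in *.
    unfold torsion_cocycle; simpl. destruct k; rewrite ?Cpow_mult_l; reflexivity.
  - destruct (torsion_cocycle_potential p q d Ha Nz) as [Nq E1].
    destruct (torsion_cocycle_potential q r e Hb Nq) as [Nr E2].
    destruct (torsion_cocycle_potential p r _ (arrow_comp n m p q r d e Hn Hm Ha Hb) Nz) as [_ E3].
    pose proof (torsion_potential_neq_0 p Nz) as Np.
    transitivity (torsion_potential r / torsion_potential p); [rewrite E3; field; exact Np|].
    rewrite E2, E1. field. exact Np.
Qed.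

Lemma torsion_cocycle_smooth k l W phi delta : local_change n m k l W phi delta ->
  csmooth W (fun z => torsion_cocycle (k, z) (l, phi z) (delta z)).
Proof.
  intros [HW [Hp [Hd _]]]. unfold torsion_cocycle; simpl.
  pose proof (csmooth_id W HW) as Hi.
  destruct k, l; repeat first [apply csmooth_pow | apply csmooth_mult | assumption].
Qed.

(** One global frame with zero connection form. All of the geometry lies in the cocycle; its [c]-th
    power covers the tensor powers without iterating [tensor]. *)
Definition torsion_bundle (c : nat) : line_bundle n m.
Proof.
  refine (LineBundle unit (fun _ _ => True) (fun _ _ p q d => torsion_cocycle p q d ^ c)
    (fun _ _ => (0%R, 0%R)) (fun _ _ => open_true) (fun _ => ex_intro _ tt I) _ _ _ _ _).
  - intros _ _ p q d _ _ Ha. rewrite Cmod_pow, (Cmod_root g); [apply pow1 | exact gcd_pos|].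
    apply torsion_cocycle_root, Ha.
  - intros _ _ _ p q r d e _ _ _ Ha Hb. rewrite (torsion_cocycle_comp p q r d e Ha Hb).
    apply Cpow_mult_l.
  - intros _ _ k l W phi delta HW _.
    apply (csmooth_pow W (fun z => torsion_cocycle (k, z) (l, phi z) (delta z)));
      [apply HW | apply torsion_cocycle_smooth, HW].
  - intros _ k. split; intros r; apply Ck_const.
  - intros _ _ k l W phi delta HW _ h z Hz.
    assert (S : csmooth W h)
      by (apply (csmooth_pow W (fun z => torsion_cocycle (k, z) (l, phi z) (delta z)));
        [apply HW | apply torsion_cocycle_smooth, HW]).
    destruct (root_derivative_0 W h g z (proj1 HW) gcd_pos S) as [-> ->]; [|exact Hz|].
    + intros x Hx. unfold h. rewrite <- Cpow_mult_r, Nat.mul_comm, Cpow_mult_r, torsion_cocycle_root;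
        [apply Cpow_1_l | apply HW, Hx].
    + unfold pairing; simpl fst; simpl snd. rewrite !Rmult_0_l, Rplus_0_l, Rminus_0_r. split; ring.
Defined.

Lemma torsion_bundle_flat c : flat (torsion_bundle c).
Proof.
  intros i p _. unfold curvature, Dx, Dy; simpl. rewrite !Derive_const, Rminus_0_r. ring.
Qed.

End Torsion.

(** * Branches of the gluing map u^n v^m = 1 *)

Definition cexp (u : C) : C := RtoC (exp (Re u)) * cis (Im u).

Lemma cexp_plus u v : cexp (u + v) = cexp u * cexp v.
Proof.
  unfold cexp.
  replace (Re (u + v)) with (Re u + Re v)%R by reflexivity.
  replace (Im (u + v)) with (Im u + Im v)%R by reflexivity.
  rewrite exp_plus, cis_plus, RtoC_mult. ring.
Qed.

Lemma cexp_0 : cexp 0 = 1.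
Proof. unfold cexp; simpl. rewrite exp_0, cis_0. ring. Qed.

Lemma cexp_pow u k : cexp u ^ k = cexp (RtoC (INR k) * u).
Proof.
  induction k as [|k IH]; [simpl; rewrite Cmult_0_l; symmetry; apply cexp_0|].
  rewrite Cpow_S, IH, <- cexp_plus, S_INR, RtoC_plus. f_equal. ring.
Qed.

Lemma cexp_neq_0 u : cexp u <> 0.
Proof.
  intros E. assert (K : cexp u * cexp (- u) = 1) by (rewrite <- cexp_plus, <- cexp_0; f_equal; ring).
  rewrite E in K. apply (f_equal fst) in K. revert K. simpl. lra.
Qed.

Lemma cexp_surj (z : C) : z <> 0 -> exists u, z = cexp u.
Proof.
  intros Nz. assert (Hz : (0 < Cmod z)%R) by (apply Cmod_gt_0, Nz).
  assert (NC : RtoC (Cmod z) <> 0) by (intros E; apply RtoC_inj in E; lra).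
  destruct (unit_cis (z / Cmod z)) as [t Ht].
  { rewrite Cmod_div, Cmod_R, Rabs_right by (auto; lra). field. lra. }
  exists (ln (Cmod z), t). unfold cexp; simpl. rewrite exp_ln, <- Ht by exact Hz. field. exact NC.
Qed.

Lemma is_derive_cexp (f : R -> C) t l : is_derive_C f t l ->
  is_derive_C (fun s => cexp (f s)) t (cexp (f t) * l).
Proof.
  intros H. apply is_derive_C_iff in H. destruct H as [H1 H2].
  assert (E : is_derive_C (fun s => RtoC (exp (Re (f s)))) t (RtoC (exp (Re (f t)) * Re l))).
  { apply is_derive_C_iff. split.
    - replace (Re (RtoC (exp (Re (f t)) * Re l))) with (scal (Re l) (exp (Re (f t))))
        by (unfold scal; simpl; unfold mult; simpl; ring).
      apply (is_derive_comp exp (fun s => Re (f s))); [apply is_derive_exp | exact H1].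
    - apply (is_derive_const (K := R_AbsRing) (V := R_NormedModule) 0%R t). }
  apply (is_derive_C_eq _ _ _ _ (is_derive_C_mult _ _ _ _ _ E (is_derive_cis _ _ _ H2))).
  unfold cexp. rewrite RtoC_mult.
  transitivity (RtoC (exp (Re (f t))) * cis (Im (f t)) * (RtoC (Re l) + Ci * RtoC (Im l))); [ring|].
  f_equal. apply injective_projections; unfold Re, Im; simpl; ring.
Qed.

Lemma is_derive_ray (u : C) t : is_derive_C (fun s => cexp (RtoC s * u)) t (cexp (RtoC t * u) * u).
Proof.
  apply is_derive_cexp.
  apply (is_derive_ext (V := C_R_NormedModule) (fun s => 0 + RtoC s * u)); [intros; apply Cplus_0_l|].
  apply is_derive_C_segment.
Qed.

(* The half plane around the direction of argument [a], and the branch of the logarithm on it. *)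
Definition along (a : R) (z : C) : R := (cos a * Re z + sin a * Im z)%R.
Definition across (a : R) (z : C) : R := (cos a * Im z - sin a * Re z)%R.
Definition half_plane (a : R) (z : C) : Prop := (0 < along a z)%R.
Definition clog (a : R) (z : C) : C :=
  ((ln (Re z ^ 2 + Im z ^ 2) / 2)%R, (a + atan (across a z / along a z))%R).

Lemma along_across_norm a z : (along a z ^ 2 + across a z ^ 2 = Re z ^ 2 + Im z ^ 2)%R.
Proof.
  unfold along, across. pose proof (sin2_cos2 a) as H. unfold Rsqr in H.
  transitivity ((sin a * sin a + cos a * cos a) * (Re z ^ 2 + Im z ^ 2))%R; [ring | rewrite H; ring].
Qed.

Lemma half_plane_norm a z : half_plane a z -> (0 < Re z ^ 2 + Im z ^ 2)%R.
Proof. unfold half_plane. intros H. rewrite <- (along_across_norm a). nra. Qed.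

Lemma half_plane_neq_0 a z : half_plane a z -> z <> 0.
Proof. intros H ->. apply half_plane_norm in H. simpl in H. lra. Qed.

Lemma continuous_along a z : continuous (along a) z.
Proof.
  apply (continuous_plus (fun z => cos a * Re z)%R (fun z => sin a * Im z)%R);
    [apply (continuous_mult (fun _ => cos a) Re) | apply (continuous_mult (fun _ => sin a) Im)];
    first [apply continuous_const | apply continuous_Re | apply continuous_Im].
Qed.

Lemma continuous_across a z : continuous (across a) z.
Proof.
  apply (continuous_minus (fun z => cos a * Im z)%R (fun z => sin a * Re z)%R);
    [apply (continuous_mult (fun _ => cos a) Im) | apply (continuous_mult (fun _ => sin a) Re)];
    first [apply continuous_const | apply continuous_Re | apply continuous_Im].
Qed.

Lemma continuous_norm2 (z : C) : continuous (fun z : C => Re z ^ 2 + Im z ^ 2)%R z.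
Proof.
  apply continuous_ext with (fun z : C => Re z * Re z + Im z * Im z)%R; [intros; simpl; ring|].
  apply (continuous_plus (fun z : C => Re z * Re z)%R (fun z : C => Im z * Im z)%R);
    [apply (continuous_mult Re Re) | apply (continuous_mult Im Im)];
    first [apply continuous_Re | apply continuous_Im].
Qed.

Lemma open_half_plane a : open (half_plane a).
Proof. apply (open_comp (along a) (fun x => 0 < x)%R); [intros; apply continuous_along | apply open_gt]. Qed.

Lemma is_derive_half_ln (N : R -> R) t dN : is_derive N t dN -> (0 < N t)%R ->
  is_derive (fun s => ln (N s) / 2)%R t (dN / (2 * N t))%R.
Proof.
  intros H HN.
  replace (dN / (2 * N t))%R with (scal (/ 2)%R (scal dN (/ N t))%R)
    by (unfold scal; simpl; unfold mult; simpl; field; lra).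
  apply (is_derive_ext (fun s => scal (/ 2)%R (ln (N s)))).
  - intros s. unfold scal; simpl; unfold mult; simpl. field.
  - apply is_derive_scal. apply (is_derive_comp ln N); [apply is_derive_ln, HN | exact H].
Qed.

Lemma is_derive_atan_quotient (a : R) (A O : R -> R) t dA dO : is_derive A t dA -> is_derive O t dO ->
  (0 < A t)%R ->
  is_derive (fun s => a + atan (O s / A s))%R t ((dO * A t - O t * dA) / (A t ^ 2 + O t ^ 2))%R.
Proof.
  intros HA HO Hpos.
  assert (HQ : is_derive (fun s => O s / A s)%R t ((dO * A t - O t * dA) / A t ^ 2)%R)
    by (apply is_derive_div; [exact HO | exact HA | lra]).
  replace ((dO * A t - O t * dA) / (A t ^ 2 + O t ^ 2))%R with
    (plus 0%R (scal ((dO * A t - O t * dA) / A t ^ 2)%R (/ (1 + Rsqr (O t / A t))))%R).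
  - apply (is_derive_plus (fun _ => a) (fun s => atan (O s / A s))%R).
    + apply (is_derive_const (K := R_AbsRing) (V := R_NormedModule) a t).
    + apply (is_derive_comp atan (fun s => O s / A s)%R); [apply is_derive_atan | exact HQ].
  - unfold plus, scal; simpl; unfold mult; simpl. unfold Rsqr. field. split; nra.
Qed.

(** This is d log z = dz / z. The imaginary part is the angular form (x dy - y dx) / r^2, computed
    in coordinates rotated by [a]; invariance under that rotation is sin^2 + cos^2 = 1. *)
Lemma has_partials_clog a z : half_plane a z -> has_partials (clog a) z (/ z) (Ci / z).
Proof.
  intros H. pose proof (half_plane_norm a z H) as Hr. pose proof (along_across_norm a z) as Ho.
  pose proof (sin2_cos2 a) as Hs. unfold Rsqr in Hs.
  assert (DR : forall N dN t, N t = (Re z ^ 2 + Im z ^ 2)%R -> is_derive N t dN ->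
     is_derive (fun s => ln (N s) / 2)%R t (dN / (2 * (Re z ^ 2 + Im z ^ 2)))%R).
  { intros N dN t E HN. rewrite <- E in Hr |- *. apply is_derive_half_ln; assumption. }
  assert (DI : forall A O t dA dO, A t = along a z -> O t = across a z -> is_derive A t dA -> is_derive O t dO ->
     is_derive (fun s => a + atan (O s / A s))%R t ((dO * along a z - across a z * dA) / (Re z ^ 2 + Im z ^ 2))%R).
  { intros A O t dA dO EA EO HA HO. rewrite <- Ho, <- EA, <- EO. apply is_derive_atan_quotient; auto.
    rewrite EA. exact H. }
  assert (Nz : (Re z ^ 2 + Im z ^ 2 <> 0)%R) by lra.
  split; apply is_derive_C_iff; split.
  - replace (Re (/ z)) with ((2 * Re z) / (2 * (Re z ^ 2 + Im z ^ 2)))%R by (unfold Re, Im in *; simpl in *; field; lra).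
    apply (DR (fun x => Re (x, Im z) ^ 2 + Im (x, Im z) ^ 2)%R); [reflexivity|].
    unfold Re, Im; simpl. auto_derive; trivial; ring.
  - replace (Im (/ z)) with (((- sin a) * along a z - across a z * cos a) / (Re z ^ 2 + Im z ^ 2))%R.
    + apply (DI (fun x => along a (x, Im z)) (fun x => across a (x, Im z)));
        try (destruct z; reflexivity); unfold along, across, Re, Im; simpl; auto_derive; trivial; ring.
    + replace (- sin a * along a z - across a z * cos a)%R with (- ((sin a * sin a + cos a * cos a) * Im z))%R
        by (unfold along, across; ring).
      rewrite Hs. unfold Re, Im in *; simpl in *; field; lra.
  - replace (Re (Ci / z)) with ((2 * Im z) / (2 * (Re z ^ 2 + Im z ^ 2)))%R by (unfold Re, Im in *; simpl in *; field; lra).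
    apply (DR (fun y => Re (Re z, y) ^ 2 + Im (Re z, y) ^ 2)%R); [reflexivity|].
    unfold Re, Im; simpl. auto_derive; trivial; ring.
  - replace (Im (Ci / z)) with ((cos a * along a z - across a z * sin a) / (Re z ^ 2 + Im z ^ 2))%R.
    + apply (DI (fun y => along a (Re z, y)) (fun y => across a (Re z, y)));
        try (destruct z; reflexivity); unfold along, across, Re, Im; simpl; auto_derive; trivial; ring.
    + replace (cos a * along a z - across a z * sin a)%R with ((sin a * sin a + cos a * cos a) * Re z)%R
        by (unfold along, across; ring).
      rewrite Hs. unfold Re, Im in *; simpl in *; field; lra.
Qed.

Lemma cexp_clog a z : half_plane a z -> cexp (clog a z) = z.
Proof.
  intros H. pose proof (half_plane_norm a z H) as Hr. pose proof (along_across_norm a z) as Ho.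
  pose proof (sin2_cos2 a) as Hs. unfold Rsqr in Hs. unfold half_plane in H.
  set (r := (Re z ^ 2 + Im z ^ 2)%R) in *.
  assert (E1 : exp (ln r / 2) = sqrt r).
  { rewrite <- Rpower_sqrt by exact Hr. unfold Rpower. f_equal. field. }
  assert (Hq : sqrt (1 + Rsqr (across a z / along a z)) = (sqrt r / along a z)%R).
  { replace (1 + Rsqr (across a z / along a z))%R with (r / (along a z * along a z))%R
      by (rewrite <- Ho; unfold Rsqr; field; lra).
    rewrite sqrt_div_alt by nra. rewrite sqrt_square by lra. reflexivity. }
  assert (Hsr : (0 < sqrt r)%R) by (apply sqrt_lt_R0, Hr).
  unfold cexp, clog. cbn [Re Im fst snd]. fold r. rewrite E1. rewrite cis_plus.
  unfold cis at 2. rewrite cos_atan, sin_atan, Hq.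
  apply injective_projections; simpl.
  - transitivity (cos a * along a z - sin a * across a z)%R; [field; lra|].
    transitivity ((sin a * sin a + cos a * cos a) * Re z)%R; [unfold along, across; ring|]. rewrite Hs. apply Rmult_1_l.
  - transitivity (cos a * across a z + sin a * along a z)%R; [field; lra|].
    transitivity ((sin a * sin a + cos a * cos a) * Im z)%R; [unfold along, across; ring|]. rewrite Hs. apply Rmult_1_l.
Qed.

(** The horizontal strip on which this branch inverts the exponential. It shows which branch follows
    a given piece of a spiral. *)
Lemma clog_cexp a u : (Rabs (Im u - a) < PI / 2)%R -> half_plane a (cexp u) /\ clog a (cexp u) = u.
Proof.
  intros Hu. apply Rabs_def2 in Hu. destruct u as [x y]; unfold Im in Hu; simpl in Hu.
  pose proof (exp_pos x) as He. pose proof (cos_gt_0 (y - a)) as Hc.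
  assert (EA : along a (cexp (x, y)) = (exp x * cos (y - a))%R).
  { unfold along, cexp, cis; simpl. rewrite cos_minus. ring. }
  assert (EO : across a (cexp (x, y)) = (exp x * sin (y - a))%R).
  { unfold across, cexp, cis; simpl. rewrite sin_minus. ring. }
  assert (Hc' : (0 < cos (y - a))%R) by (apply Hc; lra).
  split; [unfold half_plane; rewrite EA; apply Rmult_lt_0_compat; assumption|].
  unfold clog. rewrite <- along_across_norm with (a := a), EA, EO.
  apply injective_projections; simpl.
  - replace ((exp x * cos (y - a) * (exp x * cos (y - a) * 1) + exp x * sin (y - a) * (exp x * sin (y - a) * 1)))%R
      with (exp x * exp x)%R.
    + rewrite <- exp_plus, ln_exp. field.
    + pose proof (sin2_cos2 (y - a)) as Hs. unfold Rsqr in Hs.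
      transitivity (exp x * exp x * (sin (y - a) * sin (y - a) + cos (y - a) * cos (y - a)))%R; [rewrite Hs; ring | ring].
  - replace (exp x * sin (y - a) / (exp x * cos (y - a)))%R with (tan (y - a)) by (unfold tan; field; lra).
    rewrite atan_tan by lra. ring.
Qed.

(** The branch of z^q on the half plane around the direction of argument [a]. *)
Definition cpower (a q : R) (z : C) : C := cexp (RtoC q * clog a z).

Lemma continuous_clog a z : half_plane a z ->
  continuous (fun z => Re (clog a z)) z /\ continuous (fun z => Im (clog a z)) z.
Proof.
  intros H. pose proof (half_plane_norm a z H) as Hr. unfold half_plane in H. split.
  - apply (continuous_mult (fun z : C => ln (Re z ^ 2 + Im z ^ 2)) (fun _ => (/ 2)%R)); [|apply continuous_const].
    apply (continuous_comp (fun z : C => Re z ^ 2 + Im z ^ 2)%R ln); [apply continuous_norm2 | apply continuous_ln, Hr].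
  - apply (continuous_plus (fun _ => a) (fun z => atan (across a z / along a z))); [apply continuous_const|].
    apply (continuous_comp (fun z => across a z / along a z)%R atan); [|apply continuous_atan].
    apply (continuous_mult (across a) (fun z => / along a z)%R); [apply continuous_across|].
    apply (continuous_comp (along a) Rinv); [apply continuous_along | apply continuous_Rinv; lra].
Qed.

Lemma continuous_cpower a q z : half_plane a z ->
  continuous (fun z => Re (cpower a q z)) z /\ continuous (fun z => Im (cpower a q z)) z.
Proof.
  intros H. destruct (continuous_clog a z H) as [C1 C2].
  assert (D1 : continuous (fun z => exp (q * Re (clog a z))) z).
  { apply (continuous_comp (fun z => q * Re (clog a z))%R exp).
    - apply (continuous_mult (fun _ => q) (fun z => Re (clog a z))); [apply continuous_const | exact C1].
    - apply (ex_derive_continuous (K := R_AbsRing) (V := R_NormedModule)). eexists; apply is_derive_exp. }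
  assert (D2 : continuous (fun z => (q * Im (clog a z))%R) z).
  { apply (continuous_mult (fun _ => q) (fun z => Im (clog a z))); [apply continuous_const | exact C2]. }
  split.
  - apply continuous_ext with (fun z => exp (q * Re (clog a z)) * cos (q * Im (clog a z)))%R.
    + intros w. unfold cpower, cexp, cis, Re, Im. simpl.
      rewrite !Rmult_0_l, !Rminus_0_r, Rplus_0_r. reflexivity.
    + apply (continuous_mult (fun z => exp (q * Re (clog a z))) (fun z => cos (q * Im (clog a z)))); [exact D1|].
      apply (continuous_comp (fun z => q * Im (clog a z))%R cos); [exact D2 | apply continuous_cos'].
  - apply continuous_ext with (fun z => exp (q * Re (clog a z)) * sin (q * Im (clog a z)))%R.
    + intros w. unfold cpower, cexp, cis, Re, Im. simpl.
      rewrite !Rmult_0_l, !Rminus_0_r, !Rplus_0_r. reflexivity.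
    + apply (continuous_mult (fun z => exp (q * Re (clog a z))) (fun z => sin (q * Im (clog a z)))); [exact D1|].
      apply (continuous_comp (fun z => q * Im (clog a z))%R sin); [exact D2 | apply continuous_sin'].
Qed.

Lemma has_partials_cpower a q z : half_plane a z ->
  has_partials (cpower a q) z (cpower a q z * (RtoC q * / z)) (cpower a q z * (RtoC q * (Ci / z))).
Proof.
  intros H. destruct (has_partials_clog a z H) as [D1 D2]. destruct z as [x y].
  split; (eapply is_derive_C_eq;
    [apply is_derive_cexp, (is_derive_C_mult (fun _ => RtoC q)); [apply is_derive_C_const|];
      first [exact D1 | exact D2] |]); unfold cpower; simpl Re; simpl Im; ring.
Qed.

Lemma cpower_inv a z : half_plane a z -> cpower a (-1) z = / z.
Proof.
  intros H. pose proof (half_plane_neq_0 a z H) as Nz.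
  assert (E : z * cpower a (-1) z = 1).
  { rewrite <- (cexp_clog a z H) at 1. unfold cpower. rewrite <- cexp_plus, <- cexp_0. f_equal. ring. }
  transitivity (z * cpower a (-1) z / z); [field; exact Nz|]. rewrite E. field; exact Nz.
Qed.

(** The exponent -1 comes before the others: the partial derivatives of any power contain 1/z, and
    only here is 1/z the function itself, so that the bootstrap closes. *)
Lemma csmooth_inv a : csmooth (half_plane a) (fun z => / z).
Proof.
  apply csmooth_ext with (cpower a (-1)); [apply open_half_plane | apply cpower_inv|].
  apply csmooth_bootstrap with (3 := has_partials_cpower a (-1));
    [apply open_half_plane | apply continuous_cpower|].
  intros k Hk.
  assert (Hi : CCk k (half_plane a) (fun z => / z)).
  { destruct Hk as [H1 H2]. split.
    - apply Ck_ext with (2 := fun z Hz => f_equal Re (cpower_inv a z Hz)); [apply open_half_plane | exact H1].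
    - apply Ck_ext with (2 := fun z Hz => f_equal Im (cpower_inv a z Hz)); [apply open_half_plane | exact H2]. }
  pose proof (open_half_plane a) as HO.
  split.
  - apply CCk_mult; [exact HO | exact Hk|].
    apply (CCk_mult k _ (fun _ => RtoC (-1)) (fun z => / z)); [exact HO | apply CCk_const | exact Hi].
  - apply CCk_mult; [exact HO | exact Hk|].
    apply (CCk_mult k _ (fun _ => RtoC (-1)) (fun z => Ci / z)); [exact HO | apply CCk_const|].
    apply (CCk_mult k _ (fun _ => Ci) (fun z => / z)); [exact HO | apply CCk_const | exact Hi].
Qed.

Lemma csmooth_cpower a q : csmooth (half_plane a) (cpower a q).
Proof.
  pose proof (open_half_plane a) as HO.
  apply csmooth_bootstrap with (3 := has_partials_cpower a q);
    [exact HO | apply continuous_cpower|].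
  intros k Hk. pose proof (proj1 (csmooth_CCk _ _) (csmooth_inv a) k) as Hi.
  split.
  - apply CCk_mult; [exact HO | exact Hk|].
    apply (CCk_mult k _ (fun _ => RtoC q) (fun z => / z)); [exact HO | apply CCk_const | exact Hi].
  - apply CCk_mult; [exact HO | exact Hk|].
    apply (CCk_mult k _ (fun _ => RtoC q) (fun z => Ci / z)); [exact HO | apply CCk_const|].
    apply (CCk_mult k _ (fun _ => Ci) (fun z => / z)); [exact HO | apply CCk_const | exact Hi].
Qed.

(** The branches v = u^(-n/m) solve u^n v^m = 1 and have derivative -(n/m) v/u, which is the
    derivative prescribed by [arrow]. *)
Lemma local_change_cpower n m a : (0 < n)%nat -> (0 < m)%nat ->
  let phi := cpower a (- (INR n / INR m)) in
  local_change n m north south (half_plane a) phi (fun z => - (INR n * phi z) / (INR m * z)).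
Proof.
  intros Hn Hm phi. pose proof (INR_neq_0 m Hm) as Nm. pose proof (open_half_plane a) as HO.
  assert (Nm' : INR m <> 0%R) by (apply not_0_INR; lia).
  split; [exact HO|]. split; [apply csmooth_cpower|]. split.
  - apply csmooth_ext with (fun z => RtoC (- (INR n / INR m)) * (phi z * / z)); [exact HO| |].
    + intros z Hz. pose proof (half_plane_neq_0 a z Hz).
      rewrite RtoC_opp, RtoC_div by exact Nm'. field. auto.
    + apply csmooth_mult; [exact HO | apply csmooth_const|].
      apply csmooth_mult; [exact HO | apply csmooth_cpower | apply csmooth_inv].
  - intros z Hz. split; [|reflexivity].
    rewrite <- (cexp_clog a z Hz) at 1. unfold phi, cpower.
    rewrite !cexp_pow, <- cexp_plus, <- cexp_0. f_equal.
    rewrite RtoC_opp, RtoC_div by exact Nm'. simpl cone_order. field. exact Nm.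
Qed.

(** * The cocycle of a flat bundle *)

(** Bezout over the naturals: a n = g + b m for suitable [a] and [b]. *)
Lemma pow_gcd_eq_1 n m (z : C) : (0 < n)%nat -> z ^ n = 1 -> z ^ m = 1 -> z ^ Nat.gcd n m = 1.
Proof.
  intros Hn H1 H2. destruct (Nat.gcd_bezout_pos n m Hn) as [a [b E]].
  assert (K : z ^ (a * n) = z ^ (Nat.gcd n m + b * m)) by (rewrite E; reflexivity).
  rewrite Cpow_add_r, (Nat.mul_comm a), (Nat.mul_comm b), !Cpow_mult_r, H1, H2, !Cpow_1_l in K.
  rewrite K. ring.
Qed.

Lemma arrow_rotation n m k z d : d ^ cone_order n m k = 1 -> arrow n m (k, z) (k, d * z) d.
Proof. destruct k; simpl; intros H; split; auto. Qed.

(** The south coordinate reached when the logarithm of the north coordinate moves straight from 0 to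
    [u]. It depends on [u] itself: logarithms of one point may lead to different solutions v. *)
Definition spiral_end (n m : nat) (u : C) : C := cexp (RtoC (- (INR n / INR m)) * u).

Lemma arrow_spiral n m u : (0 < m)%nat ->
  arrow n m (north, cexp u) (south, spiral_end n m u) (- (INR n * spiral_end n m u) / (INR m * cexp u)).
Proof.
  intros Hm. assert (Nm' : INR m <> 0%R) by (apply not_0_INR; lia).
  split; [|reflexivity]. unfold spiral_end. rewrite !cexp_pow, <- cexp_plus, <- cexp_0. f_equal.
  rewrite RtoC_opp, RtoC_div by exact Nm'. simpl cone_order. field. apply INR_neq_0, Hm.
Qed.

Section Sections.
Context {n m : nat} (B : line_bundle n m).
Context (Hn : (0 < n)%nat) (Hm : (0 < m)%nat).
Context (s : chart -> lb_idx B -> C -> C) (Hs : forall k, parallel_on B k (fun _ => True) (s k)).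

Definition ratio (p q : point) (d : C) : C :=
  arrow_ratio B (fst p) (fst q) (s (fst p)) (s (fst q)) (snd p) (snd q) d.

Lemma ratio_unitary p q d : arrow n m p q d -> Cmod (ratio p q d) = 1%R.
Proof.
  destruct p, q. intros Ha. apply (arrow_ratio_unitary B _ _ (fun _ => True) (fun _ => True)); auto.
Qed.

Lemma ratio_comp p q r d e : arrow n m p q d -> arrow n m q r e ->
  ratio p r (e * d) = ratio q r e * ratio p q d.
Proof.
  destruct p, q, r. intros Ha Hb.
  apply (arrow_ratio_comp B _ _ _ (fun _ => True) (fun _ => True) (fun _ => True)); auto.
Qed.

Lemma ratio_id p : ratio p p 1 = 1.
Proof.
  pose proof (ratio_comp p p p 1 1 (arrow_id n m p) (arrow_id n m p)) as E.
  rewrite Cmult_1_l in E.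
  pose proof (Cmod_1_neq_0 _ (ratio_unitary p p 1 (arrow_id n m p))) as N.
  transitivity (ratio p p 1 * ratio p p 1 / ratio p p 1); [field; exact N|].
  rewrite <- E. field. exact N.
Qed.

(** The rotation by a fixed [d] is a smooth family of arrows over the whole chart, so its base point
    can be moved to the cone point along a segment. *)
Lemma ratio_rotation k z d : d ^ cone_order n m k = 1 ->
  ratio (k, z) (k, d * z) d = ratio (k, RtoC 0) (k, RtoC 0) d.
Proof.
  intros Hd. symmetry.
  set (c := fun t : R => RtoC 0 + RtoC t * z).
  transitivity (ratio (k, c 0%R) (k, d * c 0%R) d).
  { f_equal; f_equal; unfold c; ring. }
  transitivity (ratio (k, c 1%R) (k, d * c 1%R) d).
  2: { f_equal; f_equal; unfold c; ring. }
  apply (is_derive_C_zero (fun t => ratio (k, c t) (k, d * c t) d)); [lra|]. intros t _.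
  apply (arrow_ratio_curve B k k (fun _ => True) (fun _ => True) (s k) (s k) (fun _ => True)
    (fun z => d * z) (fun _ => d) c (fun t => d * c t) (fun _ => d) t z); auto using open_true.
  - split; [apply open_true|]. split; [|split].
    + apply csmooth_mult; [apply open_true | apply csmooth_const | apply csmooth_id, open_true].
    + apply csmooth_const.
    + intros w _. apply arrow_rotation, Hd.
  - apply is_derive_C_segment.
  - apply (is_derive_C_eq _ _ _ _ (is_derive_C_mult (fun _ => d) c t 0 z (is_derive_C_const d t)
      (is_derive_C_segment 0 z t))). ring.
  - apply filter_forall. auto.
Qed.

(** The arrows along the curve t |-> (e^(tu), e^(-(n/m)tu)) join (1,1) to the given end. The curve
    may wind around the cone point, so no single branch of the power covers it; each time [t] uses
    the half plane around the current argument. *)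
Lemma ratio_spiral u d : d = - (INR n * spiral_end n m u) / (INR m * cexp u) ->
  ratio (north, cexp u) (south, spiral_end n m u) d =
  ratio (north, RtoC 1) (south, RtoC 1) (- (INR n * 1) / (INR m * 1)).
Proof.
  intros ->. pose proof (INR_neq_0 m Hm) as Nm.
  assert (Nm' : INR m <> 0%R) by (apply not_0_INR; lia).
  set (c := fun t : R => cexp (RtoC t * u)).
  set (q := RtoC (- (INR n / INR m))).
  set (c' := fun t : R => cexp (RtoC t * (q * u))).
  set (dl := fun t : R => - (INR n * c' t) / (INR m * c t)).
  transitivity (ratio (north, c 1%R) (south, c' 1%R) (dl 1%R)).
  { unfold dl, c, c', spiral_end. fold q. rewrite !Cmult_1_l. reflexivity. }
  transitivity (ratio (north, c 0%R) (south, c' 0%R) (dl 0%R)).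
  2: { unfold dl, c, c'. rewrite !Cmult_0_l, cexp_0. reflexivity. }
  symmetry. apply (is_derive_C_zero (fun t => ratio (north, c t) (south, c' t) (dl t))); [lra|]. intros t _.
  set (a := Im (RtoC t * u)).
  (* Near [t] the argument stays within pi/2 of [a], the strip where [clog_cexp] identifies the
     branch with the spiral. *)
  assert (Hloc : locally t (fun t' => (Rabs (Im (RtoC t' * u) - a) < PI / 2)%R)).
  { assert (Cc : continuous (fun t' => Rabs (Im (RtoC t' * u) - a)) t).
    { apply (continuous_comp (fun t' => Im (RtoC t' * u) - a)%R Rabs); [|apply continuous_Rabs].
      apply continuous_ext with (fun t' => t' * Im u - a)%R; [intros; unfold Im; simpl; ring|].
      apply (continuous_minus (fun t' => t' * Im u)%R (fun _ => a)); [|apply continuous_const].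
      apply (continuous_mult (fun t' => t') (fun _ => Im u)); [apply continuous_id | apply continuous_const]. }
    apply (Cc (fun y => (y < PI / 2)%R)), (open_lt (PI / 2)). unfold a. rewrite Rminus_diag, Rabs_R0. pose proof PI_RGT_0. lra. }
  assert (Hphi : forall t', (Rabs (Im (RtoC t' * u) - a) < PI / 2)%R ->
    half_plane a (c t') /\ cpower a (- (INR n / INR m)) (c t') = c' t').
  { intros t' Ht. destruct (clog_cexp a (RtoC t' * u) Ht) as [H1 H2]. split; [exact H1|].
    unfold cpower, c, c'. rewrite H2. fold q. f_equal. ring. }
  apply (arrow_ratio_curve B north south (fun _ => True) (fun _ => True) (s north) (s south) (half_plane a)
    (cpower a (- (INR n / INR m)))
    (fun z => - (INR n * cpower a (- (INR n / INR m)) z) / (INR m * z))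
    c c' dl t (cexp (RtoC t * u) * u)); auto using open_true.
  - apply local_change_cpower; assumption.
  - apply Hphi. exact (locally_singleton _ _ Hloc).
  - apply is_derive_ray.
  - apply (is_derive_C_eq _ _ _ _ (is_derive_ray (q * u) t)).
    unfold dl, c, c', q. rewrite RtoC_opp, RtoC_div by exact Nm'. field.
    split; [apply cexp_neq_0 | exact Nm].
  - apply filter_imp with (2 := Hloc). intros t' Ht. destruct (Hphi t' Ht) as [_ E].
    split; [exact E|]. rewrite E. reflexivity.
Qed.

Notation zeta_of k := (zeta (cone_order n m k)).
Notation rot k := (ratio (k, RtoC 0) (k, RtoC 0)).

Lemma cone_order_pos k : (0 < cone_order n m k)%nat.
Proof. destruct k; assumption. Qed.

Lemma arrow_0 k d : d ^ cone_order n m k = 1 -> arrow n m (k, RtoC 0) (k, RtoC 0) d.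
Proof. intros H. pose proof (arrow_rotation n m k 0 d H) as A. rewrite Cmult_0_r in A. exact A. Qed.

Lemma zeta_pow_root k j : (zeta_of k ^ j) ^ cone_order n m k = 1.
Proof. rewrite <- Cpow_mult_r, Nat.mul_comm, Cpow_mult_r, zeta_order; [apply Cpow_1_l | apply cone_order_pos]. Qed.

Lemma zeta_root k : zeta_of k ^ cone_order n m k = 1.
Proof. apply zeta_order, cone_order_pos. Qed.

Lemma ratio_zeta_pow k j : rot k (zeta_of k ^ j) = rot k (zeta_of k) ^ j.
Proof.
  induction j as [|j IH]; [apply ratio_id|].
  rewrite !Cpow_S, <- IH. rewrite Cmult_comm, (Cmult_comm (rot k (zeta_of k))).
  apply ratio_comp; apply arrow_0; [apply zeta_root | apply zeta_pow_root].
Qed.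

Lemma ratio_zeta_root k : rot k (zeta_of k) ^ cone_order n m k = 1.
Proof. rewrite <- ratio_zeta_pow, zeta_root. apply ratio_id. Qed.

(* Transport along the spiral from (1,1) to (zeta_n, 1/zeta_m), followed by rotations at both ends. *)
Lemma ratio_zeta_south : rot south (zeta m) * rot north (zeta n) = 1.
Proof.
  pose proof (INR_neq_0 n Hn) as Nn. pose proof (INR_neq_0 m Hm) as Nm.
  assert (Nn' : INR n <> 0%R) by (apply not_0_INR; lia).
  assert (Nm' : INR m <> 0%R) by (apply not_0_INR; lia).
  pose proof (Cmod_1_neq_0 _ (zeta_norm n)) as Zn. pose proof (Cmod_1_neq_0 _ (zeta_norm m)) as Zm.
  set (u := (0, (2 * PI / INR n)%R) : C).
  assert (E1 : cexp u = zeta n).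
  { unfold cexp, zeta, u; simpl. rewrite exp_0. apply Cmult_1_l. }
  assert (E2 : zeta m * spiral_end n m u = 1).
  { unfold spiral_end, cexp, zeta, u; simpl.
    replace (- (INR n / INR m) * 0 - 0 * (2 * PI / INR n))%R with 0%R by ring.
    rewrite exp_0, Cmult_1_l, <- cis_plus, <- cis_0. f_equal. field. split; assumption. }
  set (w := spiral_end n m u) in *.
  set (d := - (INR n * w) / (INR m * cexp u)).
  pose proof (arrow_spiral n m u Hm) as A2. fold w d in A2. rewrite E1 in A2.
  pose proof (arrow_rotation n m north 1 (zeta n) (zeta_root north)) as A1. rewrite Cmult_1_r in A1.
  pose proof (arrow_rotation n m south w (zeta m) (zeta_root south)) as A3. rewrite E2 in A3.
  pose proof (arrow_comp _ _ _ _ _ _ _ Hn Hm A1 A2) as A12.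
  pose proof (ratio_comp _ _ _ _ _ A12 A3) as R123. rewrite (ratio_comp _ _ _ _ _ A1 A2) in R123.
  pose proof (ratio_spiral u d eq_refl) as R2. fold w in R2. rewrite E1 in R2. rewrite R2 in R123.
  pose proof (ratio_rotation north 1 (zeta n) (zeta_root north)) as R1. rewrite Cmult_1_r in R1. rewrite R1 in R123.
  pose proof (ratio_rotation south w (zeta m) (zeta_root south)) as R3. rewrite E2 in R3. rewrite R3 in R123.
  assert (Ed : zeta m * (d * zeta n) = - (INR n * 1) / (INR m * 1)).
  { unfold d. rewrite E1. transitivity (- (INR n * (zeta m * w)) / (INR m * 1)); [field; auto|]. rewrite E2. reflexivity. }
  rewrite Ed in R123.
  assert (N : ratio (north, RtoC 1) (south, RtoC 1) (- (INR n * 1) / (INR m * 1)) <> 0).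
  { apply Cmod_1_neq_0, ratio_unitary. split; [simpl; rewrite !Cpow_1_l; ring | reflexivity]. }
  set (l := ratio (north, RtoC 1) (south, RtoC 1) (- (INR n * 1) / (INR m * 1))) in *.
  transitivity (rot south (zeta m) * (l * rot north (zeta n)) / l); [field; exact N|].
  rewrite <- R123. field; exact N.
Qed.

End Sections.

Lemma Cpow_comm (z : C) a b : (z ^ a) ^ b = (z ^ b) ^ a.
Proof. rewrite <- !Cpow_mult_r, Nat.mul_comm. reflexivity. Qed.

Lemma zeta_div_gcd_l n m : (0 < n)%nat -> (0 < m)%nat -> zeta n ^ (n / Nat.gcd n m) = zeta (Nat.gcd n m).
Proof.
  intros Hn Hm. pose proof (div_gcd_l n m Hn Hm) as E.
  assert (Hk : (0 < n / Nat.gcd n m)%nat) by (destruct (n / Nat.gcd n m)%nat; [simpl in E; lia | lia]).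
  pose proof (zeta_mult (Nat.gcd n m) (n / Nat.gcd n m) (gcd_pos n m Hn Hm) Hk) as Z.
  rewrite <- E in Z. exact Z.
Qed.

Lemma zeta_div_gcd_r n m : (0 < n)%nat -> (0 < m)%nat -> zeta m ^ (m / Nat.gcd n m) = zeta (Nat.gcd n m).
Proof.
  intros Hn Hm. rewrite (Nat.gcd_comm n m). apply zeta_div_gcd_l; assumption.
Qed.

(** The c-th power of the torsion cocycle is chosen to cancel the rotation characters of B. What
    remains is 1 on rotations and one constant [l] on arrows from north to south, and rescaling the
    south section absorbs that constant. *)
Lemma twisted_section n m (B : line_bundle n m) : (0 < n)%nat -> (0 < m)%nat -> flat B ->
  exists (c : nat) (S : lb_idx B -> point -> C), (c < Nat.gcd n m)%nat /\
    (forall k, parallel_on B k (fun _ => True) (fun i z => S i (k, z))) /\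
    (forall i j p q d, lb_dom B i p -> lb_dom B j q -> arrow n m p q d ->
       S j q = torsion_cocycle n m p q d ^ c * lb_tr B i j p q d * S i p).
Proof.
  intros Hn Hm HF.
  assert (HS : exists s : chart -> lb_idx B -> C -> C, forall k, parallel_on B k (fun _ => True) (s k)).
  { destruct (parallel_on_plane B north HF) as [s1 H1], (parallel_on_plane B south HF) as [s2 H2].
    exists (fun k => match k with north => s1 | south => s2 end). intros [|]; assumption. }
  destruct HS as [s Hs].
  set (g := Nat.gcd n m).
  set (R := ratio B s).
  set (xi := R (north, RtoC 0) (north, RtoC 0) (zeta n)).
  set (xi' := R (south, RtoC 0) (south, RtoC 0) (zeta m)).
  assert (Hg : (0 < g)%nat) by (apply gcd_pos; assumption).
  assert (X1 : xi ^ n = 1) by (apply (ratio_zeta_root B Hn Hm s Hs north)).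
  assert (X2 : xi' ^ m = 1) by (apply (ratio_zeta_root B Hn Hm s Hs south)).
  assert (X3 : xi' * xi = 1) by (apply (ratio_zeta_south B Hn Hm s Hs)).
  assert (X4 : xi ^ m = 1).
  { transitivity (xi' ^ m * xi ^ m); [rewrite X2; ring|]. rewrite <- Cpow_mult_l, X3. apply Cpow_1_l. }
  (* As the inverse of the n-th root of unity [xi], the m-th root of unity [xi'] is also an n-th
     root, hence a g-th root; its exponent is the desired [c]. *)
  assert (X5 : xi' ^ n = 1).
  { transitivity (xi' ^ n * xi ^ n); [rewrite X1; ring|]. rewrite <- Cpow_mult_l, X3. apply Cpow_1_l. }
  destruct (root_zeta g xi' Hg (pow_gcd_eq_1 n m xi' Hn X5 X2)) as [c [Hc Exi']].
  set (K := fun p q d => torsion_cocycle n m p q d ^ c * R p q d).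
  assert (K_comp : forall p q r d e, arrow n m p q d -> arrow n m q r e -> K p r (e * d) = K q r e * K p q d).
  { intros p q r d e Ha Hb. unfold K, R.
    rewrite (torsion_cocycle_comp n m Hn Hm p q r d e Ha Hb), Cpow_mult_l, (ratio_comp B s Hs p q r d e Ha Hb).
    ring. }
  (* It suffices to treat powers of the generating rotation. In the north the torsion factor is
     [xi'], the inverse of [xi]; in the south it is xi'^(g-1), and xi'^g = 1. *)
  assert (K_rot : forall k z w d, arrow n m (k, z) (k, w) d -> K (k, z) (k, w) d = 1).
  { intros k z w d Ha.
    assert (Hd : d ^ cone_order n m k = 1 /\ w = d * z) by (destruct k; exact Ha).
    destruct Hd as [Hd ->].
    unfold K, R. rewrite (ratio_rotation B s Hs k z d Hd).
    destruct (root_zeta (cone_order n m k) d (cone_order_pos Hn Hm k) Hd) as [j [_ ->]].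
    rewrite (ratio_zeta_pow B Hn Hm s Hs k j).
    rewrite <- (Cpow_1_l j). destruct k; unfold torsion_cocycle; cbn [fst snd cone_order]; fold R xi xi'.
    - rewrite (Cpow_comm (zeta n) j), zeta_div_gcd_l by assumption. fold g.
      rewrite (Cpow_comm (zeta g) j), <- Exi', <- Cpow_mult_l, X3. reflexivity.
    - rewrite (Cpow_comm (zeta m) j), zeta_div_gcd_r by assumption. fold g.
      rewrite (Cpow_comm (zeta g) j), (Cpow_comm _ j c), <- Cpow_mult_l. f_equal.
      rewrite (Cpow_comm (zeta g) (g - 1) c), <- Exi'.
      rewrite <- (Cpow_1_r xi') at 2. rewrite <- Cpow_add_r. replace (g - 1 + 1)%nat with g by lia.
      apply pow_gcd_eq_1; assumption. }
  set (l := R (north, RtoC 1) (south, RtoC 1) (- (INR n * 1) / (INR m * 1))).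
  assert (A1 : arrow n m (north, RtoC 1) (south, RtoC 1) (- (INR n * 1) / (INR m * 1)))
    by (split; [simpl; rewrite !Cpow_1_l; ring | reflexivity]).
  assert (Nl : Cmod l = 1%R) by (apply (ratio_unitary B s Hs), A1).
  (* An arbitrary arrow to the south chart is the spiral arrow for a logarithm [u] of its source,
     followed by the south rotation [e]; the latter contributes 1 by [K_rot]. *)
  assert (K_ns : forall z w d, arrow n m (north, z) (south, w) d -> K (north, z) (south, w) d = l).
  { intros z w d [Ha Hd]. cbn [cone_order] in Ha, Hd.
    destruct (Cpow_mult_eq_1_neq_0 n m z w Hn Hm Ha) as [Nz Nw].
    destruct (cexp_surj z Nz) as [u ->].
    pose proof (arrow_spiral n m u Hm) as A2. pose proof (ratio_spiral B Hn Hm s Hs u _ eq_refl) as R2.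
    set (d2 := - (INR n * spiral_end n m u) / (INR m * cexp u)) in *.
    pose proof A2 as A2a. destruct A2 as [A2 _]. cbn [cone_order] in A2.
    destruct (Cpow_mult_eq_1_neq_0 n m _ _ Hn Hm A2) as [_ Nw2].
    set (w2 := spiral_end n m u) in *.
    set (e := w / w2).
    assert (A3 : arrow n m (south, w2) (south, w) e).
    { split; [|unfold e; field; exact Nw2]. cbn [cone_order]. unfold e. rewrite Cpow_div_l by exact Nw2.
      pose proof (Cpow_nz _ n Nz). pose proof (Cpow_nz _ m Nw2).
      transitivity (cexp u ^ n * w ^ m / (cexp u ^ n * w2 ^ m)); [field; auto|]. rewrite Ha, A2. field. }
    assert (Ed : d = e * d2).
    { rewrite Hd. unfold e, d2. pose proof (INR_neq_0 m Hm). field. auto. }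
    rewrite Ed, (K_comp _ (south, w2) _ d2 e A2a A3), (K_rot south _ _ _ A3).
    unfold K. fold R in R2. rewrite R2. fold l.
    (* Along a spiral the exponents of u^(n/g) and v^(m/g) cancel, because (n/g) m = (m/g) n. *)
    assert (T : torsion_cocycle n m (north, cexp u) (south, w2) d2 = 1).
    { unfold torsion_cocycle; cbn [fst snd].
      assert (E : cexp u ^ (n / Nat.gcd n m) * w2 ^ (m / Nat.gcd n m) = 1).
      { unfold w2, spiral_end. rewrite !cexp_pow, <- cexp_plus, <- cexp_0. f_equal.
        assert (Nm' : INR m <> 0%R) by (apply not_0_INR; lia).
        pose proof (INR_neq_0 m Hm) as Nm.
        rewrite RtoC_opp, RtoC_div by exact Nm'.
        assert (EE : RtoC (INR (n / Nat.gcd n m)) * RtoC (INR m) = RtoC (INR (m / Nat.gcd n m)) * RtoC (INR n)).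
        { rewrite <- !RtoC_mult, <- !mult_INR. do 2 f_equal.
          pose proof (div_gcd_l n m Hn Hm) as D1. pose proof (div_gcd_r n m Hn Hm) as D2.
          fold g in D1, D2 |- *.
          transitivity (n / g * (m / g * g))%nat; [f_equal; exact D2|].
          transitivity (m / g * (n / g * g))%nat; [ring | f_equal; symmetry; exact D1]. }
        transitivity ((RtoC (INR (n / Nat.gcd n m)) * RtoC (INR m) - RtoC (INR (m / Nat.gcd n m)) * RtoC (INR n)) / RtoC (INR m) * u);
          [field; exact Nm|]. rewrite EE. field. exact Nm. }
      rewrite E. apply Cpow_1_l. }
    rewrite T, Cpow_1_l. ring. }
  (* Rescaling by [mu] turns the constant [l] into a coboundary. Arrows from south to north follow
     by composing with their inverses, which yields a rotation. *)
  set (mu := fun k => match k with north => RtoC 1 | south => l end).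
  assert (Nmu : forall k, Cmod (mu k) = 1%R) by (intros [|]; [apply Cmod_1 | exact Nl]).
  assert (K_mu : forall p q d, arrow n m p q d -> K p q d * mu (fst p) = mu (fst q)).
  { intros [[|] z] [[|] w] d Ha; cbn [fst mu].
    - rewrite (K_rot north z w d Ha). ring.
    - rewrite (K_ns z w d Ha). ring.
    - pose proof (arrow_inv n m _ _ _ Hn Hm Ha) as Hb.
      pose proof (K_comp _ _ _ _ _ Hb Ha) as E. rewrite (K_ns w z _ Hb) in E.
      rewrite <- E. apply K_rot. apply (arrow_comp n m _ _ _ _ _ Hn Hm Hb Ha).
    - rewrite (K_rot south z w d Ha). ring. }
  exists c, (fun i p => mu (fst p) * s (fst p) i (snd p)). split; [exact Hc|]. split.
  - intros k. apply (parallel_on_scal B k (fun _ => True) (s k) (mu k)); [apply open_true | apply Nmu | apply Hs].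
  - intros i j [k z] [k' w] d Hi Hj Ha. cbn [fst snd].
    pose proof (K_mu _ _ _ Ha) as E. unfold K, R, ratio in E. cbn [fst snd] in E.
    rewrite (arrow_ratio_frames B k k' (fun _ => True) (fun _ => True) (s k) (s k') z w d i j) in E; auto.
    rewrite <- E.
    destruct (Hs k') as [N _]. pose proof (Cmod_1_conj_l _ (N j w I Hj)) as E1.
    transitivity (torsion_cocycle n m (k, z) (k', w) d ^ c * lb_tr B i j (k, z) (k', w) d * (mu k * s k i z) *
      (Cconj (s k' j w) * s k' j w)); [ring | rewrite E1; ring].
Qed.

(** * Classification *)

Section Classification.
Context {n m : nat} (Hn : (0 < n)%nat) (Hm : (0 < m)%nat).

Notation g := (Nat.gcd n m).
Notation T := (torsion_bundle n m Hn Hm).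

(** The twisted section of [tensor M (dual L)] is itself the isomorphism: parallelism is
    compatibility with the connections, and multiplication by the transition functions of [L] turns
    equivariance up to torsion into the intertwining identity. *)
Lemma isomorphic_twist (L M : line_bundle n m) :
  flat (tensor M (dual L)) -> exists c, (c < g)%nat /\ isomorphic L (tensor M (T c)).
Proof.
  intros HF. destruct (twisted_section n m (tensor M (dual L)) Hn Hm HF) as [c [S [Hc [HS HT]]]].
  exists c. split; [exact Hc|].
  exists (fun i j p => S (fst j, i) p). split; [|split].
  - intros i [j []] [k z] Hi [Hj _]. apply (HS k); [exact I | split; assumption].
  - intros i i' [j []] [j' []] p q d Hi Hi' [Hj _] [Hj' _] Ha. cbn [fst snd].
    pose proof (HT (j, i) (j', i') p q d (conj Hj Hi) (conj Hj' Hi') Ha) as ES.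
    change (S (j', i') q = torsion_cocycle n m p q d ^ c *
      (lb_tr M j j' p q d * Cconj (lb_tr L i i' p q d)) * S (j, i) p) in ES.
    change (S (j', i') q * lb_tr L i i' p q d =
      lb_tr M j j' p q d * torsion_cocycle n m p q d ^ c * S (j, i) p).
    rewrite ES.
    pose proof (Cmod_1_conj_l _ (lb_unitary _ _ L i i' p q d Hi Hi' Ha)) as E.
    transitivity (torsion_cocycle n m p q d ^ c * lb_tr M j j' p q d * S (j, i) p *
      (Cconj (lb_tr L i i' p q d) * lb_tr L i i' p q d)); [ring | rewrite E; ring].
  - intros i [j []] k U h. destruct (HS k) as [_ [_ [H3 H4]]]. split.
    + apply csmooth_subset with (2 := H3 (j, i)). intros z [Hz [Hz' _]]. split; [exact I | split; assumption].
    + intros z [Hz [Hz' _]]. destruct (H4 (j, i) z I (conj Hz' Hz)) as [E1 E2].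
      rewrite !pairing_1, !pairing_Ci. cbn [lb_conn tensor dual torsion_bundle fst snd] in *.
      rewrite !Rplus_0_r. split; [exact E1 | exact E2].
Qed.

Lemma isomorphic_tensor_trivial (L M : line_bundle n m) : isomorphic L (tensor M (T 0)) -> isomorphic L M.
Proof.
  intros [f [F1 [F2 F3]]]. exists (fun i j p => f i (j, tt) p). split; [|split].
  - intros i j p Hi Hj. apply F1; [exact Hi | split; [exact Hj | exact I]].
  - intros i i' j j' p q d Hi Hi' Hj Hj' Ha.
    rewrite (F2 i i' (j, tt) (j', tt) p q d) by first [assumption | split; [assumption | exact I]].
    cbn [lb_tr tensor torsion_bundle fst snd]. simpl Cpow. ring.
  - intros i j k U h. destruct (F3 i (j, tt) k) as [H1 H2]. split.
    + apply csmooth_subset with (2 := H1). intros z [Hz Hz']. repeat split; assumption.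
    + intros z [Hz Hz']. destruct (H2 z (conj Hz (conj Hz' I))) as [E1 E2].
      rewrite !pairing_1, !pairing_Ci in *. cbn [lb_conn tensor torsion_bundle fst snd] in *.
      rewrite !Rplus_0_r in *. split; [exact E1 | exact E2].
Qed.

(** An isomorphism commutes with the isotropy at the north cone point. The generator [zeta n] acts
    on the two fibres by the same scalar of [L] times zeta_g^a and zeta_g^b. *)
Lemma tensor_torsion_inj (L : line_bundle n m) a b : (a < g)%nat -> (b < g)%nat ->
  isomorphic (tensor L (T a)) (tensor L (T b)) -> a = b.
Proof.
  intros Ha Hb [f [F1 [F2 _]]].
  destruct (lb_cover n m L (north, RtoC 0)) as [i Hi].
  assert (A : arrow n m (north, RtoC 0) (north, RtoC 0) (zeta n))
    by (split; [apply zeta_order, Hn | ring]).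
  pose proof (F2 (i, tt) (i, tt) (i, tt) (i, tt) _ _ _ (conj Hi I) (conj Hi I) (conj Hi I) (conj Hi I) A) as E.
  pose proof (Cmod_1_neq_0 _ (F1 (i, tt) (i, tt) _ (conj Hi I) (conj Hi I))) as Nf.
  pose proof (Cmod_1_neq_0 _ (lb_unitary _ _ L i i _ _ _ Hi Hi A)) as Nt.
  cbn [lb_tr tensor torsion_bundle fst snd] in E. unfold torsion_cocycle in E. cbn [fst snd] in E.
  rewrite zeta_div_gcd_l in E by assumption.
  apply (zeta_pow_inj g); [exact Ha | exact Hb|].
  set (x := f (i, tt) (i, tt) (north, RtoC 0)) in *.
  set (y := lb_tr L i i (north, RtoC 0) (north, RtoC 0) (zeta n)) in *.
  transitivity (x * (y * zeta g ^ a) / (x * y)); [field; auto|]. rewrite E. field. auto.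
Qed.

(** * Holonomy around the generators *)

Lemma velocity_eq (c : R -> C) t v : is_derive_C c t v -> velocity c t = v.
Proof.
  intros H. apply is_derive_C_iff in H. destruct H as [H1 H2].
  apply injective_projections; apply is_derive_unique; assumption.
Qed.

Lemma cis_root_arrow k : let a := (2 * PI / INR (cone_order n m k))%R in
  arrow n m (k, cis a) (k, RtoC 1) (cis (- a)).
Proof.
  intros a. assert (E : (cis (- a)) ^ cone_order n m k = 1).
  { rewrite cis_opp, <- Cpow_conj. change (cis a) with (zeta (cone_order n m k)).
    rewrite zeta_order by (destruct k; assumption). apply injective_projections; simpl; ring. }
  pose proof (arrow_rotation n m k (cis a) _ E) as A. rewrite <- cis_plus, Rplus_opp_l, cis_0 in A. exact A.
Qed.

(** Pairing the section [S] of the dual with a parallel transport [y] gives a function that is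
    constant along the loop. All holonomy therefore comes from the closing arrow, under which [S] is
    equivariant up to the torsion factor. *)
Lemma holonomy_of_section (L : line_bundle n m) S c h k :
  (forall k, parallel_on (dual L) k (fun _ => True) (fun i z => S i (k, z))) ->
  (forall i j p q d, lb_dom L i p -> lb_dom L j q -> arrow n m p q d ->
       S j q = torsion_cocycle n m p q d ^ c * Cconj (lb_tr L i j p q d) * S i p) ->
  generator_holonomy L k h ->
  let a := (2 * PI / INR (cone_order n m k))%R in
  h = torsion_cocycle n m (k, cis a) (k, RtoC 1) (cis (- a)) ^ c.
Proof.
  intros HS HT [y [Hpar Hend]] a. fold a in Hpar, Hend.
  set (w := fun t : R => cis (a * t)) in *.
  assert (Dw : forall t, is_derive_C w t (Ci * w t * RtoC a)).
  { intros t. apply (is_derive_cis (fun t => a * t)%R t a). auto_derive; trivial; ring. }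
  set (Y := fun t => S (frame_at L (k, w t)) (k, w t) * y (frame_at L (k, w t)) t).
  assert (YE : forall t i, lb_dom L i (k, w t) -> Y t = S i (k, w t) * y i t).
  { intros t i Hi. unfold Y. pose proof (frame_at_dom L (k, w t)) as Hj. set (j := frame_at L (k, w t)) in *.
    destruct (HS k) as [_ [H2 _]]. rewrite (H2 i j (w t) I Hi Hj).
    rewrite (proj1 (Hpar t) i j Hi Hj). cbn [lb_tr dual].
    pose proof (Cmod_1_conj_l _ (lb_unitary _ _ L i j _ _ _ Hi Hj (arrow_id n m (k, w t)))) as E.
    transitivity (Cconj (lb_tr L i j (k, w t) (k, w t) 1) * lb_tr L i j (k, w t) (k, w t) 1 *
      (S i (k, w t) * y i t)); [ring | rewrite E; ring]. }
  (* The dual has the opposite connection form, so the two transport equations cancel. *)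
  assert (DY : forall t, is_derive_C Y t 0).
  { intros t. pose proof (frame_at_dom L (k, w t)) as Hi. set (i := frame_at L (k, w t)) in *.
    apply (is_derive_ext_loc (V := C_R_NormedModule) (fun t => S i (k, w t) * y i t)).
    - pose proof (is_derive_C_continuous _ _ _ (Dw t) _ (lb_open _ _ L i k _ Hi)) as Hl.
      apply (filter_imp (fun t' => lb_dom L i (k, w t'))); [|exact Hl].
      intros t' Ht. symmetry. apply YE, Ht.
    - pose proof (parallel_on_curve (dual L) k (fun _ => True) _ w t _ i open_true (HS k) (Dw t) I Hi) as D1.
      pose proof (proj2 (Hpar t) i Hi) as D2. rewrite (velocity_eq _ _ _ (Dw t)) in D2.
      apply (is_derive_C_eq _ _ _ _ (is_derive_C_mult _ _ _ _ _ D1 D2)).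
      cbn [lb_conn dual]. rewrite pairing_opp, RtoC_opp. ring. }
  assert (Y01 : Y 0%R = Y 1%R) by (apply is_derive_C_zero; [lra | intros; apply DY]).
  assert (w0 : w 0%R = 1) by (unfold w; rewrite Rmult_0_r; apply cis_0).
  assert (w1 : w 1%R = cis a) by (unfold w; rewrite Rmult_1_r; reflexivity).
  destruct (lb_cover _ _ L (k, cis a)) as [i Hi]. destruct (lb_cover _ _ L (k, RtoC 1)) as [j Hj].
  destruct (Hend i j Hi Hj) as [Ny E].
  rewrite (YE 0%R j), (YE 1%R i), w0, w1 in Y01 by (rewrite ?w0, ?w1; assumption).
  pose proof (cis_root_arrow k) as A. cbv zeta in A. fold a in A.
  pose proof (HT i j _ _ _ Hi Hj A) as ES.
  pose proof (Cmod_1_conj_l _ (lb_unitary _ _ L i j _ _ _ Hi Hj A)) as Et.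
  assert (NS : S j (k, RtoC 1) <> 0) by (apply Cmod_1_neq_0; apply (HS k); [exact I | exact Hj]).
  set (th := torsion_cocycle n m (k, cis a) (k, RtoC 1) (cis (- a)) ^ c) in *.
  set (tr := lb_tr L i j (k, cis a) (k, RtoC 1) (cis (- a))) in *.
  assert (K : h * (S j (k, RtoC 1) * y j 0%R) = th * (S j (k, RtoC 1) * y j 0%R)).
  { transitivity (S j (k, RtoC 1) * (h * y j 0%R)); [ring|]. rewrite <- E.
    rewrite Y01, ES at 1.
    transitivity (th * (Cconj tr * tr) * (S i (k, cis a) * y i 1%R)); [ring | rewrite Et; ring]. }
  transitivity (h * (S j (k, RtoC 1) * y j 0%R) / (S j (k, RtoC 1) * y j 0%R)); [field; auto|].
  rewrite K. field. auto.
Qed.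

(** The loop is closed by the rotation through 1/zeta_n, so the holonomy around x_1 is the inverse
    of zeta_g^c. In [torsion_south_value] the inverse built into the south cocycle gives zeta_g^c
    itself, in accordance with x_1 x_2 = 1. *)
Lemma torsion_north_value c : let a := (2 * PI / INR n)%R in
  torsion_cocycle n m (north, cis a) (north, RtoC 1) (cis (- a)) ^ c * zeta g ^ c = 1.
Proof.
  intros a. rewrite <- Cpow_mult_l. unfold torsion_cocycle; cbn [fst snd].
  rewrite <- (zeta_div_gcd_l n m Hn Hm), <- Cpow_mult_l.
  change (zeta n) with (cis a). rewrite <- cis_plus, Rplus_opp_l, cis_0, !Cpow_1_l. reflexivity.
Qed.

Lemma torsion_south_value c : let a := (2 * PI / INR m)%R in
  torsion_cocycle n m (south, cis a) (south, RtoC 1) (cis (- a)) ^ c = zeta g ^ c.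
Proof.
  intros a. f_equal. unfold torsion_cocycle; cbn [fst snd].
  assert (E : cis (- a) ^ (m / g) * zeta g = 1).
  { rewrite <- (zeta_div_gcd_r n m Hn Hm), <- Cpow_mult_l.
    change (zeta m) with (cis a). rewrite <- cis_plus, Rplus_opp_l, cis_0, Cpow_1_l. reflexivity. }
  pose proof (gcd_pos n m Hn Hm) as Hg.
  rewrite (root_pred_inv n m Hn Hm).
  - pose proof (Cmod_1_neq_0 _ (zeta_norm g)) as Nz.
    assert (N : cis (- a) ^ (m / g) <> 0) by (apply Cpow_nz, Cmod_1_neq_0, cis_norm).
    transitivity (/ cis (- a) ^ (m / g) * (cis (- a) ^ (m / g) * zeta g)); [rewrite E; ring | field; exact N].
  - transitivity ((cis (- a) ^ (m / g)) ^ g * zeta g ^ g); [rewrite (zeta_order g Hg); ring|].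
    rewrite <- Cpow_mult_l, E. apply Cpow_1_l.
Qed.

(** * Characters of the orbifold fundamental group *)

Notation x1 := ((north, false) :: nil : word).
Notation x2 := ((south, false) :: nil : word).

Lemma char_nil (chi : character n m) : chi nil = 1.
Proof.
  pose proof (char_mult _ _ chi nil nil) as E. simpl in E.
  pose proof (Cmod_1_neq_0 _ (char_unitary _ _ chi nil)) as N.
  transitivity (chi nil * chi nil / chi nil); [field; exact N|]. rewrite <- E. field. exact N.
Qed.

Lemma char_root (chi : character n m) k : chi ((k, false) :: nil) ^ cone_order n m k = 1.
Proof.
  rewrite <- (char_nil chi), <- (char_compat _ _ chi _ _ (pi1_cone n m k)).
  induction (cone_order n m k) as [|j IH]; [symmetry; apply char_nil|].
  rewrite Cpow_S, IH. symmetry. apply (char_mult _ _ chi ((k, false) :: nil)).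
Qed.

Lemma char_inverse (chi : character n m) : chi x1 * chi x2 = 1.
Proof.
  rewrite <- (char_mult _ _ chi x1 x2), <- (char_nil chi). apply char_compat, pi1_prod.
Qed.

(** By x_1 x_2 = 1 the value on x_2 is the inverse of an n-th root of unity, besides being an m-th
    root. *)
Lemma char_exponent (chi : character n m) : exists c, (c < g)%nat /\ chi x2 = zeta g ^ c.
Proof.
  apply root_zeta; [apply gcd_pos; assumption|].
  apply pow_gcd_eq_1; [exact Hn | | apply (char_root chi south)].
  transitivity (chi x1 ^ n * chi x2 ^ n); [rewrite (char_root chi north : chi x1 ^ n = 1); ring|].
  rewrite <- Cpow_mult_l, char_inverse. apply Cpow_1_l.
Qed.

(** The generator x_2 goes to zeta_g^c and x_1 to its inverse, written as a conjugate. This matches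
    the holonomy of the c-th torsion bundle. *)
Definition torsion_letter (c : nat) (x : chart * bool) : C :=
  match x with
  | (north, false) | (south, true) => Cconj (zeta g ^ c)
  | (north, true) | (south, false) => zeta g ^ c
  end.

Definition torsion_word (c : nat) (u : word) : C := fold_right (fun x z => torsion_letter c x * z) 1 u.

Lemma torsion_word_app c u v : torsion_word c (u ++ v) = torsion_word c u * torsion_word c v.
Proof. induction u as [|x u IH]; simpl; [ring | rewrite IH; ring]. Qed.

Lemma torsion_word_repeat c x k : torsion_word c (repeat x k) = torsion_letter c x ^ k.
Proof. induction k as [|k IH]; simpl; [reflexivity | rewrite IH; reflexivity]. Qed.

Lemma torsion_unit c : Cmod (zeta g ^ c) = 1%R.
Proof. rewrite Cmod_pow, zeta_norm. apply pow1. Qed.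

Lemma torsion_word_compat c u v : pi1_eq n m u v -> torsion_word c u = torsion_word c v.
Proof.
  pose proof (Cmod_1_conj_l _ (torsion_unit c)) as E.
  assert (R : forall k, (zeta g ^ c) ^ cone_order n m k = 1).
  { intros k. rewrite Cpow_comm.
    assert (K : zeta g ^ cone_order n m k = 1).
    { pose proof (gcd_pos n m Hn Hm) as Hg.
      destruct k; cbn [cone_order];
        [rewrite (div_gcd_l n m Hn Hm) at 2 | rewrite (div_gcd_r n m Hn Hm) at 2];
        rewrite Nat.mul_comm, Cpow_mult_r, (zeta_order g Hg); apply Cpow_1_l. }
    rewrite K. apply Cpow_1_l. }
  induction 1 as [u|u v _ IH|u v w _ IH1 _ IH2|u u' v v' _ IH1 _ IH2|x b|x|].
  - reflexivity.
  - symmetry; exact IH.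
  - rewrite IH1; exact IH2.
  - rewrite !torsion_word_app, IH1, IH2. reflexivity.
  - destruct x, b; simpl; rewrite Cmult_1_r; first [exact E | rewrite Cmult_comm; exact E].
  - rewrite torsion_word_repeat. destruct x; simpl torsion_letter.
    + rewrite <- Cpow_conj, R. apply injective_projections; simpl; ring.
    + apply R.
  - simpl. rewrite Cmult_1_r. exact E.
Qed.

Definition torsion_character (c : nat) : character n m.
Proof.
  refine (Character n m (torsion_word c) _ (torsion_word_app c) (torsion_word_compat c)).
  induction u as [|x u IH]; simpl; [apply Cmod_1|].
  rewrite Cmod_mult, IH. destruct x as [[|] [|]]; simpl torsion_letter; rewrite ?Cmod_conj, torsion_unit; ring.
Defined.

Lemma torsion_bundle_holonomy (chi : character n m) c : chi x2 = zeta g ^ c -> has_holonomy (T c) chi.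
Proof.
  (* With zero connection form the constant section is parallel, and the holonomy is the value of
     the cocycle on the closing arrow. *)
  intros E k. exists (fun _ _ => 1). split.
  - intros t. split.
    + intros i j _ _. cbn [lb_tr torsion_bundle].
      assert (E1 : torsion_cocycle n m (k, cis (2 * PI / INR (cone_order n m k) * t))
        (k, cis (2 * PI / INR (cone_order n m k) * t)) 1 = 1)
        by (destruct k; unfold torsion_cocycle; cbn [fst snd]; rewrite ?Cpow_1_l; reflexivity).
      rewrite E1, Cpow_1_l. ring.
    + intros i _. apply (is_derive_C_eq _ _ _ _ (is_derive_C_const 1 t)).
      unfold pairing. cbn [lb_conn torsion_bundle fst snd]. rewrite !Rmult_0_l, Rplus_0_l. ring.
  - intros i j _ _. split; [intros E0; apply RtoC_inj in E0; lra|].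
    rewrite !Cmult_1_r. cbn [lb_tr torsion_bundle]. destruct k; cbn [cone_order].
    + pose proof (torsion_north_value c) as V. cbv zeta in V. rewrite <- E in V.
      pose proof (char_inverse chi) as I1.
      pose proof (Cmod_1_neq_0 _ (char_unitary _ _ chi x2)) as N.
      match type of V with ?x * _ = _ => transitivity (x * chi x2 / chi x2); [field; exact N|] end.
      rewrite V, <- I1. field. exact N.
    + rewrite E. apply torsion_south_value.
Qed.

(** The twisted section of [dual L] identifies [L] with some torsion bundle, as in
    [isomorphic_twist]. Its exponent is read off from the holonomy around x_1. *)
Lemma flat_isomorphic (L : line_bundle n m) (chi : character n m) c : (c < g)%nat -> chi x2 = zeta g ^ c ->
  flat L -> has_holonomy L chi -> isomorphic L (T c).
Proof.
  intros Hc Echi HF Hh.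
  assert (HF' : flat (dual L)) by (intros i p Hi; rewrite curvature_dual, (HF i p Hi); ring).
  destruct (twisted_section n m (dual L) Hn Hm HF') as [c' [S [Hc' [HS HT]]]].
  pose proof (holonomy_of_section L S c' _ north HS HT (Hh north)) as E. cbv zeta in E. cbn [cone_order] in E.
  pose proof (torsion_north_value c') as V. cbv zeta in V. rewrite <- E in V.
  assert (c' = c).
  { apply (zeta_pow_inj g); [assumption | assumption|]. rewrite <- Echi.
    pose proof (char_inverse chi) as I1.
    pose proof (Cmod_1_neq_0 _ (char_unitary _ _ chi x1)) as N.
    transitivity (chi x1 * zeta g ^ c' / chi x1); [field; exact N|]. rewrite V, <- I1. field. exact N. }
  subst c'. exists (fun i _ p => S i p). split; [|split].
  - intros i i0 [k z] Hi _. apply (HS k); [exact I | exact Hi].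
  - intros i i' i0 i0' p q d Hi Hi' _ _ Ha. rewrite (HT i i' p q d Hi Hi' Ha).
    cbn [lb_tr dual torsion_bundle].
    pose proof (Cmod_1_conj_l _ (lb_unitary _ _ L i i' p q d Hi Hi' Ha)) as E2.
    transitivity (torsion_cocycle n m p q d ^ c * S i p *
      (Cconj (lb_tr L i i' p q d) * lb_tr L i i' p q d)); [ring | rewrite E2; ring].
  - intros i i0 k U h. destruct (HS k) as [_ [_ [H3 H4]]]. split.
    + apply csmooth_subset with (2 := H3 i). intros z [Hz _]. split; [exact I | exact Hz].
    + intros z [Hz _]. destruct (H4 i z I Hz) as [E1 E2].
      rewrite !pairing_1, !pairing_Ci. cbn [lb_conn dual torsion_bundle fst snd] in *.
      rewrite !Rminus_0_l. split; [exact E1 | exact E2].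
Qed.

Lemma prequantum_twist hbar w (L : line_bundle n m) c : prequantum hbar w L -> prequantum hbar w (tensor L (T c)).
Proof.
  intros HL [i j] p [Hi Hj]. rewrite curvature_tensor by assumption.
  rewrite (HL i p Hi), (torsion_bundle_flat n m Hn Hm c j p Hj). ring.
Qed.

(** Equal curvatures cancel in [tensor L (dual L')], which is therefore flat. *)
Lemma prequantum_isomorphic hbar w (L L' : line_bundle n m) : prequantum hbar w L -> prequantum hbar w L' ->
  exists c, (c < g)%nat /\ isomorphic L' (tensor L (T c)).
Proof.
  intros HL HL'. apply isomorphic_twist. intros [i j] p [Hi Hj].
  rewrite (curvature_tensor n m L (dual L') i j p Hi Hj), curvature_dual, (HL i p Hi), (HL' j p Hj). ring.
Qed.

End Classification.

Theorem proposition6p3 (n m : nat) (hbar : R) (w : point -> R) (L : line_bundle n m)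
  (hn : (2 <= n)%nat) (hm : (2 <= m)%nat) (hhbar : (0 < hbar)%R)
  (hw : symplectic n m w)
  (hint : exists (d0 : Z) (a b : nat), (a < n)%nat /\ (b < m)%nat /\
     (1 / (2 * PI * hbar) * orb_integral n m w
      = IZR d0 + INR a / INR n + INR b / INR m)%R)
  (hL : prequantum hbar w L) :
  exists F : character n m -> line_bundle n m,
    (forall chi, flat (F chi) /\ has_holonomy (F chi) chi /\
       forall F', flat F' -> has_holonomy F' chi -> isomorphic F' (F chi)) /\
    (forall L' : line_bundle n m, prequantum hbar w L' ->
       exists chi, isomorphic L' (tensor L (F chi))) /\
    (Nat.gcd n m = 1%nat ->
       forall L' : line_bundle n m, prequantum hbar w L' -> isomorphic L' L) /\
    ((1 < Nat.gcd n m)%nat ->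
       exactly_classes (Nat.gcd n m) (prequantum (n := n) (m := m) hbar w)).
Proof.
  assert (Hn : (0 < n)%nat) by lia. assert (Hm : (0 < m)%nat) by lia.
  (* The flat bundle of [chi] is the torsion bundle whose exponent [e chi] satisfies chi(x_2) =
     zeta_g^(e chi). *)
  set (e := fun chi => proj1_sig (constructive_indefinite_description _ (char_exponent Hn Hm chi))).
  assert (He : forall chi : character n m, (e chi < Nat.gcd n m)%nat /\
    chi ((south, false) :: nil) = zeta (Nat.gcd n m) ^ e chi)
    by (intros chi; apply (proj2_sig (constructive_indefinite_description _ (char_exponent Hn Hm chi)))).
  exists (fun chi => torsion_bundle n m Hn Hm (e chi)). split; [|split; [|split]].
  - intros chi. destruct (He chi) as [H1 H2]. split; [apply torsion_bundle_flat|]. split.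
    + apply torsion_bundle_holonomy, H2.
    + intros F' HF Hh. apply (flat_isomorphic Hn Hm F' chi); assumption.
  - intros L' HL'. destruct (prequantum_isomorphic Hn Hm hbar w L L' hL HL') as [c [Hc Hi]].
    exists (torsion_character Hn Hm c). destruct (He (torsion_character Hn Hm c)) as [H1 H2].
    (* The exponent was picked by choice, but below g it is unique, so the character built from [c]
       returns [c]. *)
    assert (E : e (torsion_character Hn Hm c) = c).
    { apply (zeta_pow_inj (Nat.gcd n m)); [exact H1 | exact Hc|]. rewrite <- H2. simpl. apply Cmult_1_r. }
    rewrite E. exact Hi.
  - intros Hg L' HL'. destruct (prequantum_isomorphic Hn Hm hbar w L L' hL HL') as [c [Hc Hi]].
    (* For g = 1 the only exponent below g is 0, and the zeroth torsion bundle is trivial. *)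
    assert (c = 0%nat) by lia. subst c. exact (isomorphic_tensor_trivial Hn Hm L' L Hi).
  - intros _. exists (fun a => tensor L (torsion_bundle n m Hn Hm a)). split; [|split].
    + intros a _. apply prequantum_twist, hL.
    + intros a b Ha Hb. apply tensor_torsion_inj; assumption.
    + intros L' HL'. apply (prequantum_isomorphic Hn Hm hbar w L L' hL HL').
Qed.
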